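(* Let $\mathcal O$ be a dg operad with a dg operad map $\phi:L_\infty\to\mathcal O$, let $A$ be a formal cdga, let $V$ be an $A$-linear $\mathcal O$ algebra and $\xi\in\mathrm{MC}(V,A)$. Then $V$ has the structure of an $A$-linear $\mathcal O_{\mathrm{MC}}$ algebra. Conversely, an $A$-linear $\mathcal O_{\mathrm{MC}}$ algebra gives rise to an $A$-linear $\mathcal O$ algebra $V$ together with a choice of an element in $\mathrm{MC}(V,A)$. (The $\mathcal O$ algebra structure is the restriction of the operad map along $\mathcal O\subset\mathcal O_{\mathrm{MC}}$ and the MC element is the image of $x$.)
   Context: $\mathbf k$ is a field of characteristic $0$; vector spaces are $\mathbb Z/2$-graded, dg means differential $\mathbb Z/2$-graded, $\Pi$ is parity reversion, Koszul signs are used. Operads are non-unital: collections $\mathcal O(n)$, $n\ge0$, with $S_n$-actions and partial compositions $\circ_i$. $\mathcal E(W)(n)=\mathrm{Hom}(W^{\otimes n},W)$ is the endomorphism operad. For $f\in\mathcal O(n)$, $f\circ x^{\otimes i}$ denotes inserting $x$ in the first $i$ inputs. $L_\infty$ is the dg operad freely generated by odd $S_n$-invariant $m_n\in L_\infty(n)$, $n\ge1$, with $d(m_n)=\sum_{k=1}^n\sum_{\sigma\in\mathrm{Sh}(n-k+1,k-1)}\sigma(m_k\circ_1m_{n-k+1})$. $\mathcal O_{\mathrm{MC}}$ is the topological dg operad with underlying graded operad $\mathcal O[[x]]$, the completion at the operadic ideal $(x)$ of the operad obtained from $\mathcal O$ by freely adjoining an even element $x$ of arity $0$; $\mathcal O\subset\mathcal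 O_{\mathrm{MC}}$ is a dg suboperad and $d(x)=\sum_{n\ge1}\frac1{n!}\phi(m_n)\circ x^{\otimes n}$. A formal cdga $A$ is obtained by adjoining a unit to an inverse limit $A_+$ of finite-dimensional nilpotent non-unital commutative dg algebras; tensor products with $A_+$ are completed. For a (possibly topological) dg operad $\mathcal P$, an $A$-linear $\mathcal P$ algebra structure on a dg vector space $V$ is a continuous map of dg operads $f:\mathcal P\to A_+\otimes\mathcal E(\Pi V)$. For an $A$-linear $\mathcal O$ algebra given by $f$, its $L_\infty$ structure maps are $\mu_n:=-f(\phi(m_n))$, $n\ge1$, and $\mathrm{MC}(V,A)=\mathrm{MC}_\phi(V,A)$ is the set of even $\xi\in A_+\otimes\Pi V$ with $(d_A\otimes\mathrm{id}+\mathrm{id}\otimes d_{\Pi V})(\xi)+\sum_{i\ge1}\frac1{i!}\mu_i(\xi^{\otimes i})=0$. *)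

(* Defs.v *)
From HB Require Import structures.
From mathcomp Require Import all_boot all_order all_algebra.
From mathcomp Require Import generic_quotient fingroup perm.
From mathcomp Require Import boolp zify.

Set Implicit Arguments.
Unset Strict Implicit.
Unset Printing Implicit Defensive.

Import GRing.Theory.
Local Open Scope ring_scope.
Local Open Scope quotient_scope.

Section LinearProp.
Variables (k : fieldType) (U V : lmodType k).

Lemma lin_sum (f : U -> V) (I : Type) (r : seq I) (F : I -> U) :
  linear f -> f (\sum_(i <- r) F i) = \sum_(i <- r) f (F i).
Proof.
move=> Hf; have f0 : f 0 = 0.
  have := Hf 1 0 0; rewrite !scale1r addr0 => /eqP.
  by rewrite -subr_eq subrr eq_sym => /eqP.
elim: r => [|i r IH]; first by rewrite !big_nil.
by rewrite !big_cons -[F i]scale1r Hf IH !scale1r.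
Qed.

Lemma lin0 (f : U -> V) : linear f -> f 0 = 0.
Proof. by move=> Hf; have := lin_sum [::] (fun _ : nat => 0) Hf; rewrite !big_nil. Qed.

Lemma linZ (f : U -> V) a u : linear f -> f (a *: u) = a *: f u.
Proof. by move=> Hf; rewrite -[a *: u]addr0 Hf lin0 // addr0. Qed.

Lemma linD (f : U -> V) u v : linear f -> f (u + v) = f u + f v.
Proof. by move=> Hf; rewrite -[u]scale1r Hf !scale1r. Qed.

Lemma linN (f : U -> V) u : linear f -> f (- u) = - f u.
Proof. by move=> Hf; rewrite -!scaleN1r linZ. Qed.

Lemma linB (f : U -> V) u v : linear f -> f (u - v) = f u - f v.
Proof. by move=> Hf; rewrite linD // linN. Qed.

Lemma linear_sum_fun (I : Type) (r : seq I) (F : I -> U -> V) :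
  (forall i, linear (F i)) -> linear (fun u => \sum_(i <- r) F i u).
Proof.
move=> HF a u v /=; rewrite scaler_sumr -big_split.
by apply: eq_bigr => i _; rewrite HF.
Qed.

Lemma linear_add_fun (f g : U -> V) :
  linear f -> linear g -> linear (fun u => f u + g u).
Proof. by move=> Hf Hg a u v /=; rewrite Hf Hg scalerDr addrACA. Qed.

Lemma linear_opp_fun (f : U -> V) : linear f -> linear (fun u => - f u).
Proof. by move=> Hf a u v /=; rewrite Hf opprD scalerN. Qed.

Lemma linear_scale_fun c (f : U -> V) : linear f -> linear (fun u => c *: f u).
Proof. by move=> Hf a u v /=; rewrite Hf scalerDr !scalerA mulrC. Qed.

End LinearProp.

Lemma linear_comp_fun (k : fieldType) (U V W : lmodType k)
    (g : V -> W) (f : U -> V) :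
  linear g -> linear f -> linear (fun u => g (f u)).
Proof. by move=> Hg Hf a u v /=; rewrite Hf Hg. Qed.

Lemma linear_id_fun (k : fieldType) (U : lmodType k) : linear (fun u : U => u).
Proof. by []. Qed.

(* A Z/2-grading is recorded by the projections onto the even (false) and odd
   (true) parts.  The axioms are in [is_graded]. *)
Record gmod (k : fieldType) := GMod {
  gcar :> lmodType k;
  gproj : bool -> gcar -> gcar;
  gproj_lin : forall b, linear (gproj b) }.

Section Graded.
Variables (k : fieldType) (V : gmod k).

Definition is_graded : Prop :=
  (forall v : V, gproj false v + gproj true v = v) /\
  (forall a b (v : V), gproj a (gproj b v) = if a == b then gproj b v else 0).

Definition homog (b : bool) (v : V) : Prop := gproj b v = v.

(* [koszul b v] is (-1)^(b |v|) v. *)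
Definition koszul (b : bool) (v : V) : V :=
  if b then gproj false v - gproj true v else v.

Definition is_diff (d : V -> V) : Prop :=
  [/\ linear d,
      forall b v, gproj (~~ b) (d v) = d (gproj b v) &
      forall v, d (d v) = 0].

Lemma koszul_lin b : linear (koszul b).
Proof.
rewrite /koszul; case: b; last exact: linear_id_fun.
apply: linear_add_fun; first exact: gproj_lin.
by apply: linear_opp_fun; exact: gproj_lin.
Qed.

End Graded.

Record dgvect (k : fieldType) := DGVect {
  dv_car :> gmod k;
  dv_d : dv_car -> dv_car;
  dv_graded : is_graded dv_car;
  dv_diff : is_diff dv_d }.

Lemma dv_lin k (V : dgvect k) : linear (@dv_d k V).
Proof. by case: (dv_diff V). Qed.

(* Parity reversion.  The identity of V is an odd map Pi : V -> Pi V, and the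
   differential satisfies d Pi = - Pi d. *)
Section ParityReversion.
Variables (k : fieldType) (V : dgvect k).

Definition pirev_gmod : gmod k :=
  @GMod k V (fun b => gproj (~~ b)) (fun b => @gproj_lin k V (~~ b)).

Definition pirev_d (v : pirev_gmod) : pirev_gmod := - dv_d (v : V).

Lemma pirev_graded : is_graded pirev_gmod.
Proof.
have [H1 H2] := dv_graded V; split=> [v|a b v] /=; first by rewrite addrC H1.
by rewrite H2 (inj_eq (can_inj negbK)).
Qed.

Lemma pirev_diff : is_diff pirev_d.
Proof.
have [H1 H2 H3] := dv_diff V; rewrite /pirev_d; split => /=.
- exact: linear_opp_fun.
- by move=> b v; rewrite linN ?H2 //; apply: (@gproj_lin k V).
- by move=> v; rewrite linN // H3 !oppr0.
Qed.

Definition pirev : dgvect k := DGVect pirev_graded pirev_diff.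
End ParityReversion.

(* [ocomp h i f g] is the partial composition inserting [g], of arity [n], in
   input [i] (counted from 0) of [f], of arity [m]; the result has arity
   p = m + n - 1, which is what [h] says.  [oact] is a left action for the
   usual composition of permutations (perm.v composes in the opposite order),
   normalised so that on multilinear maps
   (s . f)(w_1, ..., w_n) = +- f(w_s(1), ..., w_s(n)). *)
Record operad_sig (k : fieldType) := OperadSig {
  ocar :> nat -> gmod k;
  oact : forall n, 'S_n -> ocar n -> ocar n;
  ocomp : forall m n p, p.+1 = (m + n)%N -> 'I_m -> ocar m -> ocar n -> ocar p;
  oact_lin : forall n (s : 'S_n), linear (oact s);
  ocomp_linl : forall m n p (h : p.+1 = (m + n)%N) (i : 'I_m) (g : ocar n),
    linear (fun f => ocomp h i f g);
  ocomp_linr : forall m n p (h : p.+1 = (m + n)%N) (i : 'I_m) (f : ocar m),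
    linear (ocomp h i f) }.

(* In f o_i g with g of arity n, input [a] <> [i] of f becomes input
   [outer_pos i n a], and input [b] of g becomes input i + b. *)
Definition outer_pos (i n a : nat) : nat :=
  if (a < i)%N then a else (a + n).-1.

Record is_operad (k : fieldType) (P : operad_sig k) : Prop := IsOperad {
  op_graded : forall n, is_graded (P n);
  op_act1 : forall n (f : P n), oact 1%g f = f;
  op_actM : forall n (s t : 'S_n) (f : P n),
    oact (s * t)%g f = oact t (oact s f);
  op_act_proj : forall n (s : 'S_n) b (f : P n),
    gproj b (oact s f) = oact s (gproj b f);
  op_comp_homog : forall m n p (h : p.+1 = (m + n)%N) (i : 'I_m) a b
      (f : P m) (g : P n),
    homog a f -> homog b g -> homog (a (+) b) (ocomp h i f g);
  (* (f o_i g) o_(i+j) e = f o_i (g o_j e) *)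
  op_assoc : forall l m n p q r
      (h1 : p.+1 = (l + m)%N) (h2 : q.+1 = (p + n)%N)
      (h3 : r.+1 = (m + n)%N) (h4 : q.+1 = (l + r)%N)
      (i : 'I_l) (j : 'I_m) (c : 'I_p) (f : P l) (g : P m) (e : P n),
    c = (i + j)%N :> nat ->
    ocomp h2 c (ocomp h1 i f g) e = ocomp h4 i f (ocomp h3 j g e);
  (* (f o_i g) o_(j+m-1) e = (-1)^(|g||e|) (f o_j e) o_i g   for i < j *)
  op_par : forall l m n p q r
      (h1 : p.+1 = (l + m)%N) (h2 : q.+1 = (p + n)%N)
      (h3 : r.+1 = (l + n)%N) (h4 : q.+1 = (r + m)%N)
      (i j : 'I_l) (c : 'I_p) (c' : 'I_r) a b
      (f : P l) (g : P m) (e : P n),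
    (i < j)%N -> c.+1 = (j + m)%N -> c' = i :> nat ->
    homog a g -> homog b e ->
    ocomp h2 c (ocomp h1 i f g) e =
      (-1) ^+ (a && b) *: ocomp h4 c' (ocomp h3 j f e) g;
  op_equivariant : forall m n p (h : p.+1 = (m + n)%N) (i : 'I_m)
      (s : 'S_m) (t : 'S_n) (r : 'S_p) (f : P m) (g : P n),
    (forall (a : 'I_m) (c : 'I_p), a != i -> c = outer_pos i n a :> nat ->
       r c = outer_pos (s i) n (s a) :> nat) ->
    (forall (b : 'I_n) (c : 'I_p), c = (i + b)%N :> nat ->
       r c = (s i + t b)%N :> nat) ->
    oact r (ocomp h i f g) = ocomp h (s i) (oact s f) (oact t g) }.

Record operad (k : fieldType) := Operad {
  op_sig :> operad_sig k;
  op_axioms : is_operad op_sig }.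

Record operad_map (k : fieldType) (P Q : operad_sig k)
    (f : forall n, P n -> Q n) : Prop := OperadMap {
  om_lin : forall n, linear (@f n);
  om_proj : forall n b (u : P n), f n (gproj b u) = gproj b (f n u);
  om_act : forall n (s : 'S_n) (u : P n), f n (oact s u) = oact s (f n u);
  om_comp : forall m n p (h : p.+1 = (m + n)%N) (i : 'I_m) (u : P m) (v : P n),
    f p (ocomp h i u v) = ocomp h i (f m u) (f n v) }.

Record is_differential (k : fieldType) (P : operad_sig k)
    (d : forall n, P n -> P n) : Prop := IsDifferential {
  odiff_diff : forall n, is_diff (@d n);
  odiff_act : forall n (s : 'S_n) (f : P n), d n (oact s f) = oact s (d n f);
  odiff_comp : forall m n p (h : p.+1 = (m + n)%N) (i : 'I_m)
      (f : P m) (g : P n),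
    d p (ocomp h i f g) =
      ocomp h i (d m f) g + ocomp h i (koszul true f) (d n g) }.

Record dgoperad_sig (k : fieldType) := DGOperadSig {
  dg_sig :> operad_sig k;
  odiff : forall n, dg_sig n -> dg_sig n;
  odiff_lin : forall n, linear (@odiff n) }.

Record dgoperad (k : fieldType) := DGOperad {
  dgo_sig :> dgoperad_sig k;
  dgo_operad : is_operad dgo_sig;
  dgo_diff : is_differential (@odiff k dgo_sig) }.

Lemma differential_lin (k : fieldType) (P : operad_sig k)
    (d : forall n, P n -> P n) :
  is_differential d -> forall n, linear (@d n).
Proof. by move=> Hd n; have [] := odiff_diff Hd n. Qed.

Definition dgoperad_of (k : fieldType) (P : operad k)
    (d : forall n, P n -> P n) (Hd : is_differential d) : dgoperad k :=
  @DGOperad k (DGOperadSig (differential_lin Hd)) (op_axioms P) Hd.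

Definition underlying (k : fieldType) (P : dgoperad k) : operad k :=
  Operad (dgo_operad P).

Definition dgoperad_map (k : fieldType) (P Q : dgoperad_sig k)
    (f : forall n, P n -> Q n) : Prop :=
  operad_map f /\ forall n (u : P n), f n (odiff u) = odiff (f n u).

(* [fill x f] is f o x^(tensor n) for f of arity n: the element x of arity 0 is
   inserted n times in a row in the first remaining input. *)
Fixpoint fill (k : fieldType) (P : operad_sig k) (x : P 0%N) (n : nat) :
    P n -> P 0%N :=
  match n return P n -> P 0%N with
  | 0 => fun f => f
  | n'.+1 => fun f =>
      fill x (ocomp (esym (addn0 n'.+1)) (ord0 : 'I_n'.+1) f x)
  end.

(* A translation-invariant topology, given by a basis of neighbourhoods of 0. *)
Record lintop (k : fieldType) (V : lmodType k) := LinTop {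
  nb_index : Type;
  nb : nb_index -> V -> Prop }.

Definition discrete (k : fieldType) (V : lmodType k) : lintop V :=
  @LinTop k V unit (fun _ v => v = 0).

(* Meant for linear maps, for which continuity at 0 is continuity. *)
Definition lin_continuous (k : fieldType) (V W : lmodType k)
    (TV : lintop V) (TW : lintop W) (f : V -> W) : Prop :=
  forall j : nb_index TW, exists i : nb_index TV,
    forall v : V, nb i v -> nb j (f v).

Definition converges (k : fieldType) (V : lmodType k) (T : lintop V)
    (u : nat -> V) (l : V) : Prop :=
  forall j : nb_index T, exists N0 : nat, forall N, (N0 <= N)%N ->
    nb j (u N - l).

(* [rels I] states that the family [I] of elements of the graded operad Q
   satisfies the relations imposed on the generators. *)
Record presentation (k : fieldType) := Presentation {
  gens : nat -> Type;
  rels : forall Q : operad k, (forall n, gens n -> Q n) -> Prop }.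

(* Formal operadic expressions in the generators, two of which are identified
   when they take equal values in every graded operad for every choice of
   elements satisfying the relations. *)
Section Presented.
Variables (k : fieldType) (S : presentation k).

Inductive term : nat -> Type :=
  | TGen n (g : gens S n) : term n
  | TZero n : term n
  | TAdd n (t u : term n) : term n
  | TScale n (c : k) (t : term n) : term n
  | TProj n (b : bool) (t : term n) : term n
  | TAct n (s : 'S_n) (t : term n) : term n
  | TComp m n p (h : p.+1 = (m + n)%N) (i : 'I_m) (t : term m) (u : term n) :
      term p.

Fixpoint eval (Q : operad_sig k) (I : forall n, gens S n -> Q n)
    n (t : term n) : Q n :=
  match t in term n0 return Q n0 with
  | TGen _ g => I _ g
  | TZero _ => 0
  | TAdd _ t u => eval I t + eval I u
  | TScale _ c t => c *: eval I t
  | TProj _ b t => gproj b (eval I t)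
  | TAct _ s t => oact s (eval I t)
  | TComp _ _ _ h i t u => ocomp h i (eval I t) (eval I u)
  end.

Definition term_eq n : rel (term n) := fun t u =>
  `[< forall (Q : operad k) (I : forall n, gens S n -> Q n),
        rels I -> eval I t = eval I u >].

HB.instance Definition _ n := gen_eqMixin (term n).
HB.instance Definition _ n := gen_choiceMixin (term n).

Lemma term_eq_refl n : reflexive (@term_eq n).
Proof. by move=> t; apply/asboolP. Qed.

Lemma term_eq_sym n : symmetric (@term_eq n).
Proof.
move=> t u; apply/asboolP/asboolP => H Q I HI; by rewrite (H Q I HI).
Qed.

Lemma term_eq_trans n : transitive (@term_eq n).
Proof.
move=> t u v /asboolP H1 /asboolP H2; apply/asboolP => Q I HI.
by rewrite (H1 Q I HI) (H2 Q I HI).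
Qed.

Canonical term_equiv n :=
  EquivRel (@term_eq n) (@term_eq_refl n) (@term_eq_sym n) (@term_eq_trans n).

Definition pcar n : Type := {eq_quot (term_equiv n)}.
HB.instance Definition _ n := Choice.on (pcar n).

Definition pcls n (t : term n) : pcar n := \pi_({eq_quot (term_equiv n)})%qT t.
Definition prep n (f : pcar n) : term n := generic_quotient.repr (f : {eq_quot (term_equiv n)}).

Lemma prepK n (f : pcar n) : pcls (prep f) = f.
Proof. exact: reprK. Qed.

Lemma pclsP n (t u : term n) :
  (forall (Q : operad k) (I : forall n, gens S n -> Q n),
     rels I -> eval I t = eval I u) <-> pcls t = pcls u.
Proof.
split=> [H|H]; first by apply/(@eqmodP _ (term_equiv n))/asboolP.
by move: H => /(@eqmodP _ (term_equiv n)) /asboolP.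
Qed.

Lemma eval_prep n (t : term n) (Q : operad k) (I : forall n, gens S n -> Q n) :
  rels I -> eval I (prep (pcls t)) = eval I t.
Proof. by move: Q I; apply/pclsP; rewrite prepK. Qed.

Definition padd n (f g : pcar n) : pcar n := pcls (TAdd (prep f) (prep g)).
Definition pscale n (c : k) (f : pcar n) : pcar n := pcls (TScale c (prep f)).
Definition popp n (f : pcar n) : pcar n := pscale (-1) f.

Local Ltac by_models :=
  apply/pclsP => Q I ? /=; rewrite ?eval_prep //=; rewrite ?eval_prep //=.

Lemma paddA n : associative (@padd n).
Proof. by move=> f g h; by_models; rewrite addrA. Qed.
Lemma paddC n : commutative (@padd n).
Proof. by move=> f g; by_models; rewrite addrC. Qed.
Lemma padd0 n : left_id (pcls (TZero n)) (@padd n).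
Proof. by move=> f; rewrite -[RHS]prepK; by_models; rewrite add0r. Qed.
Lemma paddN n : left_inverse (pcls (TZero n)) (@popp n) (@padd n).
Proof. by move=> f; by_models; rewrite scaleN1r addNr. Qed.

HB.instance Definition _ n :=
  GRing.isZmodule.Build (pcar n) (@paddA n) (@paddC n) (@padd0 n) (@paddN n).

Lemma pscaleA n a b (f : pcar n) : pscale a (pscale b f) = pscale (a * b) f.
Proof. by by_models; rewrite scalerA. Qed.
Lemma pscale1 n : left_id 1 (@pscale n).
Proof. by move=> f; rewrite -[RHS]prepK; by_models; rewrite scale1r. Qed.
Lemma pscaleDr n : right_distributive (@pscale n) +%R.
Proof. by move=> c f g; by_models; rewrite scalerDr. Qed.
Lemma pscaleDl n (f : pcar n) : {morph (@pscale n)^~ f : a b / a + b}.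
Proof. by move=> a b; by_models; rewrite scalerDl. Qed.

HB.instance Definition _ n :=
  GRing.Zmodule_isLmodule.Build k (pcar n)
    (@pscaleA n) (@pscale1 n) (@pscaleDr n) (@pscaleDl n).

Definition pproj n (b : bool) (f : pcar n) : pcar n := pcls (TProj b (prep f)).
Definition pact n (s : 'S_n) (f : pcar n) : pcar n := pcls (TAct s (prep f)).
Definition pcomp m n p (h : p.+1 = (m + n)%N) (i : 'I_m)
    (f : pcar m) (g : pcar n) : pcar p := pcls (TComp h i (prep f) (prep g)).

Lemma pproj_lin n b : linear (@pproj n b).
Proof. by move=> a f g; by_models; rewrite (@gproj_lin k (Q n)). Qed.
Lemma pact_lin n (s : 'S_n) : linear (pact s).
Proof. by move=> a f g; by_models; rewrite oact_lin. Qed.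
Lemma pcomp_linl m n p (h : p.+1 = (m + n)%N) (i : 'I_m) (g : pcar n) :
  linear (fun f => pcomp h i f g).
Proof. by move=> a f f'; by_models; rewrite ocomp_linl. Qed.
Lemma pcomp_linr m n p (h : p.+1 = (m + n)%N) (i : 'I_m) (f : pcar m) :
  linear (pcomp h i f).
Proof. by move=> a g g'; by_models; rewrite ocomp_linr. Qed.

Definition presented_sig : operad_sig k :=
  @OperadSig k (fun n => GMod (@pproj_lin n)) pact pcomp
    pact_lin pcomp_linl pcomp_linr.

Lemma presented_is_operad : is_operad presented_sig.
Proof.
have hg n b (f : pcar n) : homog (V := presented_sig n) b f ->
    forall (Q : operad k) (I : forall n, gens S n -> Q n),
      rels I -> homog b (eval I (prep f)).
  move=> Hf Q I HI; rewrite /homog -{2}Hf /= eval_prep //.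
split; rewrite /homog /=.
- move=> n; split=> [f|a b f] /=.
    rewrite -[RHS]prepK; by_models.
    by have [-> _] := op_graded (op_axioms Q) n.
  case: eqP => ab; by_models; have [_ ->] := op_graded (op_axioms Q) n.
    by rewrite ab eqxx.
  by case: eqP ab.
- by move=> n f; rewrite -[RHS]prepK; by_models; exact: (op_act1 (op_axioms Q)).
- by move=> n s t f; by_models; exact: (op_actM (op_axioms Q)).
- by move=> n s b f; by_models; exact: (op_act_proj (op_axioms Q)).
- move=> m n p h i a b f g Hf Hg; by_models.
  by apply: (op_comp_homog (op_axioms Q)); exact: hg.
- move=> l m n p q r h1 h2 h3 h4 i j c f g e Hc; by_models.
  exact: (op_assoc (op_axioms Q)).
- move=> l m n p q r h1 h2 h3 h4 i j c c' a b f g e Hij Hc Hc' Hg He.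
  by_models; apply: (op_par (op_axioms Q)) => //; exact: hg.
- move=> m n p h i s t r f g Ho Hi; by_models.
  exact: (op_equivariant (op_axioms Q)).
Qed.

Definition presented : operad k := Operad presented_is_operad.

Definition generator n (g : gens S n) : presented n := pcls (TGen g).

End Presented.

Record is_ideal (k : fieldType) (P : operad_sig k)
    (J : forall n, P n -> Prop) : Prop := IsIdeal {
  ideal0 : forall n, J n 0;
  ideal_lin : forall n c (f g : P n), J n f -> J n g -> J n (c *: f + g);
  ideal_proj : forall n b (f : P n), J n f -> J n (gproj b f);
  ideal_act : forall n (s : 'S_n) (f : P n), J n f -> J n (oact s f);
  ideal_compl : forall m n p (h : p.+1 = (m + n)%N) (i : 'I_m)
      (f : P m) (g : P n), J m f -> J p (ocomp h i f g);
  ideal_compr : forall m n p (h : p.+1 = (m + n)%N) (i : 'I_m)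
      (f : P m) (g : P n), J n g -> J p (ocomp h i f g) }.

Record ideal (k : fieldType) (P : operad_sig k) := Ideal {
  imem :> forall n, P n -> Prop;
  idealP : is_ideal imem }.

Section GeneratedIdeal.
Variables (k : fieldType) (P : operad_sig k) (a : nat) (x : P a).

Definition gen_ideal_mem n (f : P n) : Prop :=
  forall J : ideal P, J a x -> J n f.

Lemma gen_ideal_is_ideal : is_ideal gen_ideal_mem.
Proof.
split.
- by move=> n J _; exact: (ideal0 (idealP J)).
- by move=> n c f g Hf Hg J HJ; apply: (ideal_lin (idealP J)); auto.
- by move=> n b f Hf J HJ; apply: (ideal_proj (idealP J)); auto.
- by move=> n s f Hf J HJ; apply: (ideal_act (idealP J)); auto.
- by move=> m n p h i f g Hf J HJ; apply: (ideal_compl (idealP J)); auto.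
- by move=> m n p h i f g Hf J HJ; apply: (ideal_compr (idealP J)); auto.
Qed.

Definition gen_ideal : ideal P := Ideal gen_ideal_is_ideal.
End GeneratedIdeal.

Section Completion.
Variables (k : fieldType) (P : operad k) (J : ideal P).

(* The power J^N: the span of the operadic composites with at least N factors
   in J. *)
Inductive ipow : nat -> forall n, P n -> Prop :=
  | ipow_any n (f : P n) : ipow 0 f
  | ipow_mem n (f : P n) : J n f -> ipow 1 f
  | ipow_0 N n : ipow N (0 : P n)
  | ipow_lin N n c (f g : P n) : ipow N f -> ipow N g -> ipow N (c *: f + g)
  | ipow_act N n (s : 'S_n) (f : P n) : ipow N f -> ipow N (oact s f)
  | ipow_comp M N m n p (h : p.+1 = (m + n)%N) (i : 'I_m) (f : P m) (g : P n) :
      ipow M f -> ipow N g -> ipow (M + N) (ocomp h i f g).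

Lemma ipowD N n (f g : P n) : ipow N f -> ipow N g -> ipow N (f + g).
Proof. by move=> Hf Hg; rewrite -[f]scale1r; apply: ipow_lin. Qed.

Lemma ipowZ N n c (f : P n) : ipow N f -> ipow N (c *: f).
Proof. by move=> Hf; rewrite -[_ *: _]addr0; apply: ipow_lin => //; exact: ipow_0. Qed.

Lemma ipowN N n (f : P n) : ipow N f -> ipow N (- f).
Proof. by rewrite -scaleN1r; exact: ipowZ. Qed.

Lemma ipowB N n (f g : P n) : ipow N f -> ipow N g -> ipow N (f - g).
Proof. by move=> Hf Hg; apply: ipowD => //; exact: ipowN. Qed.

Lemma gproj_comp m n p (h : p.+1 = (m + n)%N) (i : 'I_m) b
    (f : P m) (g : P n) :
  gproj b (ocomp h i f g) =
    \sum_(c : bool) ocomp h i (gproj c f) (gproj (b (+) c) g).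
Proof.
have [sf pf] := op_graded (op_axioms P) m.
have [sg pg] := op_graded (op_axioms P) n.
have [_ pp] := op_graded (op_axioms P) p.
have hom c d : gproj (c (+) d) (ocomp h i (gproj c f) (gproj d g)) =
    ocomp h i (gproj c f) (gproj d g).
  by apply: (op_comp_homog (op_axioms P)); rewrite /homog ?pf ?pg eqxx.
have E : ocomp h i f g =
    \sum_(c : bool) \sum_(d : bool) ocomp h i (gproj c f) (gproj d g).
  rewrite big_bool !big_bool /= addrC ![ocomp _ _ _ (gproj true g) + _]addrC.
  rewrite -!(linD _ _ (ocomp_linr h i _)) sg.
  by rewrite -(linD _ _ (ocomp_linl h i g)) sf.
rewrite E (lin_sum _ _ (@gproj_lin k (P p) b)); apply: eq_bigr => c _.
rewrite (lin_sum _ _ (@gproj_lin k (P p) b)) (bigD1 (b (+) c)) //= big1.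
  by rewrite addr0 -{1}[b](addbK c) [(b (+) c) (+) c]addbC hom.
move=> d Hd; rewrite -hom pp; case: eqP => // Hb.
by move: Hd; rewrite Hb -addbA addbC -addbA addbb addbF eqxx.
Qed.

Lemma ipow_proj N n b (f : P n) : ipow N f -> ipow N (gproj b f).
Proof.
move=> H; elim: H b => {N n f}.
- by move=> n f b; exact: ipow_any.
- by move=> n f Hf b; apply: ipow_mem; exact: (ideal_proj (idealP J)).
- by move=> N n b; rewrite (lin0 (@gproj_lin k (P n) b)); exact: ipow_0.
- by move=> N n c f g _ Hf _ Hg b; rewrite (@gproj_lin k (P n) b); apply: ipow_lin.
- move=> N n s f _ Hf b; rewrite (op_act_proj (op_axioms P)).
  by apply: ipow_act.
- move=> M N m n p h i f g _ Hf _ Hg b; rewrite gproj_comp.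
  by rewrite big_bool; apply: ipowD; apply: ipow_comp.
Qed.

(* An element of the inverse limit of the P n / J^N n is represented by a
   sequence of elements of P n that is compatible modulo the powers of J. *)
Record cseq n := CSeq {
  cterm :> nat -> P n;
  cterm_compat : forall N, ipow N (cterm N.+1 - cterm N) }.

Definition cseq_eq n : rel (cseq n) := fun u v =>
  `[< forall N, ipow N (u N - v N) >].

HB.instance Definition _ n := gen_eqMixin (cseq n).
HB.instance Definition _ n := gen_choiceMixin (cseq n).

Lemma cseq_eq_refl n : reflexive (@cseq_eq n).
Proof. by move=> u; apply/asboolP => N; rewrite subrr; exact: ipow_0. Qed.

Lemma cseq_eq_sym n : symmetric (@cseq_eq n).
Proof.
by move=> u v; apply/asboolP/asboolP => H N; rewrite -opprB; apply: ipowN.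
Qed.

Lemma cseq_eq_trans n : transitive (@cseq_eq n).
Proof.
move=> u v w /asboolP H1 /asboolP H2; apply/asboolP => N.
by rewrite -[v N](addrNK (u N)) -addrA; apply: ipowD.
Qed.

Canonical cseq_equiv n :=
  EquivRel (@cseq_eq n) (@cseq_eq_refl n) (@cseq_eq_sym n) (@cseq_eq_trans n).

Definition ccar n : Type := {eq_quot (cseq_equiv n)}.
HB.instance Definition _ n := Choice.on (ccar n).

Definition ccls n (u : cseq n) : ccar n := \pi_({eq_quot (cseq_equiv n)}) u.
Definition crep n (f : ccar n) : cseq n :=
  generic_quotient.repr (f : {eq_quot (cseq_equiv n)}).

Lemma crepK n (f : ccar n) : ccls (crep f) = f.
Proof. exact: reprK. Qed.

Lemma cclsP n (u v : cseq n) :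
  (forall N, ipow N (u N - v N)) <-> ccls u = ccls v.
Proof.
split=> [H|H]; first by apply/(@eqmodP _ (cseq_equiv n))/asboolP.
by move: H => /(@eqmodP _ (cseq_equiv n)) /asboolP.
Qed.

Lemma crep_ccls n (u : cseq n) N : ipow N (crep (ccls u) N - u N).
Proof. by apply: (proj2 (cclsP (crep (ccls u)) u)); rewrite crepK. Qed.

Lemma cseq_map_compat m n (F : P m -> P n) (u : cseq m) :
  linear F -> (forall N f, ipow N f -> ipow N (F f)) ->
  forall N, ipow N (F (u N.+1) - F (u N)).
Proof. by move=> HF Hp N; rewrite -linB //; apply: Hp; exact: cterm_compat. Qed.

Definition cconst n (f : P n) : cseq n.
Proof. by exists (fun _ => f) => N; rewrite subrr; exact: ipow_0. Defined.

Definition cseq_add n (u v : cseq n) : cseq n.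
Proof.
exists (fun N => u N + v N) => N.
by rewrite opprD addrACA; apply: ipowD; exact: cterm_compat.
Defined.

Definition cseq_scale n (c : k) (u : cseq n) : cseq n.
Proof.
exists (fun N => c *: u N) => N.
by rewrite -scalerBr; apply: ipowZ; exact: cterm_compat.
Defined.

Definition cseq_proj n (b : bool) (u : cseq n) : cseq n.
Proof.
exists (fun N => gproj b (u N)) => N.
apply: (@cseq_map_compat n n) => [|M f]; first exact: gproj_lin.
exact: ipow_proj.
Defined.

Definition cseq_act n (s : 'S_n) (u : cseq n) : cseq n.
Proof.
exists (fun N => oact s (u N)) => N.
apply: (@cseq_map_compat n n) => [|M f]; first exact: oact_lin.
exact: ipow_act.
Defined.

Lemma comp_ipow m n p (h : p.+1 = (m + n)%N) (i : 'I_m) N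
    (f f' : P m) (g g' : P n) :
  ipow N (f - f') -> ipow N (g - g') ->
  ipow N (ocomp h i f g - ocomp h i f' g').
Proof.
move=> Hf Hg; rewrite -[f](subrK f') (linD _ _ (ocomp_linl h i g)).
rewrite -addrA; apply: ipowD.
  by rewrite -[N]addn0; apply: ipow_comp => //; exact: ipow_any.
rewrite -(linB _ _ (ocomp_linr h i f')) -[N]add0n.
by apply: ipow_comp => //; exact: ipow_any.
Qed.

Definition cseq_comp m n p (h : p.+1 = (m + n)%N) (i : 'I_m)
    (u : cseq m) (v : cseq n) : cseq p.
Proof.
exists (fun N => ocomp h i (u N) (v N)) => N.
by apply: comp_ipow; exact: cterm_compat.
Defined.

Definition cadd n (f g : ccar n) : ccar n := ccls (cseq_add (crep f) (crep g)).
Definition cscale n (c : k) (f : ccar n) : ccar n := ccls (cseq_scale c (crep f)).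
Definition copp n (f : ccar n) : ccar n := cscale (-1) f.
Definition cproj n (b : bool) (f : ccar n) : ccar n := ccls (cseq_proj b (crep f)).
Definition cact n (s : 'S_n) (f : ccar n) : ccar n :=
  ccls (cseq_act s (crep f)).
Definition ccomp m n p (h : p.+1 = (m + n)%N) (i : 'I_m)
    (f : ccar m) (g : ccar n) : ccar p :=
  ccls (cseq_comp h i (crep f) (crep g)).

Lemma cadd_cls n (u v : cseq n) : cadd (ccls u) (ccls v) = ccls (cseq_add u v).
Proof.
apply/cclsP => N /=; rewrite opprD addrACA.
by apply: ipowD; exact: crep_ccls.
Qed.

Lemma cscale_cls n c (u : cseq n) : cscale c (ccls u) = ccls (cseq_scale c u).
Proof. by apply/cclsP => N /=; rewrite -scalerBr; apply: ipowZ; exact: crep_ccls. Qed.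

Lemma cproj_cls n b (u : cseq n) : cproj b (ccls u) = ccls (cseq_proj b u).
Proof.
apply/cclsP => N /=; rewrite -(linB _ _ (@gproj_lin k (P n) b)).
by apply: ipow_proj; exact: crep_ccls.
Qed.

Lemma cact_cls n (s : 'S_n) (u : cseq n) : cact s (ccls u) = ccls (cseq_act s u).
Proof.
apply/cclsP => N /=; rewrite -(linB _ _ (oact_lin s)).
by apply: ipow_act; exact: crep_ccls.
Qed.

Lemma ccomp_cls m n p (h : p.+1 = (m + n)%N) (i : 'I_m)
    (u : cseq m) (v : cseq n) :
  ccomp h i (ccls u) (ccls v) = ccls (cseq_comp h i u v).
Proof. by apply/cclsP => N /=; apply: comp_ipow; exact: crep_ccls. Qed.

Lemma ccls_eq n (u v : cseq n) : (forall N, u N = v N) -> ccls u = ccls v.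
Proof. by move=> H; apply/cclsP => N; rewrite H subrr; exact: ipow_0. Qed.

Definition cclsE := (cadd_cls, cscale_cls, cproj_cls, cact_cls, ccomp_cls).

Lemma caddA n : associative (@cadd n).
Proof.
move=> f g h; rewrite -[f]crepK -[g]crepK -[h]crepK !cclsE.
by apply: ccls_eq => N /=; rewrite addrA.
Qed.
Lemma caddC n : commutative (@cadd n).
Proof.
move=> f g; rewrite -[f]crepK -[g]crepK !cclsE.
by apply: ccls_eq => N /=; rewrite addrC.
Qed.
Lemma cadd0 n : left_id (ccls (cconst (0 : P n))) (@cadd n).
Proof.
by move=> f; rewrite -[f]crepK !cclsE; apply: ccls_eq => N /=; rewrite add0r.
Qed.
Lemma caddN n : left_inverse (ccls (cconst (0 : P n))) (@copp n) (@cadd n).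
Proof.
move=> f; rewrite -[f]crepK /copp !cclsE.
by apply: ccls_eq => N /=; rewrite scaleN1r addNr.
Qed.

HB.instance Definition _ n :=
  GRing.isZmodule.Build (ccar n) (@caddA n) (@caddC n) (@cadd0 n) (@caddN n).

Lemma cscaleA n a b (f : ccar n) : cscale a (cscale b f) = cscale (a * b) f.
Proof.
by rewrite -[f]crepK !cclsE; apply: ccls_eq => N /=; rewrite scalerA.
Qed.
Lemma cscale1 n : left_id 1 (@cscale n).
Proof.
by move=> f; rewrite -[f]crepK !cclsE; apply: ccls_eq => N /=; rewrite scale1r.
Qed.
Lemma cscaleDr n : right_distributive (@cscale n) +%R.
Proof.
move=> c f g; rewrite -[f]crepK -[g]crepK.
rewrite [ccls _ + ccls _]cadd_cls !cscale_cls [RHS]cadd_cls.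
by apply: ccls_eq => N /=; rewrite scalerDr.
Qed.
Lemma cscaleDl n (f : ccar n) : {morph (@cscale n)^~ f : a b / a + b}.
Proof.
move=> a b; rewrite -[f]crepK !cscale_cls [RHS]cadd_cls.
by apply: ccls_eq => N /=; rewrite scalerDl.
Qed.

HB.instance Definition _ n :=
  GRing.Zmodule_isLmodule.Build k (ccar n)
    (@cscaleA n) (@cscale1 n) (@cscaleDr n) (@cscaleDl n).

Lemma clin_cls n c (u v : cseq n) :
  c *: ccls u + ccls v = ccls (cseq_add (cseq_scale c u) v).
Proof. by rewrite [c *: _]cscale_cls [LHS]cadd_cls. Qed.

Lemma cproj_lin n b : linear (@cproj n b).
Proof.
move=> a f g; rewrite -[f]crepK -[g]crepK !(clin_cls, cproj_cls).
by apply: ccls_eq => N /=; rewrite (@gproj_lin k (P n)).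
Qed.
Lemma cact_lin n (s : 'S_n) : linear (cact s).
Proof.
move=> a f g; rewrite -[f]crepK -[g]crepK !(clin_cls, cact_cls).
by apply: ccls_eq => N /=; rewrite oact_lin.
Qed.
Lemma ccomp_linl m n p (h : p.+1 = (m + n)%N) (i : 'I_m) (g : ccar n) :
  linear (fun f => ccomp h i f g).
Proof.
move=> a f f'; rewrite -[f]crepK -[f']crepK -[g]crepK !(clin_cls, ccomp_cls).
by apply: ccls_eq => N /=; rewrite ocomp_linl.
Qed.
Lemma ccomp_linr m n p (h : p.+1 = (m + n)%N) (i : 'I_m) (f : ccar m) :
  linear (ccomp h i f).
Proof.
move=> a g g'; rewrite -[f]crepK -[g]crepK -[g']crepK !(clin_cls, ccomp_cls).
by apply: ccls_eq => N /=; rewrite ocomp_linr.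
Qed.

Definition completion_sig : operad_sig k :=
  @OperadSig k (fun n => GMod (@cproj_lin n)) cact ccomp
    cact_lin ccomp_linl ccomp_linr.

Lemma completion_is_operad : is_operad completion_sig.
Proof.
have H n := op_graded (op_axioms P) n.
have homE n b (f : ccar n) : homog (V := completion_sig n) b f ->
    exists2 u : cseq n, f = ccls u & forall N, homog b (u N).
  move=> Hf; exists (cseq_proj b (crep f)); first by rewrite -[LHS]Hf.
  by move=> N; rewrite /homog /=; have [_ ->] := H n; rewrite eqxx.
split.
- move=> n; split=> [f|a b f]; rewrite -[f]crepK /=.
    rewrite !cproj_cls [LHS]cadd_cls; apply: ccls_eq => N /=.
    by have [-> _] := H n.
  rewrite !cproj_cls; case: (a =P b) => ab.
    apply: ccls_eq => N /=; have [_ ->] := H n; by rewrite ab eqxx.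
  apply: ccls_eq => N /=; have [_ ->] := H n.
  by case: eqP ab.
- move=> n f; rewrite -[f]crepK /= cact_cls.
  by apply: ccls_eq => N /=; exact: (op_act1 (op_axioms P)).
- move=> n s t f; rewrite -[f]crepK /= !cact_cls.
  by apply: ccls_eq => N /=; exact: (op_actM (op_axioms P)).
- move=> n s b f; rewrite -[f]crepK /= !(cact_cls, cproj_cls).
  by apply: ccls_eq => N /=; exact: (op_act_proj (op_axioms P)).
- move=> m n p h i a b f g /homE [u -> Hu] /homE [v -> Hv].
  rewrite /homog /= !(ccomp_cls, cproj_cls); apply: ccls_eq => N /=.
  exact: (op_comp_homog (op_axioms P)).
- move=> l m n p q r h1 h2 h3 h4 i j c f g e Hc.
  rewrite -[f]crepK -[g]crepK -[e]crepK /= !ccomp_cls.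
  by apply: ccls_eq => N /=; exact: (op_assoc (op_axioms P)).
- move=> l m n p q r h1 h2 h3 h4 i j c c' a b f g e Hij Hc Hc'.
  move=> /homE [u -> Hu] /homE [v -> Hv]; rewrite -[f]crepK /= !ccomp_cls.
  rewrite [RHS]cscale_cls; apply: ccls_eq => N /=.
  exact: (op_par (op_axioms P)).
- move=> m n p h i s t r f g Ho Hi; rewrite -[f]crepK -[g]crepK /=.
  rewrite !(cact_cls, ccomp_cls); apply: ccls_eq => N /=.
  exact: (op_equivariant (op_axioms P)).
Qed.

Definition completion : operad k := Operad completion_is_operad.

Definition completion_incl n (f : P n) : completion n := ccls (cconst f).

(* The kernels of the projections to P n / J^N n are the basic neighbourhoods
   of 0. *)
Definition completion_top n : lintop (completion n) :=
  @LinTop k (completion n) nat (fun N f => ipow N (crep f N)).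

End Completion.

Section FormalAdjunction.
Variables (k : fieldType) (O : operad k).

Inductive adj_gens : nat -> Type :=
  | AdjOld n (f : O n) : adj_gens n
  | AdjX : adj_gens 0.

Definition adj_presentation : presentation k :=
  @Presentation k adj_gens (fun Q I =>
    @operad_map k O Q (fun n f => I n (AdjOld f)) /\ homog false (I 0%N AdjX)).

Definition adjoin : operad k := presented adj_presentation.

Definition adjoin_x : adjoin 0%N := @generator k adj_presentation 0 AdjX.

Definition adjoin_incl n (f : O n) : adjoin n :=
  @generator k adj_presentation n (AdjOld f).

Definition formal : operad k := completion (gen_ideal adjoin_x).

Definition formal_x : formal 0%N := completion_incl (gen_ideal adjoin_x) adjoin_x.

Definition formal_incl n (f : O n) : formal n :=
  completion_incl (gen_ideal adjoin_x) (adjoin_incl f).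

Definition formal_top n : lintop (formal n) :=
  completion_top (gen_ideal adjoin_x) n.

End FormalAdjunction.

Section LInfinity.
Variable k : fieldType.

Definition linf_presentation : presentation k :=
  @Presentation k (fun n => is_true (0 < n)%N) (fun Q I =>
    forall n (h : (0 < n)%N),
      homog true (I n h) /\ forall s : 'S_n, oact s (I n h) = I n h).

Definition linf : operad k := presented linf_presentation.

(* [linf_m n] is the generator m_(n+1), of arity n + 1. *)
Definition linf_m (n : nat) : linf n.+1 :=
  @generator k linf_presentation n.+1 (ltn0Sn n).

(* Sh(p, n - p): s(1) < ... < s(p) and s(p+1) < ... < s(n). *)
Definition shuffle (n p : nat) (s : 'S_n) : bool :=
  [forall i : 'I_n, forall j : 'I_n,
    ((i < j) && ((j < p) || (p <= i)))%N ==> (s i < s j)%N].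

Lemma linf_arity (n : nat) (j : 'I_n.+1) : n.+2 = (j.+1 + (n - j).+1)%N.
Proof. by rewrite addnS addSn subnKC // -ltnS. Qed.

(* The formula for d(m_(n+1)); the summation index k of the formula is j + 1. *)
Definition linf_dm (n : nat) : linf n.+1 :=
  \sum_(j < n.+1) \sum_(s : 'S_n.+1 | shuffle (n - j).+1 s)
    oact s (ocomp (linf_arity j) ord0 (linf_m j) (linf_m (n - j))).

(* The dg operad L_infinity: [linf] with the differential determined by its
   values on the generators. *)
Record linf_structure := LinfStructure {
  linf_d : forall n, linf n -> linf n;
  linf_d_diff : is_differential linf_d;
  linf_d_gen : forall n, linf_d (linf_m n) = linf_dm n }.

Definition linf_dg (L : linf_structure) : dgoperad k :=
  dgoperad_of (linf_d_diff L).

End LInfinity.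

Section OMC.
Variables (k : fieldType) (O : dgoperad k) (phi : forall n, linf k n -> O n).

Notation OMC := (formal (underlying O)).

(* The N-th partial sum of sum_(n >= 1) 1/n! phi(m_n) o x^(tensor n). *)
Definition mc_partial (N : nat) : OMC 0%N :=
  \sum_(n < N) (n.+1`!%:R : k)^-1 *:
    fill (formal_x (underlying O))
      (formal_incl (O := underlying O) (phi (linf_m k n))).

(* The topological dg operad O_MC: O[[x]] with the continuous differential that
   extends the one of O and has the prescribed value on x. *)
Record mc_structure := MCStructure {
  mc_d : forall n, OMC n -> OMC n;
  mc_d_diff : is_differential mc_d;
  mc_d_continuous : forall n,
    lin_continuous (@formal_top k (underlying O) n)
                   (@formal_top k (underlying O) n) (@mc_d n);
  mc_d_incl : forall n (f : O n),
    mc_d (formal_incl (O := underlying O) f) =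
    formal_incl (O := underlying O) (odiff f);
  mc_d_x : converges (formal_top (underlying O) 0) mc_partial
    (mc_d (formal_x (underlying O))) }.

Definition mc_dg (M : mc_structure) : dgoperad k := dgoperad_of (mc_d_diff M).

Definition mc_x (M : mc_structure) : mc_dg M 0%N := formal_x (underlying O).

Definition mc_incl (M : mc_structure) n (f : O n) : mc_dg M n :=
  formal_incl (O := underlying O) f.

Definition mc_top (M : mc_structure) n : lintop (mc_dg M n) :=
  formal_top (underlying O) n.

End OMC.

Record ncdga (k : fieldType) := NCDGA {
  na_car :> vectType k;
  na_proj : bool -> na_car -> na_car;
  na_mul : na_car -> na_car -> na_car;
  na_d : na_car -> na_car;
  na_proj_lin : forall b, linear (na_proj b);
  na_graded : is_graded (GMod na_proj_lin);
  na_diff : @is_diff k (GMod na_proj_lin) na_d;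
  na_mul_linl : forall b, linear (fun a => na_mul a b);
  na_mul_linr : forall a, linear (na_mul a);
  na_mul_homog : forall e e' a b, na_proj e a = a -> na_proj e' b = b ->
    na_proj (e (+) e') (na_mul a b) = na_mul a b;
  na_mulA : associative na_mul;
  na_mulC : forall e e' a b, na_proj e a = a -> na_proj e' b = b ->
    na_mul a b = (-1) ^+ (e && e') *: na_mul b a;
  na_leibniz : forall a b, na_d (na_mul a b) =
    na_mul (na_d a) b +
    na_mul (koszul (V := GMod na_proj_lin) true a) (na_d b);
  na_nilpotent : exists N : nat, forall (a : na_car) (s : seq na_car),
    (N <= size s)%N -> foldl na_mul a s = 0 }.

Definition na_gmod (k : fieldType) (A : ncdga k) : gmod k :=
  GMod (@na_proj_lin k A).

Record ncdga_map (k : fieldType) (A B : ncdga k) (f : A -> B) : Prop := NCDGAMap {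
  nm_lin : linear f;
  nm_proj : forall e a, f (na_proj e a) = na_proj e (f a);
  nm_mul : forall a b, f (na_mul a b) = na_mul (f a) (f b);
  nm_d : forall a, f (na_d a) = na_d (f a) }.

(* A formal cdga A is determined by the inverse system, over a directed
   preorder, of which A_+ is the limit; everything here depends on A only
   through A_+. *)
Record formal_cdga (k : fieldType) := FormalCDGA {
  fc_index : Type;
  fc_le : fc_index -> fc_index -> Prop;
  fc_refl : forall i, fc_le i i;
  fc_trans : forall i j l, fc_le i j -> fc_le j l -> fc_le i l;
  fc_inhabited : inhabited fc_index;
  fc_directed : forall i j, exists l, fc_le i l /\ fc_le j l;
  fc_alg :> fc_index -> ncdga k;
  fc_tr : forall i j, fc_le i j -> fc_alg j -> fc_alg i;
  fc_tr_map : forall i j (h : fc_le i j), ncdga_map (fc_tr h);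
  fc_tr_id : forall i (h : fc_le i i) a, fc_tr h a = a;
  fc_tr_comp : forall i j l (h : fc_le i j) (h' : fc_le j l) (h'' : fc_le i l) a,
    fc_tr h (fc_tr h' a) = fc_tr h'' a }.

Section Tensor.
Variables (k : fieldType).

(* With b the basis [vbasis {:A}] of A, the element t of A (x) W represents
   the sum of the b_l (x) t l. *)
Definition tens (A : vectType k) (W : lmodType k) : Type :=
  {ffun 'I_(\dim {:A}) -> W}.
HB.instance Definition _ A W := GRing.Lmodule.on (tens A W).

Definition tpure (A : vectType k) (W : lmodType k) (a : A) (w : W) : tens A W :=
  [ffun l => coord (vbasis {:A}) l a *: w].

(* For B bilinear, the value at t of the linear map A (x) W -> U induced by B;
   see [tlift_pure]. *)
Definition tlift (A : vectType k) (W U : lmodType k) (B : A -> W -> U)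
    (t : tens A W) : U :=
  \sum_(l < \dim {:A}) B (vbasis {:A})`_l (t l).

Definition tmap (A A' : vectType k) (W W' : lmodType k)
    (f : A -> A') (g : W -> W') : tens A W -> tens A' W' :=
  tlift (fun a w => tpure (f a) (g w)).

Lemma tpure_linr (A : vectType k) (W : lmodType k) (a : A) :
  linear (@tpure A W a).
Proof.
by move=> c w w'; apply/ffunP => l; rewrite !ffunE scalerDr !scalerA mulrC.
Qed.

Lemma tpure_linl (A : vectType k) (W : lmodType k) (w : W) :
  linear (fun a : A => tpure a w).
Proof.
by move=> c a a'; apply/ffunP => l; rewrite !ffunE linearP /= scalerDl scalerA.
Qed.

Lemma linear_tpurel (A A' : vectType k) (W : lmodType k) (f : A -> A') (w : W) :
  linear f -> linear (fun a => tpure (f a) w).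
Proof. by move=> Hf c a a' /=; rewrite Hf tpure_linl. Qed.

Lemma linear_tpurer (A : vectType k) (W W' : lmodType k) (f : W -> W') (a : A) :
  linear f -> linear (fun w => tpure a (f w)).
Proof. by move=> Hf c w w' /=; rewrite Hf tpure_linr. Qed.

Lemma tlift_lin (A : vectType k) (W U : lmodType k) (B : A -> W -> U) :
  (forall a, linear (B a)) -> linear (tlift B).
Proof.
move=> HB c t t'; rewrite /tlift scaler_sumr -big_split.
by apply: eq_bigr => l _; rewrite !ffunE HB.
Qed.

Lemma tlift_pure (A : vectType k) (W U : lmodType k) (B : A -> W -> U) a w :
  (forall a', linear (B a')) -> (forall w', linear (B^~ w')) ->
  tlift B (tpure a w) = B a w.
Proof.
move=> Hr Hl; rewrite [in RHS](coord_vbasis (memvf a)) (lin_sum _ _ (Hl w)).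
by apply: eq_bigr => l _; rewrite ffunE (linZ _ _ (Hr _)) (linZ _ _ (Hl w)).
Qed.

Lemma tens_pure (A : vectType k) (W : lmodType k) (t : tens A W) :
  t = tlift (@tpure A W) t.
Proof.
apply/ffunP => l; rewrite /tlift sum_ffunE (bigD1 l) //= big1 => [|j Hj].
  by rewrite addr0 ffunE coord_free ?eqxx ?scale1r // (basis_free (vbasisP _)).
rewrite ffunE coord_free ?(basis_free (vbasisP _)) //.
by case: eqP => [jl|]; [rewrite jl eqxx in Hj | rewrite scale0r].
Qed.

Lemma tens_ext (A : vectType k) (W U : lmodType k) (f g : tens A W -> U) :
  linear f -> linear g -> (forall a w, f (tpure a w) = g (tpure a w)) ->
  forall t, f t = g t.
Proof.
move=> Hf Hg H t; rewrite [t]tens_pure /tlift !lin_sum //.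
by apply: eq_bigr => l _; rewrite H.
Qed.

Lemma tmap_lin (A A' : vectType k) (W W' : lmodType k)
    (f : A -> A') (g : W -> W') : linear g -> linear (tmap f g).
Proof.
by move=> Hg; apply: tlift_lin => a; exact: linear_tpurer.
Qed.

Lemma tmap_pure (A A' : vectType k) (W W' : lmodType k)
    (f : A -> A') (g : W -> W') a w : linear f -> linear g ->
  tmap f g (tpure a w) = tpure (f a) (g w).
Proof.
move=> Hf Hg; rewrite /tmap tlift_pure // => [a'|w'].
  exact: linear_tpurer.
exact: linear_tpurel.
Qed.

End Tensor.

Section GradedTensor.
Variables (k : fieldType) (A : ncdga k).

Definition tproj (W : gmod k) (b : bool) (t : tens A W) : tens A W :=
  \sum_(c : bool) tmap (na_proj c) (@gproj k W (b (+) c)) t.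

(* d(a (x) w) = da (x) w + (-1)^|a| a (x) dw *)
Definition tdiff (W : lmodType k) (d : W -> W) (t : tens A W) : tens A W :=
  tmap (@na_d k A) id t + tmap (koszul (V := na_gmod A) true) d t.

(* (a (x) f) o_i (b (x) g) = (-1)^(|f||b|) ab (x) (f o_i g) *)
Definition tcomp (P : operad_sig k) m n p (h : p.+1 = (m + n)%N) (i : 'I_m)
    (t : tens A (P m)) (u : tens A (P n)) : tens A (P p) :=
  tlift (fun a f => tlift (fun b g =>
    \sum_(e : bool) tpure (na_mul a (koszul (V := na_gmod A) e b))
                          (ocomp h i (gproj e f) g)) u) t.

Lemma tproj_lin (W : gmod k) b : linear (@tproj W b).
Proof.
by apply: linear_sum_fun => c; apply: tmap_lin; exact: gproj_lin.
Qed.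

Lemma tdiff_lin (W : lmodType k) (d : W -> W) :
  linear d -> linear (tdiff d).
Proof. by move=> Hd; apply: linear_add_fun; apply: tmap_lin. Qed.

Lemma tcomp_linr (P : operad_sig k) m n p (h : p.+1 = (m + n)%N) (i : 'I_m)
    (t : tens A (P m)) : linear (@tcomp P m n p h i t).
Proof.
apply: linear_sum_fun => l; apply: tlift_lin => b.
apply: linear_sum_fun => e; apply: linear_tpurer.
exact: ocomp_linr.
Qed.

Lemma tcomp_linl (P : operad_sig k) m n p (h : p.+1 = (m + n)%N) (i : 'I_m)
    (u : tens A (P n)) : linear (fun t => @tcomp P m n p h i t u).
Proof.
apply: tlift_lin => a; apply: linear_sum_fun => l.
apply: linear_sum_fun => e; apply: linear_tpurer.
apply: (linear_comp_fun (ocomp_linl h i _)); exact: gproj_lin.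
Qed.

Lemma tcomp_pure (P : operad_sig k) m n p (h : p.+1 = (m + n)%N) (i : 'I_m)
    a b (f : P m) (g : P n) :
  tcomp h i (tpure a f) (tpure b g) =
    \sum_(e : bool) tpure (na_mul a (koszul (V := na_gmod A) e b))
                          (ocomp h i (gproj e f) g).
Proof.
rewrite /tcomp tlift_pure.
- rewrite tlift_pure // => [b'|g'].
    apply: linear_sum_fun => e; apply: linear_tpurer.
    exact: ocomp_linr.
  apply: linear_sum_fun => e.
  apply: (linear_tpurel (f := fun b => na_mul a (koszul (V := na_gmod A) e b))).
  apply: (linear_comp_fun (na_mul_linr a)); exact: (koszul_lin (V := na_gmod A)).
- move=> a'; apply: linear_sum_fun => l.
  apply: linear_sum_fun => e; apply: linear_tpurer.
  apply: (linear_comp_fun (ocomp_linl h i _)); exact: gproj_lin.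
- move=> f'; apply: linear_sum_fun => l.
  apply: linear_sum_fun => e.
  apply: (linear_tpurel (f := fun a => na_mul a _)); exact: na_mul_linl.
Qed.

End GradedTensor.

Section Transition.
Variables (k : fieldType) (A B : ncdga k) (f : A -> B).
Hypothesis Hf : ncdga_map f.

Lemma tmap_tproj (W : gmod k) b (t : tens A W) :
  tmap f id (tproj b t) = tproj b (tmap f id t).
Proof.
have Lf := nm_lin Hf.
apply: (tens_ext (f := fun t => tmap f id (tproj b t))
                 (g := fun t => tproj b (tmap f id t))).
- by apply: linear_comp_fun; [exact: tmap_lin | exact: tproj_lin].
- by apply: linear_comp_fun; [exact: tproj_lin | exact: tmap_lin].
move=> a w; rewrite tmap_pure // /tproj lin_sum; last exact: tmap_lin.
apply: eq_bigr => c _.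
rewrite !tmap_pure ?(nm_proj Hf) //; try exact: gproj_lin; exact: na_proj_lin.
Qed.

Lemma na_d_lin (C : ncdga k) : linear (@na_d k C).
Proof. by case: (na_diff C). Qed.

Lemma nm_koszul e (a : A) :
  f (koszul (V := na_gmod A) e a) = koszul (V := na_gmod B) e (f a).
Proof.
rewrite /koszul; case: e => //=.
by rewrite (linB _ _ (nm_lin Hf)) !(nm_proj Hf).
Qed.

Lemma tmap_tdiff (W : lmodType k) (d : W -> W) (t : tens A W) : linear d ->
  tmap f id (tdiff d t) = tdiff d (tmap f id t).
Proof.
move=> Hd; have Lf := nm_lin Hf.
apply: (tens_ext (f := fun t => tmap f id (tdiff d t))
                 (g := fun t => tdiff d (tmap f id t))).
- by apply: linear_comp_fun; [exact: tmap_lin | exact: tdiff_lin].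
- by apply: linear_comp_fun; [exact: tdiff_lin | exact: tmap_lin].
move=> a w; rewrite tmap_pure // /tdiff linD; last exact: tmap_lin.
have KA := koszul_lin (V := na_gmod A) true.
have KB := koszul_lin (V := na_gmod B) true.
have DA := @na_d_lin A; have DB := @na_d_lin B.
by rewrite !tmap_pure // (nm_d Hf) (nm_koszul true).
Qed.

Lemma tmap_tmap_id (W W' : lmodType k) (g : W -> W') (t : tens A W) : linear g ->
  tmap f id (tmap id g t) = tmap id g (tmap f id t).
Proof.
move=> Hg; have Lf := nm_lin Hf.
apply: (tens_ext (f := fun t => tmap f id (tmap id g t))
                 (g := fun t => tmap id g (tmap f id t))).
- by apply: linear_comp_fun; exact: tmap_lin.
- by apply: linear_comp_fun; exact: tmap_lin.
by move=> a w; rewrite !tmap_pure.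
Qed.

Lemma tmap_tcomp (P : operad_sig k) m n p (h : p.+1 = (m + n)%N) (i : 'I_m)
    (t : tens A (P m)) (u : tens A (P n)) :
  tmap f id (tcomp h i t u) = tcomp h i (tmap f id t) (tmap f id u).
Proof.
have Lf := nm_lin Hf.
apply: (tens_ext (f := fun t => tmap f id (tcomp h i t u))
                 (g := fun t => tcomp h i (tmap f id t) (tmap f id u))).
- by apply: linear_comp_fun; [exact: tmap_lin | exact: tcomp_linl].
- apply: (linear_comp_fun (g := fun t => tcomp h i t _)).
    exact: tcomp_linl.
  exact: tmap_lin.
move=> a v; apply: (tens_ext (f := fun u => tmap f id (tcomp h i _ u))
                 (g := fun u => tcomp h i _ (tmap f id u))).
- by apply: linear_comp_fun; [exact: tmap_lin | exact: tcomp_linr].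
- by apply: linear_comp_fun; [exact: tcomp_linr | exact: tmap_lin].
move=> b w; rewrite !tmap_pure // !tcomp_pure lin_sum; last exact: tmap_lin.
by apply: eq_bigr => e _; rewrite tmap_pure // (nm_mul Hf) nm_koszul.
Qed.

End Transition.

Section CompletedTensor.
Variables (k : fieldType) (A : formal_cdga k).

Record ctens (W : lmodType k) := CTens {
  cfam : forall i, tens (A i) W;
  cfam_compat : forall i j (h : fc_le i j), tmap (fc_tr h) id (cfam j) = cfam i }.

Lemma ctensP (W : lmodType k) (t u : ctens W) :
  (forall i, cfam t i = cfam u i) -> t = u.
Proof.
case: t u => [t Ht] [u Hu] /= H; have E : t = u by apply: functional_extensionality_dep.
by subst u; congr CTens; exact: Prop_irrelevance.
Qed.

HB.instance Definition _ W := gen_eqMixin (ctens W).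
HB.instance Definition _ W := gen_choiceMixin (ctens W).

Lemma tr_lin (W : lmodType k) i j (h : fc_le i j) :
  linear (tmap (W := W) (W' := W) (fc_tr (f := A) h) id).
Proof. exact: tmap_lin. Qed.

Definition ct_add W (t u : ctens W) : ctens W.
Proof.
exists (fun i => cfam t i + cfam u i) => i j h.
by rewrite (linD _ _ (tr_lin h)) !cfam_compat.
Defined.
Definition ct_zero W : ctens W.
Proof. by exists (fun i => 0) => i j h; rewrite (lin0 (tr_lin h)). Defined.
Definition ct_opp W (t : ctens W) : ctens W.
Proof.
exists (fun i => - cfam t i) => i j h.
by rewrite (linN _ (tr_lin h)) !cfam_compat.
Defined.
Definition ct_scale W (c : k) (t : ctens W) : ctens W.
Proof.
exists (fun i => c *: cfam t i) => i j h.
by rewrite (linZ _ _ (tr_lin h)) !cfam_compat.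
Defined.

Lemma ct_addA W : associative (@ct_add W).
Proof. by move=> t u v; apply: ctensP => i /=; rewrite addrA. Qed.
Lemma ct_addC W : commutative (@ct_add W).
Proof. by move=> t u; apply: ctensP => i /=; rewrite addrC. Qed.
Lemma ct_add0 W : left_id (ct_zero W) (@ct_add W).
Proof. by move=> t; apply: ctensP => i /=; rewrite add0r. Qed.
Lemma ct_addN W : left_inverse (ct_zero W) (@ct_opp W) (@ct_add W).
Proof. by move=> t; apply: ctensP => i /=; rewrite addNr. Qed.

HB.instance Definition _ W :=
  GRing.isZmodule.Build (ctens W) (@ct_addA W) (@ct_addC W) (@ct_add0 W) (@ct_addN W).

Lemma ct_scaleA W a b (t : ctens W) : ct_scale a (ct_scale b t) = ct_scale (a * b) t.
Proof. by apply: ctensP => i /=; rewrite scalerA. Qed.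
Lemma ct_scale1 W : left_id 1 (@ct_scale W).
Proof. by move=> t; apply: ctensP => i /=; rewrite scale1r. Qed.
Lemma ct_scaleDr W : right_distributive (@ct_scale W) +%R.
Proof. by move=> c t u; apply: ctensP => i /=; rewrite scalerDr. Qed.
Lemma ct_scaleDl W (t : ctens W) : {morph (@ct_scale W)^~ t : a b / a + b}.
Proof. by move=> a b; apply: ctensP => i /=; rewrite scalerDl. Qed.

HB.instance Definition _ W :=
  GRing.Zmodule_isLmodule.Build k (ctens W)
    (@ct_scaleA W) (@ct_scale1 W) (@ct_scaleDr W) (@ct_scaleDl W).

(* The inverse limit topology, each A_i (x) W being discrete. *)
Definition ct_top (W : lmodType k) : lintop (ctens W) :=
  @LinTop k (ctens W) (fc_index A) (fun i t => cfam t i = 0).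

Definition ct_proj (W : gmod k) (b : bool) (t : ctens W) : ctens W.
Proof.
exists (fun i => tproj b (cfam t i)) => i j h.
by rewrite (tmap_tproj (fc_tr_map h)) cfam_compat.
Defined.

Lemma ct_proj_lin (W : gmod k) b : linear (@ct_proj W b).
Proof. by move=> c t u; apply: ctensP => i /=; rewrite tproj_lin. Qed.

Definition ct_gmod (W : gmod k) : gmod k := GMod (@ct_proj_lin W).

Definition ct_diff (W : lmodType k) (d : W -> W) (Hd : linear d)
    (t : ctens W) : ctens W.
Proof.
exists (fun i => tdiff d (cfam t i)) => i j h.
by rewrite (tmap_tdiff (fc_tr_map h)) // cfam_compat.
Defined.

Definition ct_map (W W' : lmodType k) (g : W -> W') (Hg : linear g)
    (t : ctens W) : ctens W'.
Proof.
exists (fun i => tmap id g (cfam t i)) => i j h.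
by rewrite (tmap_tmap_id (fc_tr_map h)) // cfam_compat.
Defined.

Lemma ct_diff_lin (W : lmodType k) (d : W -> W) (Hd : linear d) :
  linear (ct_diff Hd).
Proof. by move=> c t u; apply: ctensP => i /=; rewrite (tdiff_lin Hd). Qed.

Lemma ct_map_lin (W W' : lmodType k) (g : W -> W') (Hg : linear g) :
  linear (ct_map Hg).
Proof. by move=> c t u; apply: ctensP => i /=; rewrite (tmap_lin _ Hg). Qed.

Section Operad.
Variable P : operad_sig k.

Definition ct_comp m n p (h : p.+1 = (m + n)%N) (i : 'I_m)
    (t : ctens (P m)) (u : ctens (P n)) : ctens (P p).
Proof.
exists (fun j => tcomp h i (cfam t j) (cfam u j)) => j j' h'.
by rewrite (tmap_tcomp (fc_tr_map h')) !cfam_compat.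
Defined.

Lemma ct_comp_linl m n p (h : p.+1 = (m + n)%N) (i : 'I_m) (u : ctens (P n)) :
  linear (fun t => ct_comp h i t u).
Proof. by move=> c t t'; apply: ctensP => j /=; rewrite tcomp_linl. Qed.

Lemma ct_comp_linr m n p (h : p.+1 = (m + n)%N) (i : 'I_m) (t : ctens (P m)) :
  linear (ct_comp h i t).
Proof. by move=> c u u'; apply: ctensP => j /=; rewrite tcomp_linr. Qed.

Definition ct_operad_sig : operad_sig k :=
  @OperadSig k (fun n => ct_gmod (P n))
    (fun n s => ct_map (@oact_lin k P n s)) ct_comp
    (fun n s => ct_map_lin (@oact_lin k P n s)) ct_comp_linl ct_comp_linr.

End Operad.

Definition ct_dgoperad_sig (P : dgoperad_sig k) : dgoperad_sig k :=
  @DGOperadSig k (ct_operad_sig P)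
    (fun n => ct_diff (@odiff_lin k P n))
    (fun n => ct_diff_lin (@odiff_lin k P n)).

End CompletedTensor.

Section Multilinear.
Variables (k : fieldType) (W : lmodType k).

Definition upd n (v : 'I_n -> W) (c : 'I_n) (x : W) : 'I_n -> W :=
  fun j => if j == c then x else v j.

Definition multilinear n (f : ('I_n -> W) -> W) : Prop :=
  forall v c a x y,
    f (upd v c (a *: x + y)) = a *: f (upd v c x) + f (upd v c y).

(* Hom(W^(tensor n), W), as n-multilinear maps. *)
Record mlin n := MLin {
  mfun :> ('I_n -> W) -> W;
  mfun_multilinear : multilinear mfun }.

Lemma mlinP n (f g : mlin n) : (forall v, f v = g v) -> f = g.
Proof.
case: f g => [f Hf] [g Hg] /= H; have E : f = g by apply: functional_extensionality_dep.
by subst g; congr MLin; exact: Prop_irrelevance.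
Qed.

HB.instance Definition _ n := gen_eqMixin (mlin n).
HB.instance Definition _ n := gen_choiceMixin (mlin n).

Lemma multilinear_add n (f g : ('I_n -> W) -> W) :
  multilinear f -> multilinear g -> multilinear (fun v => f v + g v).
Proof. by move=> Hf Hg v c a x y; rewrite Hf Hg scalerDr addrACA. Qed.

Lemma multilinear0 n : multilinear (fun _ : 'I_n -> W => 0 : W).
Proof. by move=> v c a x y; rewrite scaler0 addr0. Qed.

Lemma multilinear_post n (f : ('I_n -> W) -> W) (L : W -> W) :
  linear L -> multilinear f -> multilinear (fun v => L (f v)).
Proof. by move=> HL Hf v c a x y; rewrite Hf HL. Qed.

Lemma multilinear_scale n b (f : ('I_n -> W) -> W) :
  multilinear f -> multilinear (fun v => b *: f v).
Proof.
apply: (@multilinear_post n f (fun x => b *: x)).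
exact: (linear_scale_fun b (@linear_id_fun k W)).
Qed.

Lemma multilinear_sum n (I : Type) (r : seq I) (F : I -> ('I_n -> W) -> W) :
  (forall i, multilinear (F i)) -> multilinear (fun v => \sum_(i <- r) F i v).
Proof.
move=> HF v c a x y; rewrite scaler_sumr -big_split.
by apply: eq_bigr => i _; rewrite HF.
Qed.

Lemma multilinear_subst m p (f : ('I_m -> W) -> W)
    (F : ('I_p -> W) -> 'I_m -> W) :
  multilinear f ->
  (forall v c, exists a : 'I_m, exists2 L : W -> W, linear L &
     forall x, F (upd v c x) = upd (F v) a (L x)) ->
  multilinear (fun v => f (F v)).
Proof.
move=> Hf HF v c b x y; have [a [L HL E]] := HF v c.
by rewrite !E HL Hf.
Qed.

Lemma multilinear_slots n (f : ('I_n -> W) -> W) (L : 'I_n -> W -> W) :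
  multilinear f -> (forall j, linear (L j)) ->
  multilinear (fun v => f (fun j => L j (v j))).
Proof.
move=> Hf HL; apply: multilinear_subst => // v c; exists c, (L c) => // x.
by apply: functional_extensionality_dep => j; rewrite /upd; case: eqP => // ->.
Qed.

Definition ml_add n (f g : mlin n) : mlin n :=
  MLin (multilinear_add (mfun_multilinear f) (mfun_multilinear g)).
Definition ml_zero n : mlin n := MLin (@multilinear0 n).
Definition ml_scale n (b : k) (f : mlin n) : mlin n :=
  MLin (multilinear_scale b (mfun_multilinear f)).
Definition ml_opp n (f : mlin n) : mlin n := ml_scale (-1) f.

Lemma ml_addA n : associative (@ml_add n).
Proof. by move=> f g h; apply: mlinP => v /=; rewrite addrA. Qed.
Lemma ml_addC n : commutative (@ml_add n).
Proof. by move=> f g; apply: mlinP => v /=; rewrite addrC. Qed.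
Lemma ml_add0 n : left_id (ml_zero n) (@ml_add n).
Proof. by move=> f; apply: mlinP => v /=; rewrite add0r. Qed.
Lemma ml_addN n : left_inverse (ml_zero n) (@ml_opp n) (@ml_add n).
Proof. by move=> f; apply: mlinP => v /=; rewrite scaleN1r addNr. Qed.

HB.instance Definition _ n :=
  GRing.isZmodule.Build (mlin n) (@ml_addA n) (@ml_addC n) (@ml_add0 n) (@ml_addN n).

Lemma ml_scaleA n a b (f : mlin n) : ml_scale a (ml_scale b f) = ml_scale (a * b) f.
Proof. by apply: mlinP => v /=; rewrite scalerA. Qed.
Lemma ml_scale1 n : left_id 1 (@ml_scale n).
Proof. by move=> f; apply: mlinP => v /=; rewrite scale1r. Qed.
Lemma ml_scaleDr n : right_distributive (@ml_scale n) +%R.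
Proof. by move=> c f g; apply: mlinP => v /=; rewrite scalerDr. Qed.
Lemma ml_scaleDl n (f : mlin n) : {morph (@ml_scale n)^~ f : a b / a + b}.
Proof. by move=> a b; apply: mlinP => v /=; rewrite scalerDl. Qed.

HB.instance Definition _ n :=
  GRing.Zmodule_isLmodule.Build k (mlin n)
    (@ml_scaleA n) (@ml_scale1 n) (@ml_scaleDr n) (@ml_scaleDl n).

Lemma ml_linE n a (f g : mlin n) v : (a *: f + g) v = a *: f v + g v.
Proof. by []. Qed.

(* Arity 0: Hom(k, W) = W. *)
Definition ml_eval0 (f : mlin 0) : W := f (fun _ => 0).

Lemma ml_const_multilinear (w : W) : multilinear (fun _ : 'I_0 -> W => w).
Proof. by move=> v []. Qed.

Definition ml_const (w : W) : mlin 0 := MLin (ml_const_multilinear w).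

Lemma ml_eval0_lin : linear ml_eval0.
Proof. by []. Qed.

Lemma ml_const_lin : linear ml_const.
Proof. by move=> a x y; apply: mlinP. Qed.

End Multilinear.

Section Endomorphism.
Variables (k : fieldType) (W : dgvect k).

(* f has parity b when it maps W_e(1) x ... x W_e(n) to W_(b+e(1)+...+e(n)). *)
Lemma endo_proj_multilinear n (b : bool) (f : mlin W n) :
  multilinear (fun v => \sum_(e : {ffun 'I_n -> bool})
    gproj (b (+) \big[addb/false]_j e j) (f (fun j => gproj (e j) (v j)))).
Proof.
apply: multilinear_sum => e; apply: multilinear_post; first exact: gproj_lin.
apply: (multilinear_slots (L := fun j => gproj (e j))) => [|j].
  exact: mfun_multilinear.
exact: gproj_lin.
Qed.

Definition endo_proj n b (f : mlin W n) : mlin W n :=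
  MLin (endo_proj_multilinear b f).

Lemma endo_proj_lin n b : linear (@endo_proj n b).
Proof.
move=> a f g; apply: mlinP => v /=; rewrite scaler_sumr -big_split.
by apply: eq_bigr => e _; rewrite /= gproj_lin.
Qed.

Definition endo_gmod n : gmod k := GMod (@endo_proj_lin n).

(* The sign in w_1 (x) ... (x) w_n |-> +- w_s(1) (x) ... (x) w_s(n) for w_i of
   parity e(i). *)
Definition perm_sign n (s : 'S_n) (e : 'I_n -> bool) : k :=
  \prod_(i < n) \prod_(j < n | ((i < j) && (s j < s i))%N)
    (-1) ^+ (e (s i) && e (s j)).

Lemma endo_act_multilinear n (s : 'S_n) (f : mlin W n) :
  multilinear (fun v => \sum_(e : {ffun 'I_n -> bool})
    perm_sign s e *: f (fun j => gproj (e (s j)) (v (s j)))).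
Proof.
apply: multilinear_sum => e; apply: multilinear_scale.
apply: (multilinear_subst (F := fun v j => gproj (e (s j)) (v (s j)))).
  exact: mfun_multilinear.
move=> v c; exists (s^-1%g c), (gproj (e c)); first exact: gproj_lin.
move=> x; apply: functional_extensionality_dep => j; rewrite /upd.
by rewrite -(inj_eq (@perm_inj _ s) j) permKV; case: eqP => // ->.
Qed.

Definition endo_act n (s : 'S_n) (f : mlin W n) : mlin W n :=
  MLin (endo_act_multilinear s f).

Lemma endo_act_lin n (s : 'S_n) : linear (endo_act s).
Proof.
move=> a f g; apply: mlinP => v /=; rewrite scaler_sumr -big_split.
by apply: eq_bigr => e _; rewrite /= scalerDr !scalerA mulrC.
Qed.

(* v at position a; out-of-range positions never occur below. *)
Definition tup_at n (v : 'I_n -> W) (a : nat) : W := oapp v 0 (insub a).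

Lemma tup_at_upd n (v : 'I_n -> W) c x a :
  tup_at (upd v c x) a = if a == c then x else tup_at v a.
Proof.
rewrite /tup_at /upd; case: insubP => [j Hj <-|Ha] /=; first by [].
by case: eqP => // E; move: Ha; rewrite E ltn_ord.
Qed.

(* The inputs of f in (f o_i g)(v), up to the sign (-1)^(q(|v_1|+...)) by which
   an odd g (q = true) passes the inputs before position i. *)
Definition endo_inputs m n p (i : 'I_m) (q : bool) (g : ('I_n -> W) -> W)
    (v : 'I_p -> W) : 'I_m -> W :=
  fun a => if (a < i)%N then koszul q (tup_at v a)
           else if a == i then g (fun b : 'I_n => tup_at v (i + b))
           else tup_at v (a + n).-1.

Lemma endo_comp_multilinear m n p (h : p.+1 = (m + n)%N) (i : 'I_m)
    (f : mlin W m) (g : mlin W n) :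
  multilinear (fun v : 'I_p -> W => \sum_(q : bool)
    f (endo_inputs i q (endo_proj q g) v)).
Proof.
apply: multilinear_sum => q; move: (endo_proj q g) => g'.
apply: multilinear_subst; first exact: mfun_multilinear.
have oE r (a b : 'I_r) : (a == b) = (nat_of_ord a == nat_of_ord b) by [].
move=> v c; have Hc := ltn_ord c; have Hi := ltn_ord i.
case: (ltnP c i) => ci; last case: (ltnP c (i + n)) => cin.
- have Hm : (c < m)%N by lia.
  exists (Ordinal Hm), (koszul q); first exact: koszul_lin.
  move=> x; apply: functional_extensionality_dep => a.
  rewrite /endo_inputs [RHS]/upd !oE /=.
  case: ltnP => ai; first by rewrite tup_at_upd; case: eqP.
  case: eqP => ai'.
    case: eqP => ?; first lia.
    congr (mfun g' _); apply: functional_extensionality_dep => b.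
    by rewrite tup_at_upd; case: eqP => // ?; lia.
  by rewrite tup_at_upd; case: eqP => ?; case: eqP => // ?; lia.
- have Hn : (c - i < n)%N by lia.
  pose inner := fun b : 'I_n => tup_at v (i + b).
  exists i, (fun x => g' (upd inner (Ordinal Hn) x)).
    by move=> b x y; exact: mfun_multilinear.
  move=> x; apply: functional_extensionality_dep => a.
  rewrite /endo_inputs [RHS]/upd !oE.
  case: (nat_of_ord a =P i) => ai'.
    rewrite ai' ltnn; congr (mfun g' _).
    apply: functional_extensionality_dep => b.
    rewrite tup_at_upd /upd oE /=.
    by case: eqP => ?; case: eqP => ? //; lia.
  by case: ltnP => ai; rewrite tup_at_upd; case: eqP => // ?; lia.
- have Ha a : (a < m)%N -> (a < i)%N || (a == i) -> (a < c.+1 - n)%N by lia.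
  have Hm : (c.+1 - n < m)%N by lia.
  exists (Ordinal Hm), id; first exact: linear_id_fun.
  move=> x; apply: functional_extensionality_dep => a.
  have Ham := ltn_ord a; rewrite /endo_inputs [RHS]/upd !oE /=.
  case: ltnP => ai.
    by rewrite tup_at_upd; case: eqP => ?; case: eqP => // ?; lia.
  case: eqP => ai'.
    case: eqP => ?; first lia.
    congr (mfun g' _); apply: functional_extensionality_dep => b.
    have Hb := ltn_ord b.
    by rewrite tup_at_upd; case: eqP => // ?; lia.
  by rewrite tup_at_upd; case: eqP => ?; case: eqP => // ?; lia.
Qed.

Definition endo_comp m n p (h : p.+1 = (m + n)%N) (i : 'I_m)
    (f : mlin W m) (g : mlin W n) : mlin W p :=
  MLin (endo_comp_multilinear h i f g).

Lemma endo_compE m n p (h : p.+1 = (m + n)%N) (i : 'I_m)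
    (f : mlin W m) (g : mlin W n) v :
  endo_comp h i f g v = \sum_(q : bool) f (endo_inputs i q (endo_proj q g) v).
Proof. by []. Qed.

Lemma endo_comp_linl m n p (h : p.+1 = (m + n)%N) (i : 'I_m) (g : mlin W n) :
  linear (fun f => endo_comp h i f g).
Proof.
move=> a f f'; apply: mlinP => v /=; rewrite scaler_sumr -big_split.
by apply: eq_bigr.
Qed.

Lemma endo_comp_linr m n p (h : p.+1 = (m + n)%N) (i : 'I_m) (f : mlin W m) :
  linear (endo_comp h i f).
Proof.
move=> a g g'; apply: mlinP => v; rewrite ml_linE !endo_compE.
rewrite scaler_sumr -big_split; apply: eq_bigr => q _; rewrite endo_proj_lin.
have E (g0 : mlin W n) : endo_inputs i q g0 v =
    upd (endo_inputs i q (fun _ : 'I_n -> W => 0) v) i (g0 (fun b : 'I_n => tup_at v (i + b))).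
  apply: functional_extensionality_dep => b; rewrite /endo_inputs /upd.
  have -> : (b == i) = (nat_of_ord b == i) by [].
  by case: (nat_of_ord b =P i) => [->|//]; rewrite ltnn.
by rewrite 3!E mfun_multilinear.
Qed.

Definition endo_operad_sig : operad_sig k :=
  @OperadSig k endo_gmod endo_act endo_comp
    endo_act_lin endo_comp_linl endo_comp_linr.

(* (df)(v) = d(f(v))
     - sum_i (-1)^(|f|+|v_1|+...+|v_(i-1)|) f(v_1, ..., dv_i, ..., v_n) *)
Lemma endo_diff_multilinear n (f : mlin W n) :
  multilinear (fun v => dv_d (f v) - \sum_(i < n)
    (koszul (V := endo_gmod n) true f : mlin W n) (fun j : 'I_n =>
      if (j < i)%N then koszul true (v j)
      else if j == i then dv_d (v j) else v j)).
Proof.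
apply: multilinear_add.
  by apply: multilinear_post; [exact: dv_lin | exact: mfun_multilinear].
have LN : linear (fun x : W => - x) by exact: (linear_opp_fun (@linear_id_fun k W)).
apply: (multilinear_post LN).
apply: multilinear_sum => i.
apply: (multilinear_slots (L := fun j x => if (j < i)%N then koszul true x
  else if j == i then dv_d x else x)) => [|j]; first exact: mfun_multilinear.
case: (j < i)%N; first exact: koszul_lin.
by case: (j == i); [exact: dv_lin | exact: linear_id_fun].
Qed.

Definition endo_diff n (f : mlin W n) : mlin W n :=
  MLin (endo_diff_multilinear f).

Lemma endo_diffE n (f : mlin W n) v :
  endo_diff f v = dv_d (f v) - \sum_(i < n)
    (koszul (V := endo_gmod n) true f : mlin W n) (fun j : 'I_n =>
      if (j < i)%N then koszul true (v j)
      else if j == i then dv_d (v j) else v j).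
Proof. by []. Qed.

Lemma endo_diff_lin n : linear (@endo_diff n).
Proof.
move=> a f g; apply: mlinP => v; rewrite ml_linE !endo_diffE.
rewrite ml_linE dv_lin (koszul_lin (V := endo_gmod n)) scalerBr addrACA -opprD.
rewrite scaler_sumr -big_split.
by congr (_ - _); apply: eq_bigr.
Qed.

Definition endo : dgoperad_sig k :=
  @DGOperadSig k endo_operad_sig endo_diff endo_diff_lin.

End Endomorphism.

Section Algebras.
Variables (k : fieldType) (A : formal_cdga k) (V : dgvect k).

(* A_+ (x) E(Pi V) *)
Definition alg_target : dgoperad_sig k := ct_dgoperad_sig A (endo (pirev V)).

Definition alg_structure (P : dgoperad_sig k) (T : forall n, lintop (P n))
    (f : forall n, P n -> alg_target n) : Prop :=
  dgoperad_map f /\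
  forall n, lin_continuous (T n) (ct_top A (endo (pirev V) n)) (f n).

Definition arity0_to : alg_target 0%N -> ct_gmod A (pirev V) :=
  ct_map (@ml_eval0_lin k (pirev V)).

Definition arity0_of : ct_gmod A (pirev V) -> alg_target 0%N :=
  ct_map (@ml_const_lin k (pirev V)).

Variables (O : dgoperad k) (phi : forall n, linf k n -> O n).

Section MC.
Variable f : forall n, O n -> alg_target n.

(* [mu n] is mu_(n+1). *)
Definition mu (n : nat) : alg_target n.+1 := - f (phi (linf_m k n)).

(* The partial sums of the left-hand side of the Maurer-Cartan equation. *)
Definition mc_lhs (xi : ct_gmod A (pirev V)) (N : nat) : ct_gmod A (pirev V) :=
  ct_diff (dv_lin (V := pirev V)) xi +
  \sum_(n < N) (n.+1`!%:R : k)^-1 *: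
    arity0_to (fill (arity0_of xi) (mu n)).

Definition MC (xi : ct_gmod A (pirev V)) : Prop :=
  homog false xi /\ converges (ct_top A (pirev V)) (mc_lhs xi) 0.

End MC.
End Algebras.

(* Main.v *)
Require Import Defs.
From mathcomp Require Import all_boot all_order all_algebra.
From mathcomp Require Import boolp.
From mathcomp Require Import fingroup perm zify.
Local Open Scope ring_scope.

Set Implicit Arguments.
Unset Strict Implicit.
Unset Printing Implicit Defensive.

Import GRing.Theory.

(** Let A_+ be the limit of the nilpotent algebras A_i.  The theorem rests on
    three facts.

    A continuous graded map out of O[[x]] is the same as a map f on O together with an even
    element y of arity 0.  To use that x is freely adjoined, the target
    A_+ (x) E(Pi V) has to be a graded operad ([endo_is_operad],
    [ct_is_operad]); this is a verification of Koszul signs.  The resulting map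
    on the free adjunction O<x> extends to the completion because every element
    of the target already has a coefficient in A_+: a composite with N factors
    in the ideal (x) has its coefficients in A_+^N ([ipow_tdeep]), which is zero
    in A_i for N large.  For the same reason the extension is continuous
    ([cextend_continuous]).

    The extension g respects the differentials as soon as it does so on O and on
    x.  Both g d and d g are derivations along g, so they agree on the operadic
    expressions in O and x ([mc_ext_dg]), hence by continuity on the completion
    ([cextend_diff]).  This needs the differential of A_+ (x) E(Pi V) to be a
    derivation ([endo_derivation], [ct_derivation]).

    On x the condition g(dx) = d(gx) is the Maurer-Cartan equation.  The partial
    sums of dx go to the partial sums of sum 1/n! f(phi(m_n)) o y^n, so g(dx) is
    the sum of that series ([mc_series_converges]), and as mu_n = - f(phi(m_n))
    the equation for y reads d(y) = sum 1/n! f(phi(m_n)) o y^n ([MC_arity0]).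
    Read in one direction this produces the algebra over O[[x]] from f and y, and
    in the other it shows that the image of x is a Maurer-Cartan element. *)

(** * Homogeneous elements *)

Section Homogeneous.
Variables (k : fieldType) (V : gmod k).
Hypothesis gV : is_graded V.

Lemma gproj_homog b c (v : V) : homog c v -> gproj b v = if b == c then v else 0.
Proof. by move=> Hv; rewrite -{1}Hv gV.2; case: eqP => // ->. Qed.

Lemma homog_gproj b (v : V) : homog b (gproj b v).
Proof. by rewrite /homog gV.2 eqxx. Qed.

Lemma homogD b (u v : V) : homog b u -> homog b v -> homog b (u + v).
Proof. by rewrite /homog (linD _ _ (@gproj_lin k V b)) => -> ->. Qed.

Lemma homogZ b c (v : V) : homog b v -> homog b (c *: v).
Proof. by rewrite /homog (linZ _ _ (@gproj_lin k V b)) => ->. Qed.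

Lemma homog0 b : homog b (0 : V).
Proof. exact: (lin0 (@gproj_lin k V b)). Qed.

Lemma koszul_homog e c (v : V) : homog c v -> koszul e v = (-1) ^+ (e && c) *: v.
Proof.
move=> Hv; rewrite /koszul; case: e => /=; last by rewrite expr0 scale1r.
rewrite !(gproj_homog _ Hv); case: c {Hv} => /=.
  by rewrite sub0r expr1 scaleN1r.
by rewrite subr0 expr0 scale1r.
Qed.

Lemma homog_koszul e c (v : V) : homog c v -> homog c (koszul e v).
Proof. by move=> Hv; rewrite (koszul_homog _ Hv); exact: homogZ. Qed.

Lemma graded_ind (Q : V -> Prop) :
  (forall u v, Q u -> Q v -> Q (u + v)) -> (forall c v, homog c v -> Q v) ->
  forall v, Q v.
Proof.
move=> QD Qh v; rewrite -[v]gV.1.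
by apply: QD; apply: Qh; exact: homog_gproj.
Qed.

Lemma koszulK e e' (v : V) : koszul e (koszul e' v) = koszul (e (+) e') v.
Proof.
move: v; apply: graded_ind => [u v Hu Hv|c v Hv].
  by rewrite !(linD _ _ (koszul_lin (V := V) _)) Hu Hv.
rewrite !(koszul_homog _ Hv) (koszul_homog _ (homogZ _ Hv)) scalerA.
by rewrite -signr_addb -andb_addl.
Qed.

End Homogeneous.

(** * Tensoring an operad with a graded commutative algebra *)

Section PureTensors.
Variables (k : fieldType) (A : ncdga k).

Local Notation ahomog e a := (homog (V := na_gmod A) e a).

Lemma tpureDl (W : lmodType k) (a b : A) (w : W) :
  tpure (a + b) w = tpure a w + tpure b w.
Proof. exact: (linD a b (@tpure_linl k A W w)). Qed.

Lemma tpureDr (W : lmodType k) (a : A) (w x : W) :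
  tpure a (w + x) = tpure a w + tpure a x.
Proof. exact: (linD w x (@tpure_linr k A W a)). Qed.

Lemma tpureZl (W : lmodType k) c (a : A) (w : W) :
  tpure (c *: a) w = c *: tpure a w.
Proof. exact: (linZ c a (@tpure_linl k A W w)). Qed.

Lemma tpureZr (W : lmodType k) c (a : A) (w : W) :
  tpure a (c *: w) = c *: tpure a w.
Proof. exact: (linZ c w (@tpure_linr k A W a)). Qed.

Lemma tpure0l (W : lmodType k) (w : W) : tpure (0 : A) w = 0.
Proof. exact: (lin0 (@tpure_linl k A W w)). Qed.

Lemma tpure0r (W : lmodType k) (a : A) : tpure a (0 : W) = 0.
Proof. exact: (lin0 (@tpure_linr k A W a)). Qed.

(** Both sides of the identities of this part are additive in each tensor, so it is
    enough to check them on a (x) w with a and w homogeneous, where all Koszul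
    signs are explicit. *)
Lemma tens_homog_ind (W : gmod k) (Q : tens A W -> Prop) : is_graded W ->
  (forall t u, Q t -> Q u -> Q (t + u)) ->
  (forall c d (a : A) (w : W), ahomog c a -> homog d w -> Q (tpure a w)) ->
  forall t, Q t.
Proof.
move=> gW QD Qp t.
have Q0 : Q 0.
  rewrite -(@tpure0l W 0); apply: (Qp false false); exact: homog0.
have Qpure a w : Q (tpure a w).
  move: a; apply: (graded_ind (na_graded A)) => [a b Ha Hb|c a Ha].
    by rewrite tpureDl; exact: QD.
  move: w; apply: (graded_ind gW) => [w x Hw Hx|d w Hw].
    by rewrite tpureDr; exact: QD.
  exact: Qp Ha Hw.
by rewrite [t]tens_pure /tlift; apply: big_ind.
Qed.

Lemma tmapD (B : vectType k) (W W' : lmodType k) (f : A -> B) (g : W -> W') t u :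
  linear g -> tmap f g (t + u) = tmap f g t + tmap f g u.
Proof. by move=> Hg; exact: (linD t u (tmap_lin f Hg)). Qed.

Lemma tprojD (W : gmod k) b (t u : tens A W) :
  tproj b (t + u) = tproj b t + tproj b u.
Proof. exact: (linD t u (@tproj_lin k A W b)). Qed.

Lemma tprojZ (W : gmod k) b c (t : tens A W) :
  tproj b (c *: t) = c *: tproj b t.
Proof. exact: (linZ c t (@tproj_lin k A W b)). Qed.

Lemma tdiffD (W : lmodType k) (d : W -> W) (t u : tens A W) :
  linear d -> tdiff d (t + u) = tdiff d t + tdiff d u.
Proof. by move=> Hd; exact: (linD t u (tdiff_lin Hd)). Qed.

Lemma tproj_pure (W : gmod k) b c d (a : A) (w : W) : is_graded W ->
  ahomog c a -> homog d w ->
  tproj b (tpure a w) = if b == c (+) d then tpure a w else 0.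
Proof.
move=> gW Ha Hw; rewrite /tproj big_bool /=.
rewrite !tmap_pure; try exact: gproj_lin; try exact: na_proj_lin.
have E e : na_proj e a = if e == c then a else 0.
  exact: (gproj_homog (na_graded A) e Ha).
rewrite !E !(gproj_homog gW _ Hw).
by case: b c d {Ha Hw E} => [] [] [] /=; rewrite ?tpure0l ?tpure0r ?addr0 ?add0r.
Qed.

Lemma tens_graded (W : gmod k) : is_graded W -> is_graded (GMod (@tproj_lin k A W)).
Proof.
move=> gW; split=> [t|b b' t] /=; move: t.
  apply: (tens_homog_ind gW) => [t u Ht Hu|c d a w Ha Hw].
    by rewrite !tprojD addrACA Ht Hu.
  rewrite !(tproj_pure _ gW Ha Hw).
  by case: c d {Ha Hw} => [] [] /=; rewrite ?addr0 ?add0r.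
apply: (tens_homog_ind gW) => [t u Ht Hu|c d a w Ha Hw].
  by rewrite !tprojD Ht Hu; case: ifP => _; rewrite ?addr0 ?tprojD.
rewrite !(tproj_pure _ gW Ha Hw); case: (b' =P c (+) d) => E.
  by rewrite (tproj_pure _ gW Ha Hw) E.
by rewrite (lin0 (@tproj_lin k A W b)); case: ifP.
Qed.

Lemma tdiff_pure (W : lmodType k) (d : W -> W) c (a : A) (w : W) : linear d ->
  ahomog c a ->
  tdiff d (tpure a w) = tpure (na_d a) w + (-1) ^+ c *: tpure a (d w).
Proof.
move=> Hd Ha; have KA := koszul_lin (V := na_gmod A) true.
have DA := @na_d_lin k A; rewrite /tdiff !tmap_pure //.
by rewrite (koszul_homog (na_graded A) _ Ha) /= tpureZl.
Qed.

Lemma ahomog_d c (a : A) : ahomog c a -> ahomog (~~ c) (na_d a).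
Proof.
move=> Ha; have [_ H _] := na_diff A.
by rewrite /homog (H c) Ha.
Qed.

Lemma ahomog_mul c d (a b : A) : ahomog c a -> ahomog d b ->
  ahomog (c (+) d) (na_mul a b).
Proof. exact: na_mul_homog. Qed.

Lemma na_mulZl c (a b : A) : na_mul (c *: a) b = c *: na_mul a b.
Proof. exact: (linZ c a (na_mul_linl b)). Qed.

Lemma na_mulZr c (a b : A) : na_mul a (c *: b) = c *: na_mul a b.
Proof. exact: (linZ c b (na_mul_linr a)). Qed.

Lemma tproj_tdiff (W : gmod k) (d : W -> W) b (t : tens A W) : is_graded W ->
  linear d -> (forall e w, gproj (~~ e) (d w) = d (gproj e w)) ->
  tproj (~~ b) (tdiff d t) = tdiff d (tproj b t).
Proof.
move=> gW Hd dW; move: t.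
apply: (tens_homog_ind gW) => [t u Ht Hu|c e a w Ha Hw].
  by rewrite (tdiffD _ _ Hd) (tprojD _ t u) (tdiffD _ _ Hd) (tprojD _ (tdiff d t)) Ht Hu.
have Hdw : homog (~~ e) (d w) by rewrite /homog dW Hw.
rewrite (tdiff_pure _ Hd Ha) tprojD tprojZ (tproj_pure _ gW (ahomog_d Ha) Hw).
rewrite (tproj_pure _ gW Ha Hdw) (tproj_pure _ gW Ha Hw).
rewrite addNb addbN (inj_eq (can_inj negbK)); case: ifP => _.
  by rewrite (tdiff_pure _ Hd Ha).
by rewrite scaler0 addr0 (lin0 (tdiff_lin Hd)).
Qed.

Section Operad.
Variable P : operad_sig k.

Lemma tcompDl m n p (h : p.+1 = (m + n)%N) (i : 'I_m)
    (t t' : tens A (P m)) (u : tens A (P n)) :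
  tcomp h i (t + t') u = tcomp h i t u + tcomp h i t' u.
Proof. exact: (linD t t' (tcomp_linl h i u)). Qed.

Lemma tcompDr m n p (h : p.+1 = (m + n)%N) (i : 'I_m)
    (t : tens A (P m)) (u u' : tens A (P n)) :
  tcomp h i t (u + u') = tcomp h i t u + tcomp h i t u'.
Proof. exact: (linD u u' (tcomp_linr h i t)). Qed.

Lemma tcompZl m n p (h : p.+1 = (m + n)%N) (i : 'I_m) c
    (t : tens A (P m)) (u : tens A (P n)) :
  tcomp h i (c *: t) u = c *: tcomp h i t u.
Proof. exact: (linZ c t (tcomp_linl h i u)). Qed.

Lemma tcompZr m n p (h : p.+1 = (m + n)%N) (i : 'I_m) c
    (t : tens A (P m)) (u : tens A (P n)) :
  tcomp h i t (c *: u) = c *: tcomp h i t u.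
Proof. exact: (linZ c u (tcomp_linr h i t)). Qed.

Lemma tcomp0l m n p (h : p.+1 = (m + n)%N) (i : 'I_m) (u : tens A (P n)) :
  tcomp h i 0 u = 0.
Proof. exact: (lin0 (tcomp_linl h i u)). Qed.

Lemma tcomp0r m n p (h : p.+1 = (m + n)%N) (i : 'I_m) (t : tens A (P m)) :
  tcomp h i t 0 = 0.
Proof. exact: (lin0 (tcomp_linr h i t)). Qed.

Hypothesis gP : forall n, is_graded (P n).

Lemma tcomp_homog m n p (h : p.+1 = (m + n)%N) (i : 'I_m) c d
    (a b : A) (f : P m) (g : P n) : homog d f -> ahomog c b ->
  tcomp h i (tpure a f) (tpure b g) =
    (-1) ^+ (d && c) *: tpure (na_mul a b) (ocomp h i f g).
Proof.
move=> Hf Hb; rewrite tcomp_pure (bigD1 d) //= big1 => [|e Hed].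
  rewrite addr0 (gproj_homog (gP m) _ Hf) eqxx (koszul_homog (na_graded A) _ Hb).
  by rewrite na_mulZr tpureZl.
rewrite (gproj_homog (gP m) _ Hf) (negbTE Hed) (lin0 (ocomp_linl h i g)).
exact: tpure0r.
Qed.

Lemma tact_pure n (s : 'S_n) (a : A) (f : P n) :
  tmap id (oact s) (tpure a f) = tpure a (oact s f).
Proof. by rewrite tmap_pure //; exact: oact_lin. Qed.

Lemma tactD n (s : 'S_n) (t u : tens A (P n)) :
  tmap id (oact s) (t + u) = tmap id (oact s) t + tmap id (oact s) u.
Proof. exact/tmapD/oact_lin. Qed.

Lemma tactZ n (s : 'S_n) c (t : tens A (P n)) :
  tmap id (oact s) (c *: t) = c *: tmap id (oact s) t.
Proof. exact: (linZ c t (tmap_lin id (oact_lin s))). Qed.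

End Operad.

Section TensorAxioms.
Variables (P : operad_sig k) (HP : is_operad P).
Let gP := op_graded HP.

Lemma oact_homog n (s : 'S_n) c (f : P n) : homog c f -> homog c (oact s f).
Proof. by rewrite /homog (op_act_proj HP) => ->. Qed.

Lemma tact1 n (t : tens A (P n)) : tmap id (oact 1%g) t = t.
Proof.
move: t; apply: (tens_homog_ind (gP n)) => [t u Ht Hu|c d a f _ _].
  by rewrite tactD Ht Hu.
by rewrite tact_pure (op_act1 HP).
Qed.

Lemma tactM n (s r : 'S_n) (t : tens A (P n)) :
  tmap id (oact (s * r)%g) t = tmap id (oact r) (tmap id (oact s) t).
Proof.
move: t; apply: (tens_homog_ind (gP n)) => [t u Ht Hu|c d a f _ _].
  by rewrite !tactD Ht Hu.
by rewrite !tact_pure (op_actM HP).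
Qed.

Lemma tact_proj n (s : 'S_n) b (t : tens A (P n)) :
  tproj b (tmap id (oact s) t) = tmap id (oact s) (tproj b t).
Proof.
move: t; apply: (tens_homog_ind (gP n)) => [t u Ht Hu|c d a f Ha Hf].
  by rewrite !(tactD, tprojD) Ht Hu.
rewrite tact_pure (tproj_pure _ (gP n) Ha Hf).
rewrite (tproj_pure _ (gP n) Ha (oact_homog s Hf)).
by case: ifP => _; rewrite ?tact_pure // (lin0 (tmap_lin id (oact_lin s))).
Qed.

Lemma tcomp_proj m n p (h : p.+1 = (m + n)%N) (i : 'I_m) b b'
    (t : tens A (P m)) (u : tens A (P n)) :
  tproj (b (+) b') (tcomp h i (tproj b t) (tproj b' u)) =
    tcomp h i (tproj b t) (tproj b' u).
Proof.
move: t; apply: (tens_homog_ind (gP m)) => [t t' Ht Ht'|c d a f Ha Hf].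
  by rewrite !(tprojD, tcompDl) Ht Ht'.
move: u; apply: (tens_homog_ind (gP n)) => [u u' Hu Hu'|c' d' a' g Ha' Hg].
  by rewrite !(tprojD, tcompDr) Hu Hu'.
rewrite (tproj_pure _ (gP m) Ha Hf) (tproj_pure _ (gP n) Ha' Hg).
case: eqP => E; last by rewrite tcomp0l (lin0 (@tproj_lin k A (P p) _)).
case: eqP => E'; last by rewrite tcomp0r (lin0 (@tproj_lin k A (P p) _)).
rewrite (tcomp_homog gP _ _ _ _ Hf Ha') tprojZ.
rewrite (tproj_pure _ (gP p) (ahomog_mul Ha Ha') (op_comp_homog HP h i Hf Hg)).
by rewrite E E' addbACA eqxx.
Qed.

Lemma tcomp_assoc l m n p q r
    (h1 : p.+1 = (l + m)%N) (h2 : q.+1 = (p + n)%N)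
    (h3 : r.+1 = (m + n)%N) (h4 : q.+1 = (l + r)%N)
    (i : 'I_l) (j : 'I_m) (c : 'I_p)
    (t : tens A (P l)) (u : tens A (P m)) (v : tens A (P n)) :
  c = (i + j)%N :> nat ->
  tcomp h2 c (tcomp h1 i t u) v = tcomp h4 i t (tcomp h3 j u v).
Proof.
move=> Hc; move: t.
apply: (tens_homog_ind (gP l)) => [t t' Ht Ht'|e1 d1 a1 f1 Ha1 Hf1].
  by rewrite !tcompDl Ht Ht'.
move: u; apply: (tens_homog_ind (gP m)) => [t t' Ht Ht'|e2 d2 a2 f2 Ha2 Hf2].
  by rewrite !(tcompDl, tcompDr) Ht Ht'.
move: v; apply: (tens_homog_ind (gP n)) => [t t' Ht Ht'|e3 d3 a3 f3 Ha3 Hf3].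
  by rewrite !tcompDr Ht Ht'.
rewrite (tcomp_homog gP _ _ _ _ Hf1 Ha2) (tcomp_homog gP _ _ _ _ Hf2 Ha3).
rewrite tcompZl tcompZr (tcomp_homog gP _ _ _ _ Hf1 (ahomog_mul Ha2 Ha3)).
rewrite (tcomp_homog gP _ _ _ _ (op_comp_homog HP h1 i Hf1 Hf2) Ha3).
rewrite !scalerA (na_mulA a1) (op_assoc HP h1 h2 h3 h4 _ _ _ Hc).
by congr (_ *: _); rewrite -!signr_addb; case: (d1) (d2) (e2) (e3) => [] [] [] [].
Qed.

(** Exchanging the two coefficients, exchanging the two operations and moving
    the coefficients past the operations gives altogether the sign of exchanging
    two tensors, because their parities are the total ones. *)
Lemma tcomp_par l m n p q r
    (h1 : p.+1 = (l + m)%N) (h2 : q.+1 = (p + n)%N)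
    (h3 : r.+1 = (l + n)%N) (h4 : q.+1 = (r + m)%N)
    (i j : 'I_l) (c : 'I_p) (c' : 'I_r) b b'
    (t : tens A (P l)) (u : tens A (P m)) (v : tens A (P n)) :
  (i < j)%N -> c.+1 = (j + m)%N -> c' = i :> nat ->
  tcomp h2 c (tcomp h1 i t (tproj b u)) (tproj b' v) =
    (-1) ^+ (b && b') *: tcomp h4 c' (tcomp h3 j t (tproj b' v)) (tproj b u).
Proof.
move=> ij Hc Hc'; move: t.
apply: (tens_homog_ind (gP l)) => [t t' Ht Ht'|e1 d1 a1 f1 Ha1 Hf1].
  by rewrite !tcompDl scalerDr Ht Ht'.
move: u; apply: (tens_homog_ind (gP m)) => [t t' Ht Ht'|e2 d2 a2 f2 Ha2 Hf2].
  by rewrite !(tprojD, tcompDl, tcompDr) scalerDr Ht Ht'.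
move: v; apply: (tens_homog_ind (gP n)) => [t t' Ht Ht'|e3 d3 a3 f3 Ha3 Hf3].
  by rewrite !(tprojD, tcompDl, tcompDr) scalerDr Ht Ht'.
rewrite (tproj_pure _ (gP m) Ha2 Hf2) (tproj_pure _ (gP n) Ha3 Hf3).
case: eqP => Eb; last by rewrite !(tcomp0r, tcomp0l) scaler0.
case: eqP => Eb'; last by rewrite !(tcomp0r, tcomp0l) scaler0.
rewrite (tcomp_homog gP _ _ _ _ Hf1 Ha2) (tcomp_homog gP _ _ _ _ Hf1 Ha3).
rewrite !tcompZl (tcomp_homog gP _ _ _ _ (op_comp_homog HP h1 i Hf1 Hf2) Ha3).
rewrite (tcomp_homog gP _ _ _ _ (op_comp_homog HP h3 j Hf1 Hf3) Ha2).
rewrite (op_par HP h1 h2 h3 h4 _ ij Hc Hc' Hf2 Hf3) -!na_mulA.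
rewrite (na_mulC Ha2 Ha3) na_mulZr tpureZl tpureZr !scalerA Eb Eb'.
congr (_ *: _); rewrite -!signr_addb.
by case: (d1) (d2) (d3) (e2) (e3) => [] [] [] [] [].
Qed.

Lemma tcomp_equivariant m n p (h : p.+1 = (m + n)%N) (i : 'I_m)
    (s : 'S_m) (s' : 'S_n) (r : 'S_p) (t : tens A (P m)) (u : tens A (P n)) :
  (forall (a : 'I_m) (c : 'I_p), a != i -> c = outer_pos i n a :> nat ->
     r c = outer_pos (s i) n (s a) :> nat) ->
  (forall (b : 'I_n) (c : 'I_p), c = (i + b)%N :> nat ->
     r c = (s i + s' b)%N :> nat) ->
  tmap id (oact r) (tcomp h i t u) =
    tcomp h (s i) (tmap id (oact s) t) (tmap id (oact s') u).
Proof.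
move=> Ho Hi; move: t.
apply: (tens_homog_ind (gP m)) => [t t' Ht Ht'|c d a f Ha Hf].
  by rewrite !(tactD, tcompDl) Ht Ht'.
move: u; apply: (tens_homog_ind (gP n)) => [u u' Hu Hu'|c' d' a' g Ha' Hg].
  by rewrite !(tactD, tcompDr) Hu Hu'.
rewrite (tcomp_homog gP _ _ _ _ Hf Ha') tactZ !tact_pure.
rewrite (tcomp_homog gP _ _ _ _ (oact_homog s Hf) Ha').
by rewrite (op_equivariant HP h _ _ Ho Hi).
Qed.

Variable d : forall n, P n -> P n.
Hypothesis d_lin : forall n, linear (@d n).
Hypothesis d_proj : forall n b (f : P n), gproj (~~ b) (d f) = d (gproj b f).

Lemma tdiff_act n (s : 'S_n) (t : tens A (P n)) :
  (forall f : P n, d (oact s f) = oact s (d f)) ->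
  tdiff (@d n) (tmap id (oact s) t) = tmap id (oact s) (tdiff (@d n) t).
Proof.
move=> ds; move: t.
apply: (tens_homog_ind (gP n)) => [t u Ht Hu|c e a f Ha Hf].
  by rewrite tactD !(tdiffD _ _ (@d_lin n)) (tactD _ (tdiff _ t)) Ht Hu.
rewrite tact_pure !(tdiff_pure _ (@d_lin n) Ha) tactD tactZ !tact_pure.
by rewrite ds.
Qed.

Lemma tdiff_comp m n p (h : p.+1 = (m + n)%N) (i : 'I_m)
    (t : tens A (P m)) (u : tens A (P n)) :
  (forall (f : P m) (g : P n), d (ocomp h i f g) =
     ocomp h i (d f) g + ocomp h i (koszul true f) (d g)) ->
  tdiff (@d p) (tcomp h i t u) = tcomp h i (tdiff (@d m) t) u +
    tcomp h i (koszul (V := GMod (@tproj_lin k A (P m))) true t) (tdiff (@d n) u).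
Proof.
move=> dc; move: t.
apply: (tens_homog_ind (gP m)) => [t t' Ht Ht'|c e a f Ha Hf].
  have KD := linD t t' (koszul_lin (V := GMod (@tproj_lin k A (P m))) true).
  rewrite [koszul true _]KD tcompDl !(tdiffD _ _ (@d_lin _)) Ht Ht'.
  by rewrite (tcompDl h i (tdiff _ t)) (tcompDl h i (koszul (V := GMod (@tproj_lin k A (P m))) true t)) addrACA.
move: u; apply: (tens_homog_ind (gP n)) => [u u' Hu Hu'|c' e' a' g Ha' Hg].
  rewrite tcompDr !(tdiffD _ _ (@d_lin _)) Hu Hu' tcompDr.
  by rewrite (tcompDr h i _ (tdiff _ u)) addrACA.
have Ht : homog (V := GMod (@tproj_lin k A (P m))) (c (+) e) (tpure a f).
  by rewrite /homog /= (tproj_pure _ (gP m) Ha Hf) eqxx.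
have Hdf : homog (~~ e) (d f) by rewrite /homog d_proj Hf.
rewrite (koszul_homog (tens_graded (gP m)) _ Ht) /=.
rewrite (tcomp_homog gP _ _ _ _ Hf Ha') (linZ _ _ (tdiff_lin (@d_lin p))).
rewrite (tdiff_pure _ (@d_lin p) (ahomog_mul Ha Ha')).
rewrite (tdiff_pure _ (@d_lin m) Ha) (tdiff_pure _ (@d_lin n) Ha').
rewrite !(tcompDl, tcompDr, tcompZl, tcompZr).
rewrite !(tcomp_homog gP _ _ _ _ Hf Ha') (tcomp_homog gP _ _ _ _ Hdf Ha').
rewrite (tcomp_homog gP _ _ _ _ Hf (ahomog_d Ha')).
rewrite na_leibniz (koszul_homog (na_graded A) _ Ha) dc.
rewrite (koszul_homog (gP m) _ Hf) (linZ _ _ (ocomp_linl h i _)).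
rewrite na_mulZl tpureDl tpureZl tpureDr tpureZr !scalerDr !scalerA.
rewrite -!signr_addb -!addrA; congr (_ + _).
rewrite [RHS]addrCA; congr (_ *: _ + (_ *: _ + _ *: _)); congr (_ ^+ _).
- by case: (c) (e) (c') => [] [] [].
- by case: (c) (e) (c') => [] [] [].
- by case: (c) (e) (c') => [] [] [].
Qed.

End TensorAxioms.

End PureTensors.

Section CompletedOperad.
Variables (k : fieldType) (A : formal_cdga k).

Lemma ct_graded (W : gmod k) : is_graded W -> is_graded (ct_gmod A W).
Proof.
move=> gW; have H i := tens_graded (A i) gW.
split=> [t|a b t]; apply: ctensP => i /=; first exact: (H i).1.
have := (H i).2 a b (cfam t i); rewrite /=.
by case: ifP => _ ->.
Qed.

Section Operad.
Variables (P : operad_sig k) (HP : is_operad P).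

Lemma cfam_homog n b (t : ct_operad_sig A P n) j : homog b t ->
  tproj b (cfam t j) = cfam t j.
Proof. by move=> {2}<-. Qed.

(** Everything is computed at each stage A_i of the limit. *)
Lemma ct_is_operad : is_operad (ct_operad_sig A P).
Proof.
split=> /=.
- by move=> n; exact/ct_graded/(op_graded HP).
- by move=> n t; apply: ctensP => j /=; exact: tact1.
- by move=> n s r t; apply: ctensP => j /=; exact: tactM.
- by move=> n s b t; apply: ctensP => j /=; exact: tact_proj.
- move=> m n p h i a b t u Ht Hu; apply: ctensP => j /=.
  by rewrite -(cfam_homog j Ht) -(cfam_homog j Hu); exact: tcomp_proj.
- move=> l m n p q r h1 h2 h3 h4 i j c t u v Hc; apply: ctensP => a /=.
  exact: tcomp_assoc.
- move=> l m n p q r h1 h2 h3 h4 i j c c' a b t u v ij Hc Hc' Hu Hv.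
  apply: ctensP => x /=; rewrite -(cfam_homog x Hu) -(cfam_homog x Hv).
  exact: tcomp_par.
- move=> m n p h i s s' r t u Ho Hi; apply: ctensP => j /=.
  exact: tcomp_equivariant.
Qed.
End Operad.

End CompletedOperad.

(** * Signs of permutations of homogeneous tuples *)


Section PermSign.

(** The number modulo 2 of the pairs of odd letters that s inverts.  Signs are
    handled through this exponent because a product of signs then becomes a sum
    over [addb], over which [andb] distributes. *)
Definition inv_parity n (s : 'S_n) (e : 'I_n -> bool) : bool :=
  \big[addb/false]_(i < n) \big[addb/false]_(j < n)
    [&& (i < j)%N, (s j < s i)%N, e (s i) & e (s j)].

Lemma perm_signE (k : fieldType) n (s : 'S_n) (e : 'I_n -> bool) :
  perm_sign k s e = (-1) ^+ inv_parity s e.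
Proof.
have M := @big_morph k bool (fun b : bool => (-1) ^+ b) 1 *%R false addb
  (signr_addb k) (expr0 _).
rewrite /perm_sign /inv_parity M; apply: eq_bigr => i _.
rewrite M big_mkcond; apply: eq_bigr => j _.
by case: (i < j)%N; case: (s j < s i)%N.
Qed.

Lemma ltn_ord_neq n (i j : 'I_n) : i != j -> (j < i)%N = ~~ (i < j)%N.
Proof. by move=> ij; rewrite -leqNgt ltn_neqAle eq_sym (inj_eq val_inj) ij. Qed.

(** A permutation of the letters permutes the unordered pairs; for symmetric G
    the condition i < j only selects one representative of each pair. *)
Lemma xsum_pairs_perm n (s : 'S_n) (G : 'I_n -> 'I_n -> bool) :
  (forall i j, G i j = G j i) ->
  \big[addb/false]_(i < n) \big[addb/false]_(j < n) ((i < j)%N && G (s i) (s j)) =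
  \big[addb/false]_(i < n) \big[addb/false]_(j < n) ((i < j)%N && G i j).
Proof.
move=> Gsym.
pose F (i j : 'I_n) := [&& (i < j)%N, (s^-1%g i < s^-1%g j)%N & G i j].
pose F' (i j : 'I_n) := [&& (i < j)%N, (s^-1%g j < s^-1%g i)%N & G i j].
transitivity (\big[addb/false]_(i < n) \big[addb/false]_(j < n) (F i j (+) F' j i)).
  rewrite (reindex_inj (@perm_inj _ s^-1%g)); apply: eq_bigr => i _.
  rewrite (reindex_inj (@perm_inj _ s^-1%g)); apply: eq_bigr => j _.
  rewrite !permKV /F /F' (Gsym j i).
  case: (i =P j) => [->|/eqP ij]; first by rewrite !ltnn.
  rewrite (ltn_ord_neq ij).
  by case: (i < j)%N; case: (_ < _)%N; case: (G i j).
transitivity (\big[addb/false]_(i < n) \big[addb/false]_(j < n) (F i j (+) F' i j)).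
  under eq_bigr do rewrite big_split.
  rewrite big_split /= [X in _ (+) X]exchange_big -big_split.
  by apply: eq_bigr => i _; rewrite -big_split.
apply: eq_bigr => i _; apply: eq_bigr => j _; rewrite /F /F'.
case: (i =P j) => [->|/eqP ij]; first by rewrite !ltnn.
rewrite (@ltn_ord_neq _ (s^-1%g i)) ?(inj_eq (@perm_inj _ _)) //.
by case: (i < j)%N; case: (_ < _)%N; case: (G i j).
Qed.

Lemma inv_parity1 n (e : 'I_n -> bool) : inv_parity 1%g e = false.
Proof.
rewrite /inv_parity big1 // => i _; rewrite big1 // => j _.
by rewrite !perm1; case: ltngtP.
Qed.

(** A pair is inverted by the composite when it is inverted by exactly one of
    the two factors. *)
Lemma inv_parityM n (s t : 'S_n) (e : 'I_n -> bool) :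
  inv_parity (s * t)%g e = inv_parity t e (+) inv_parity s (fun j => e (t j)).
Proof.
pose G (i j : 'I_n) :=
  ((i < j)%N (+) (t i < t j)%N) && (e (t i) && e (t j)).
have Gsym i j : G i j = G j i.
  rewrite /G; case: (i =P j) => [->//|/eqP ij].
  rewrite (ltn_ord_neq ij) (@ltn_ord_neq _ (t i)) ?(inj_eq perm_inj) //.
  by rewrite addNb addbN negbK [e (t i) && _]andbC.
have -> : inv_parity t e =
    \big[addb/false]_(i < n) \big[addb/false]_(j < n) ((i < j)%N && G i j).
  apply: eq_bigr => i _; apply: eq_bigr => j _; rewrite /G.
  case: (i =P j) => [->|/eqP ij]; first by rewrite ltnn.
  rewrite (@ltn_ord_neq _ (t i)) ?(inj_eq perm_inj) //.
  by case: (i < j)%N.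
rewrite -(xsum_pairs_perm s Gsym) /inv_parity -big_split.
apply: eq_bigr => i _; rewrite -big_split; apply: eq_bigr => j _ /=.
rewrite !permM /G; case: (i =P j) => [->|/eqP ij]; first by rewrite !ltnn.
rewrite (@ltn_ord_neq _ (s i)) ?(inj_eq perm_inj) //.
rewrite (@ltn_ord_neq _ (t (s i))) ?(inj_eq perm_inj) //.
by case: (i < j)%N; case: (s i < s j)%N; case: (t _ < _)%N; case: (e _);
  case: (e _).
Qed.

Lemma eq_inv_parity n (s : 'S_n) (e e' : 'I_n -> bool) :
  e =1 e' -> inv_parity s e = inv_parity s e'.
Proof.
by move=> E; apply: eq_bigr => i _; apply: eq_bigr => j _; rewrite !E.
Qed.

(** Changing the parity of the letter s(i) changes the sign for every odd
    letter that it passes; these are the letters that stand before it on exactly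
    one of the two sides. *)
Lemma inv_parity_flip n (s : 'S_n) (e : 'I_n -> bool) (q : bool) (i : 'I_n) :
  inv_parity s (fun j => e j (+) (q && (j == s i))) =
  inv_parity s e (+)
    (q && ((\big[addb/false]_(j < n) ((j < i)%N && e (s j))) (+)
           (\big[addb/false]_(j < n) ((s j < s i)%N && e (s j))))).
Proof.
pose F (j : 'I_n) := [&& (i < j)%N, (s j < s i)%N, q & e (s j)].
pose F' (j : 'I_n) := [&& (j < i)%N, (s i < s j)%N, q & e (s j)].
transitivity (inv_parity s e (+)
    ((\big[addb/false]_(j < n) F j) (+) (\big[addb/false]_(j < n) F' j))).
  transitivity (inv_parity s e (+)
    ((\big[addb/false]_(a < n) \big[addb/false]_(j < n) ((a == i) && F j)) (+)
     (\big[addb/false]_(a < n) \big[addb/false]_(j < n) ((j == i) && F' a)))).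
    rewrite /inv_parity -!big_split; apply: eq_bigr => a _.
    rewrite -!big_split; apply: eq_bigr => j _ /=.
    rewrite !(inj_eq perm_inj) /F /F'.
    case: (a =P i) => [->|_]; case: (j =P i) => [->|_] /=;
      rewrite ?ltnn ?andbF ?andbT ?addbF //=.
    + by case: (_ < _)%N; case: (_ < _)%N; case: (e _); case: (e _); case: (q).
    + by case: (_ < _)%N; case: (_ < _)%N; case: (e _); case: (e _); case: (q).
  congr (_ (+) (_ (+) _)).
    rewrite (bigD1 i) //= [X in _ (+) X]big1 ?addbF; first by apply: eq_bigr => j _; rewrite eqxx.
    by move=> a ai; rewrite big1 // => j _; rewrite (negbTE ai).
  apply: eq_bigr => a _; rewrite (bigD1 i) //= eqxx big1 ?addbF //.
  by move=> j ji; rewrite (negbTE ji).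
congr (_ (+) _); rewrite -!big_split big_distrr; apply: eq_bigr => j _.
rewrite /F /F' /=; case: (i =P j) => [->|/eqP ij]; first by rewrite !ltnn /= andbF.
rewrite (ltn_ord_neq ij) (@ltn_ord_neq _ (s i)) ?(inj_eq perm_inj) //.
by case: (i < j)%N; case: (s i < s j)%N; case: (e _); case: (q).
Qed.

End PermSign.

(** * Positions in a partial composition *)

Section Positions.

(** The inputs of f o_i g are the inputs of f other than i, together with those of
    g; every sum over the entries of a tuple is split in this way. *)
Lemma big_inputs (R : Type) (idx : R) (op : Monoid.com_law idx) m n p
    (h : p.+1 = (m + n)%N) (i : 'I_m) (F : nat -> R) :
  \big[op/idx]_(c < p) F c =
    op (\big[op/idx]_(a < m | a != i) F (outer_pos i n a))
       (\big[op/idx]_(b < n) F (i + b)%N).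
Proof.
have Hi := ltn_ord i.
rewrite -(big_mkord xpredT F) (@big_cat_nat _ _ _ i 0 p xpredT F) /=; try lia.
rewrite (@big_cat_nat _ _ _ (i + n) i p) /=; try lia.
rewrite -(big_mkord (fun a => a != i :> nat) (fun a => F (outer_pos i n a))).
rewrite (@big_cat_nat _ _ _ i 0 m) /=; try lia.
rewrite (@big_cat_nat _ _ _ i.+1 i m) /=; try lia.
rewrite [\big[op/idx]_(i <= _ < i.+1 | _) _]big1_seq; last first.
  by move=> a /andP[ai]; rewrite mem_index_iota => ?; lia.
rewrite Monoid.mul1m [X in op _ X = _]Monoid.mulmC Monoid.mulmA.
congr (op (op _ _) _).
- rewrite [RHS]big_nat_cond [LHS]big_nat_cond; apply: eq_big => a.
    by lia.
  by rewrite /outer_pos => /andP[/andP[_ ->]].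
- rewrite big_addn -(addn1 i) big_addn.
  have -> : (p - n = m - 1)%N by lia.
  rewrite [RHS]big_nat_cond [LHS]big_nat_cond; apply: eq_big => a; first lia.
  by move=> Ha; rewrite /outer_pos ifF; [congr F; lia|lia].
- rewrite -{1}[nat_of_ord i]add0n big_addn addKn big_mkord.
  by apply: eq_bigr => b _; rewrite addnC.
Qed.

Lemma outer_pos_lt (i n a c : nat) : a != i -> c != i ->
  (outer_pos i n a < outer_pos i n c)%N = (a < c)%N.
Proof. by rewrite /outer_pos; do 2!case: ifP => ?; lia. Qed.

Lemma outer_lt_inner (i n a b : nat) : (b < n)%N -> a != i ->
  (outer_pos i n a < i + b)%N = (a < i)%N.
Proof. by rewrite /outer_pos; case: ifP => ?; lia. Qed.

Lemma inner_lt_outer (i n a b : nat) : (b < n)%N -> a != i ->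
  (i + b < outer_pos i n a)%N = (i < a)%N.
Proof. by rewrite /outer_pos; case: ifP => ?; lia. Qed.

Lemma outer_pos_bound m n p (i a : nat) : p.+1 = (m + n)%N -> (a < m)%N ->
  (i < m)%N -> a != i -> (outer_pos i n a < p)%N.
Proof. by rewrite /outer_pos; case: ifP => ?; lia. Qed.

(** In the block permutation r the block behaves as one letter with the total
    parity of the block. *)
Lemma inv_parity_block m n p (h : p.+1 = (m + n)%N) (i : 'I_m)
    (s : 'S_m) (t : 'S_n) (r : 'S_p) (E : nat -> bool) :
  (forall (a : 'I_m) (c : 'I_p), a != i -> c = outer_pos i n a :> nat ->
     r c = outer_pos (s i) n (s a) :> nat) ->
  (forall (b : 'I_n) (c : 'I_p), c = (i + b)%N :> nat ->
     r c = (s i + t b)%N :> nat) ->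
  inv_parity r (fun c => E c) =
    inv_parity s (fun a => if a == s i then \big[addb/false]_(b < n) E (s i + b)%N
                           else E (outer_pos (s i) n a)) (+)
    inv_parity t (fun b => E (s i + b)%N).
Proof.
move=> Ho Hi; set e' := fun a : 'I_m => _.
pose rn x := oapp (fun c : 'I_p => nat_of_ord (r c)) 0%N (insub x).
have rnE (c : 'I_p) : rn c = r c by rewrite /rn valK.
have rno (a : 'I_m) : a != i -> rn (outer_pos i n a) = outer_pos (s i) n (s a).
  move=> ai; have Hc := outer_pos_bound h (ltn_ord a) (ltn_ord i) ai.
  by rewrite (rnE (Ordinal Hc)) (Ho a).
have rni (b : 'I_n) : rn (i + b)%N = (s i + t b)%N.
  have Hc : (i + b < p)%N by have := ltn_ord i; have := ltn_ord b; lia.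
  by rewrite (rnE (Ordinal Hc)) (Hi b).
have e'i : e' (s i) = \big[addb/false]_b E (s i + t b)%N.
  by rewrite /e' eqxx (reindex_inj (@perm_inj _ t)).
have e'o a : a != i -> e' (s a) = E (outer_pos (s i) n (s a)).
  by move=> ai; rewrite /e' (inj_eq perm_inj) (negbTE ai).
pose H x y := [&& (x < y)%N, (rn y < rn x)%N, E (rn x) & E (rn y)].
pose K (a c : 'I_m) := [&& (a < c)%N, (s c < s a)%N, e' (s a) & e' (s c)].
have -> : inv_parity r (fun c => E c) =
    \big[addb/false]_(c < p) \big[addb/false]_(c' < p) H c c'.
  by apply: eq_bigr => c _; apply: eq_bigr => c' _; rewrite /H !rnE.
rewrite (big_inputs _ h i (fun x => \big[addb/false]_(c' < p) H x c')).
have HS x : \big[addb/false]_(c < p) H x c =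
    (\big[addb/false]_(a < m | a != i) H x (outer_pos i n a)) (+)
    (\big[addb/false]_(b < n) H x (i + b)%N) by exact: big_inputs.
rewrite (eq_bigr _ (fun (a : 'I_m) _ => HS (outer_pos i n a))).
rewrite (eq_bigr _ (fun (b : 'I_n) _ => HS (i + b)%N)) !big_split /=.
have -> : inv_parity s e' =
    (\big[addb/false]_(a | a != i) \big[addb/false]_(c | c != i) K a c) (+)
    ((\big[addb/false]_(a | a != i) K a i) (+)
     (\big[addb/false]_(c | c != i) K i c)).
  rewrite {1}/inv_parity (bigD1 i) //= (bigD1 i) //= ltnn /=.
  under [X in _ (+) X]eq_bigr do rewrite (bigD1 i) //=.
  rewrite big_split /= addbC.
  by rewrite [X in X (+) _ = _]addbC -addbA.
rewrite -!addbA; congr (_ (+) _).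
  apply: eq_bigr => a ai; apply: eq_bigr => c ci.
  rewrite /H /K !rno // !outer_pos_lt ?(inj_eq perm_inj) ?e'o //.
  by rewrite (inj_eq val_inj) (inj_eq perm_inj).
  by rewrite (inj_eq val_inj) (inj_eq perm_inj).
congr (_ (+) _).
  apply: eq_bigr => a ai; rewrite /K e'i e'o // !big_distrr /=.
  apply: eq_bigr => b _; rewrite /H rno // rni outer_lt_inner //.
  by rewrite inner_lt_outer // (inj_eq val_inj) (inj_eq perm_inj).
congr (_ (+) _).
  rewrite exchange_big; apply: eq_bigr => a ai.
  rewrite /K e'i e'o // big_distrl !big_distrr /=.
  apply: eq_bigr => b _; rewrite /H rno // rni inner_lt_outer //.
  by rewrite outer_lt_inner // (inj_eq val_inj) (inj_eq perm_inj).
apply: eq_bigr => b _; apply: eq_bigr => b' _.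
by rewrite /H !rni !ltn_add2l.
Qed.

End Positions.

(** * Multilinear maps on homogeneous tuples *)

Section MultilinearMaps.
Variables (k : fieldType) (W : lmodType k).

Lemma upd_id n (v : 'I_n -> W) c : upd v c (v c) = v.
Proof. by apply: funext => j; rewrite /upd; case: eqP => [->|]. Qed.

Variables (n : nat) (f : ('I_n -> W) -> W).
Hypothesis Hf : multilinear f.

Lemma multilinearZ v c a x : f (upd v c (a *: x)) = a *: f (upd v c x).
Proof. exact: (linZ a x (Hf v c)). Qed.

Lemma multilinearD v c x y : f (upd v c (x + y)) = f (upd v c x) + f (upd v c y).
Proof. exact: (linD x y (Hf v c)). Qed.

Lemma multilinear_eq0 v c : v c = 0 -> f v = 0.
Proof. by move=> Hc; rewrite -(upd_id v c) Hc; exact: (lin0 (Hf v c)). Qed.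

Lemma multilinear_slotZ v w c a : w c = a *: v c ->
  (forall j, j != c -> w j = v j) -> f w = a *: f v.
Proof.
move=> Hc Ho; rewrite -[in RHS](upd_id v c) -multilinearZ -Hc; congr f.
by apply: funext => j; rewrite /upd; case: eqP => [->//|/eqP]; exact: Ho.
Qed.

Lemma multilinear_scale_slots v (c : 'I_n -> k) :
  f (fun j => c j *: v j) = (\prod_j c j) *: f v.
Proof.
have H d : (d <= n)%N -> f (fun j => (if (j < d)%N then c j else 1) *: v j) =
    (\prod_(j < n | (j < d)%N) c j) *: f v.
  elim: d => [|d IH] Hd.
    rewrite big_pred0 // scale1r; congr f; apply: funext => j.
    by rewrite scale1r.
  rewrite (bigD1 (Ordinal Hd)) //= -scalerA.
  have -> : \prod_(j < n | (j < d.+1)%N && (j != Ordinal Hd)) c j =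
      \prod_(j < n | (j < d)%N) c j.
    apply: eq_bigl => j; have -> : (j == Ordinal Hd) = (j == d :> nat) by [].
    lia.
  rewrite -IH; last lia.
  apply: (@multilinear_slotZ _ _ (Ordinal Hd)) => /=.
    by rewrite ltnSn ltnn scale1r.
  move=> j Hj; have {}Hj : (j != d :> nat) by [].
  by congr (_ *: _); rewrite ltnS leq_eqVlt (negbTE Hj).
have -> : \prod_j c j = \prod_(j < n | (j < n)%N) c j.
  by apply: eq_bigl => j; rewrite ltn_ord.
rewrite -H //; congr f; apply: funext => j.
by rewrite ltn_ord.
Qed.

Lemma multilinear_signs v (c : 'I_n -> bool) :
  f (fun j => (-1) ^+ c j *: v j) =
    (-1) ^+ (\big[addb/false]_j c j) *: f v.
Proof.
rewrite multilinear_scale_slots; congr (_ *: _); symmetry.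
exact: (@big_morph k bool (fun b : bool => (-1) ^+ b) 1 *%R false addb
  (signr_addb k) (expr0 _)).
Qed.

End MultilinearMaps.

Section HomogeneousTuples.
Variables (k : fieldType) (W : gmod k).
Hypothesis gW : is_graded W.

Definition homs n (e : 'I_n -> bool) (v : 'I_n -> W) : Prop :=
  forall j, homog (e j) (v j).

(** The entries are split into their even and odd parts one after the other. *)
Lemma multilinear_ext n (f g : ('I_n -> W) -> W) :
  multilinear f -> multilinear g ->
  (forall e v, homs e v -> f v = g v) -> forall v, f v = g v.
Proof.
move=> Hf Hg Hfg v.
have H d : (d <= n)%N -> forall u : 'I_n -> W,
    (forall j : 'I_n, (d <= j)%N -> exists b, homog b (u j)) -> f u = g u.
  elim: d => [|d IH] Hd u Hu.
    have [e He] := choice (fun j => Hu j (leq0n j)).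
    exact: (Hfg e).
  pose c := Ordinal Hd; rewrite -(upd_id u c) -[u c]gW.1.
  have Hupd b : f (upd u c (gproj b (u c))) = g (upd u c (gproj b (u c))).
    apply: IH => [|j Hj]; first exact: ltnW.
    rewrite /upd; case: (j =P c) => [_|jc]; first by exists b; exact: homog_gproj.
    apply: Hu; rewrite ltn_neqAle Hj andbT; apply/eqP => E; apply: jc.
    exact/val_inj.
  by rewrite !multilinearD // !Hupd.
by apply: (H n) => // j; rewrite leqNgt ltn_ord.
Qed.

(** The operations on multilinear maps are sums over all parity patterns e'.  On
    a homogeneous tuple the pattern of its own parities is the only one that
    contributes, as any other one projects some entry to 0. *)
Lemma sum_homog_tuple n (e : 'I_n -> bool) v
    (F : ('I_n -> bool) -> ('I_n -> W) -> W) :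
  homs e v -> (forall e' w j, w j = 0 -> F e' w = 0) ->
  \sum_(e' : {ffun 'I_n -> bool}) F e' (fun j => gproj (e' j) (v j)) = F e v.
Proof.
move=> Hv F0; rewrite (bigD1 [ffun j => e j]) //= big1 => [|e' He'].
  rewrite addr0; have E : [ffun j => e j] = e :> ('I_n -> bool).
    by apply: funext => j; rewrite ffunE.
  by rewrite E; congr F; apply: funext => j; rewrite Hv.
have [j Hj] : exists j, e' j != e j.
  apply/existsP; apply: contraNT He'; rewrite negb_exists => /forallP H.
  by apply/eqP/ffunP => j; rewrite ffunE; apply/eqP; have := H j; rewrite negbK.
by apply: (F0 _ _ j); rewrite (gproj_homog gW _ (Hv j)) (negbTE Hj).
Qed.

End HomogeneousTuples.

Section TupleEntries.
Variables (k : fieldType) (W : dgvect k).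

Lemma tup_atE n (v : 'I_n -> W) x (Hx : (x < n)%N) : tup_at v x = v (Ordinal Hx).
Proof. by rewrite /tup_at insubT. Qed.

Lemma tup_at_ord n (v : 'I_n -> W) (j : 'I_n) : tup_at v j = v j.
Proof. by rewrite /tup_at valK. Qed.

Definition par_at n (e : 'I_n -> bool) (x : nat) : bool := oapp e false (insub x).

Lemma par_at_ord n (e : 'I_n -> bool) (j : 'I_n) : par_at e j = e j.
Proof. by rewrite /par_at valK. Qed.

Lemma homog_tup_at n (e : 'I_n -> bool) (v : 'I_n -> W) x :
  homs e v -> homog (par_at e x) (tup_at v x).
Proof.
move=> Hv; rewrite /tup_at /par_at; case: insubP => [j _ _|_] /=.
  exact: Hv.
exact: homog0.
Qed.

Lemma xsum_par_at n (e : 'I_n -> bool) :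
  \big[addb/false]_j e j = \big[addb/false]_(j < n) par_at e j.
Proof. by apply: eq_bigr => j _; rewrite par_at_ord. Qed.

End TupleEntries.

(** * The endomorphism operad *)

Section Endo.
Variables (k : fieldType) (W : dgvect k).
Let gW := dv_graded W.

Lemma mlin_ext n (f g : mlin W n) :
  (forall e v, homs e v -> f v = g v) -> f = g.
Proof.
move=> H; apply: mlinP.
by apply: (multilinear_ext gW) => //; exact: mfun_multilinear.
Qed.

Lemma endo_projE n b (f : mlin W n) e v : homs e v ->
  endo_proj b f v = gproj (b (+) \big[addb/false]_j e j) (f v).
Proof.
move=> Hv /=; pose F (e' : 'I_n -> bool) w :=
  gproj (b (+) \big[addb/false]_j e' j) (f w).
apply: (sum_homog_tuple (F := F) gW Hv) => e' w j Hj; rewrite /F.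
rewrite (multilinear_eq0 (mfun_multilinear f) Hj).
exact: (lin0 (@gproj_lin k W _)).
Qed.

Lemma endo_actE n (s : 'S_n) (f : mlin W n) e v : homs e v ->
  endo_act s f v = (-1) ^+ inv_parity s e *: f (fun j => v (s j)).
Proof.
move=> Hv /=; rewrite -perm_signE.
pose F (e' : 'I_n -> bool) (w : 'I_n -> W) :=
  perm_sign k s e' *: f (fun j => w (s j)).
apply: (sum_homog_tuple (F := F) gW Hv) => e' w j Hj; rewrite /F.
rewrite (@multilinear_eq0 _ _ _ _ (mfun_multilinear f) _ (s^-1%g j)).
  exact: scaler0.
by rewrite permKV.
Qed.

Lemma endo_graded n : is_graded (endo_gmod W n).
Proof.
split=> [f|a b f]; apply: mlin_ext => e v Hv.
  rewrite [LHS](_ : _ = endo_proj false f v + endo_proj true f v) //.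
  rewrite !(endo_projE _ _ Hv) /=.
  by case: (\big[_/_]_(_ < _) _); rewrite ?gW.1 // addrC gW.1.
rewrite [LHS](endo_projE a _ Hv) (endo_projE b _ Hv) gW.2.
rewrite (inj_eq (@addIb _)).
by case: eqP => _ //; rewrite (endo_projE b _ Hv).
Qed.

Lemma endo_homogP n b (f : mlin W n) :
  (forall e v, homs e v -> homog (b (+) \big[addb/false]_j e j) (f v)) <->
  homog (V := endo_gmod W n) b f.
Proof.
split=> [H|H e v Hv].
  by apply: mlin_ext => e v Hv; rewrite [LHS](endo_projE b _ Hv) H.
by rewrite /homog -[in RHS]H (endo_projE b _ Hv).
Qed.

Lemma endo_act_homog n (s : 'S_n) b (f : mlin W n) :
  homog (V := endo_gmod W n) b f -> homog (V := endo_gmod W n) b (endo_act s f).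
Proof.
move=> /endo_homogP Hf; apply/endo_homogP => e v Hv.
rewrite (endo_actE _ _ Hv); apply: homogZ.
rewrite (reindex_inj (@perm_inj _ s)); apply: Hf => j; exact: Hv.
Qed.

Lemma endo_act_proj n (s : 'S_n) b (f : endo_gmod W n) :
  gproj b (endo_act s f : endo_gmod W n) = endo_act s (gproj b f).
Proof.
move: f; apply: (graded_ind (@endo_graded n)) => [f g Hf Hg|c f Hf].
  rewrite (linD _ _ (endo_act_lin s)) !(linD _ _ (@gproj_lin k (endo_gmod W n) b)).
  by rewrite (linD _ _ (endo_act_lin s)) Hf Hg.
rewrite (gproj_homog (@endo_graded n) _ Hf).
rewrite (gproj_homog (@endo_graded n) _ (endo_act_homog s Hf)).
by case: eqP => // _; rewrite (lin0 (endo_act_lin s)).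
Qed.

Lemma endo_act1 n (f : mlin W n) : endo_act 1%g f = f.
Proof.
apply: mlin_ext => e v Hv; rewrite (endo_actE _ _ Hv) inv_parity1 scale1r.
by congr (mfun f _); apply: funext => j; rewrite perm1.
Qed.

Lemma endo_actM n (s t : 'S_n) (f : mlin W n) :
  endo_act (s * t)%g f = endo_act t (endo_act s f).
Proof.
apply: mlin_ext => e v Hv; rewrite !(endo_actE _ _ Hv).
rewrite (@endo_actE _ s f (fun j => e (t j))); last by move=> j; exact: Hv.
rewrite scalerA -signr_addb -inv_parityM; congr (_ *: mfun f _).
by apply: funext => j; rewrite permM.
Qed.

(** For g homogeneous the sign of g passing the entries before it is known, and
    the sum over the two parities of g has one term. *)
Lemma endo_comp_homogE m n p (h : p.+1 = (m + n)%N) (i : 'I_m) b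
    (f : mlin W m) (g : mlin W n) v : homog (V := endo_gmod W n) b g ->
  endo_comp h i f g v = f (endo_inputs i b g v).
Proof.
move=> Hg; have Hgb : endo_proj b g = g := Hg.
rewrite endo_compE (bigD1 b) // Hgb big1 => [|q /andP[_ Hq]]; first exact: addr0.
have -> : endo_proj q g = 0.
  have := gproj_homog (@endo_graded n) q Hg.
  by rewrite (negbTE Hq).
apply: (multilinear_eq0 (mfun_multilinear f) (c := i)).
by rewrite /endo_inputs ltnn eqxx.
Qed.

(** The parity of g(v) is that of g plus those of the entries.  In the parallel
    axiom and in the Leibniz rule this is the sign by which an odd operator moves
    past g. *)
Lemma koszul_multilinear n (g : mlin W n) b q (v : 'I_n -> W) :
  homog (V := endo_gmod W n) b g ->
  g (fun j => koszul q (v j)) = (-1) ^+ (q && b) *: koszul q (g v).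
Proof.
move=> /endo_homogP Hg; move: v.
apply: (@multilinear_ext _ _ gW _ (fun v => g (fun j => koszul q (v j)))
  (fun v => (-1) ^+ (q && b) *: koszul q (g v))).
- apply: (multilinear_slots (L := fun _ => koszul q)) => [|j].
    exact: mfun_multilinear.
  exact: koszul_lin.
- apply: multilinear_scale; apply: multilinear_post; first exact: koszul_lin.
  exact: mfun_multilinear.
move=> e v Hv; rewrite (koszul_homog gW _ (Hg e v Hv)) scalerA -signr_addb.
have -> : (fun j => koszul q (v j)) = (fun j => (-1) ^+ (q && e j) *: v j).
  by apply: funext => j; rewrite (koszul_homog gW _ (Hv j)).
rewrite (multilinear_signs (mfun_multilinear g)); congr (_ ^+ _ *: _).
by rewrite -big_distrr /=; case: (q) (b) => [] [] //=; rewrite negbK.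
Qed.

Lemma endo_comp_homog m n p (h : p.+1 = (m + n)%N) (i : 'I_m) a b
    (f : mlin W m) (g : mlin W n) :
  homog (V := endo_gmod W m) a f -> homog (V := endo_gmod W n) b g ->
  homog (V := endo_gmod W p) (a (+) b) (endo_comp h i f g).
Proof.
move=> /endo_homogP Hf Hg; have /endo_homogP Hg' := Hg.
apply/endo_homogP => e v Hv; rewrite (endo_comp_homogE _ _ _ _ Hg).
pose E := par_at e.
pose e' (x : 'I_m) := if x == i then b (+) \big[addb/false]_(y < n) E (i + y)%N
                      else E (outer_pos i n x).
have -> : a (+) b (+) \big[addb/false]_j e j = a (+) \big[addb/false]_j e' j.
  rewrite -addbA; congr (_ (+) _); rewrite [RHS](bigD1 i) //= {1}/e' eqxx.
  rewrite xsum_par_at (big_inputs _ h i (par_at e)) -addbA; congr (_ (+) _).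
  rewrite addbC; congr (_ (+) _); apply: eq_bigr => x xi.
  by rewrite /e' (negbTE xi).
apply: Hf => x; rewrite /endo_inputs /e' /outer_pos.
have -> : (x == i) = (x == i :> nat) by [].
case: (nat_of_ord x =P i) => [->|xi].
  by rewrite ltnn; apply: Hg' => y; exact: homog_tup_at.
by case: ifP => _; [apply: (homog_koszul gW)|]; exact: homog_tup_at.
Qed.
End Endo.

Section EndoOperad.
Variables (k : fieldType) (W : dgvect k).
Let gW := dv_graded W.
Let gE n := @endo_graded k W n.

Local Notation ehomog b f := (homog (V := endo_gmod W _) b f).

Lemma ord_eqE n (a b : 'I_n) : (a == b) = (a == b :> nat).
Proof. by []. Qed.

Lemma endo_compDl m n p (h : p.+1 = (m + n)%N) (i : 'I_m)
    (f f' : mlin W m) (g : mlin W n) :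
  endo_comp h i (f + f') g = endo_comp h i f g + endo_comp h i f' g.
Proof. exact: (linD f f' (endo_comp_linl h i g)). Qed.

Lemma endo_compDr m n p (h : p.+1 = (m + n)%N) (i : 'I_m)
    (f : mlin W m) (g g' : mlin W n) :
  endo_comp h i f (g + g') = endo_comp h i f g + endo_comp h i f g'.
Proof. exact: (linD g g' (endo_comp_linr h i f)). Qed.

Lemma endo_actD n (s : 'S_n) (f f' : mlin W n) :
  endo_act s (f + f') = endo_act s f + endo_act s f'.
Proof. exact: (linD f f' (endo_act_lin s)). Qed.

(** The two sides are f at the same tuple: the entries before the block are
    passed by g and e one after the other, or by g o_j e at once. *)
Lemma endo_assoc l m n p q r
    (h1 : p.+1 = (l + m)%N) (h2 : q.+1 = (p + n)%N)
    (h3 : r.+1 = (m + n)%N) (h4 : q.+1 = (l + r)%N)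
    (i : 'I_l) (j : 'I_m) (c : 'I_p)
    (f : mlin W l) (g : mlin W m) (e : mlin W n) :
  c = (i + j)%N :> nat ->
  endo_comp h2 c (endo_comp h1 i f g) e = endo_comp h4 i f (endo_comp h3 j g e).
Proof.
move=> Hc; move: g; apply: (graded_ind (@gE m)) => [g g' Hg Hg'|b g Hg].
  by rewrite !(endo_compDl, endo_compDr) Hg Hg'.
move: e; apply: (graded_ind (@gE n)) => [e e' He He'|b' e He].
  by rewrite !endo_compDr He He'.
apply: mlinP => v; rewrite (endo_comp_homogE _ _ _ _ He).
rewrite (endo_comp_homogE _ _ _ _ Hg).
rewrite (endo_comp_homogE _ _ _ _ (endo_comp_homog h3 j Hg He)).
congr (mfun f _); apply: funext => a.
have Ha := ltn_ord a; have Hi := ltn_ord i; have Hj := ltn_ord j.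
rewrite [LHS]/endo_inputs [RHS]/endo_inputs ord_eqE.
case: ltngtP => ai.
- have Hap : (a < p)%N by lia.
  rewrite (tup_atE _ Hap) /endo_inputs ifT /=; last lia.
  by rewrite (koszulK gW).
- have Hap : ((a + m).-1 < p)%N by lia.
  rewrite (tup_atE _ Hap) /endo_inputs ord_eqE /= ifF; last lia.
  rewrite ifF; last lia.
  by congr (tup_at v _); lia.
rewrite (endo_comp_homogE _ _ _ _ He); congr (mfun g _); apply: funext => b0.
have Hb := ltn_ord b0.
have Hap : (i + b0 < p)%N by lia.
rewrite (tup_atE _ Hap) /endo_inputs !ord_eqE /= Hc ltn_add2l eqn_add2l.
have tupE (x : nat) : (x < r)%N ->
    tup_at (fun y : 'I_r => tup_at v (i + y)) x = tup_at v (i + x).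
  by move=> Hx; rewrite (tup_atE _ Hx).
case: ltngtP => bj.
- by rewrite tupE //; lia.
- by rewrite tupE; [congr (tup_at v _)|]; lia.
congr (mfun e _); apply: funext => y; have Hy := ltn_ord y.
by rewrite tupE ?addnA //; lia.
Qed.

(** Only the entry i of f differs: on the left e passes the inputs of g before g
    is applied, on the right it passes the value of g. *)
Lemma endo_par l m n p q r
    (h1 : p.+1 = (l + m)%N) (h2 : q.+1 = (p + n)%N)
    (h3 : r.+1 = (l + n)%N) (h4 : q.+1 = (r + m)%N)
    (i j : 'I_l) (c : 'I_p) (c' : 'I_r) b b'
    (f : mlin W l) (g : mlin W m) (e : mlin W n) :
  (i < j)%N -> c.+1 = (j + m)%N -> c' = i :> nat ->
  ehomog b g -> ehomog b' e ->
  endo_comp h2 c (endo_comp h1 i f g) e =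
    (-1) ^+ (b && b') *: endo_comp h4 c' (endo_comp h3 j f e) g.
Proof.
move=> ij Hc Hc' Hg He; apply: mlinP => v.
rewrite (endo_comp_homogE _ _ _ _ He) (endo_comp_homogE _ _ _ _ Hg).
rewrite [RHS](_ : _ = (-1) ^+ (b && b') *:
  endo_comp h4 c' (endo_comp h3 j f e) g v) //.
rewrite (endo_comp_homogE _ _ _ _ Hg) (endo_comp_homogE _ _ _ _ He).
have Hi := ltn_ord i; have Hj := ltn_ord j.
apply: (multilinear_slotZ (mfun_multilinear f) (c := i)).
  rewrite [in LHS]/endo_inputs ltnn eqxx.
  rewrite [in RHS]/endo_inputs ij.
  have Hir : (i < r)%N by lia.
  rewrite (tup_atE _ Hir) /endo_inputs ord_eqE /= Hc' ltnn eqxx.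
  rewrite andbC -(koszul_multilinear _ _ Hg); congr (mfun g _).
  apply: funext => y; have Hy := ltn_ord y; have Hyp : (i + y < p)%N by lia.
  by rewrite (tup_atE _ Hyp) /endo_inputs /= ifT //; lia.
move=> a ai; have {}ai : (a != i :> nat) by [].
have Ha := ltn_ord a.
rewrite [LHS]/endo_inputs [RHS]/endo_inputs !ord_eqE (negbTE ai).
case: ltnP => ai'.
  have Hap : (a < p)%N by lia.
  have Har : (a < r)%N by lia.
  rewrite (tup_atE _ Hap) (tup_atE _ Har) /endo_inputs !ord_eqE /=.
  rewrite !ifT; try lia.
  by rewrite !(koszulK gW) addbC.
have Hap : ((a + m).-1 < p)%N by lia.
rewrite (tup_atE _ Hap) [in LHS]/endo_inputs ord_eqE /=.
case: (ltngtP a j) => aj.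
- have Har : (a < r)%N by lia.
  rewrite (tup_atE _ Har) /endo_inputs ord_eqE /=.
  by rewrite ifT 1?ifF 1?ifF //; lia.
- have Har : ((a + n).-1 < r)%N by lia.
  rewrite (tup_atE _ Har) /endo_inputs ord_eqE /=.
  by rewrite ifF 1?ifF 1?ifF 1?ifF; try lia; congr (tup_at v _); lia.
rewrite ifF; last lia.
rewrite ifT; last lia.
congr (mfun e _); apply: funext => y; have Hy := ltn_ord y.
have Hyr : (j + y < r)%N by lia.
rewrite (tup_atE _ Hyr) /endo_inputs ord_eqE /=.
by rewrite ifF 1?ifF; try lia; congr (tup_at v _); lia.
Qed.

(** On a homogeneous tuple both sides are a sign times f at X, where X is the
    tuple of the entries of f without signs.  The signs agree by
    [inv_parity_block], which moves the block as one letter, and by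
    [inv_parity_flip], which accounts for the parity q that g adds to it. *)
Lemma endo_equivariant m n p (h : p.+1 = (m + n)%N) (i : 'I_m)
    (s : 'S_m) (t : 'S_n) (r : 'S_p) (f : mlin W m) (g : mlin W n) :
  (forall (a : 'I_m) (c : 'I_p), a != i -> c = outer_pos i n a :> nat ->
     r c = outer_pos (s i) n (s a) :> nat) ->
  (forall (b : 'I_n) (c : 'I_p), c = (i + b)%N :> nat ->
     r c = (s i + t b)%N :> nat) ->
  endo_act r (endo_comp h i f g) = endo_comp h (s i) (endo_act s f) (endo_act t g).
Proof.
move=> Ho Hi; move: g; apply: (graded_ind (@gE n)) => [g g' Hg Hg'|q g Hg].
  by rewrite !(endo_compDr, endo_actD) Hg Hg'.
apply: mlin_ext => e v Hv; rewrite (endo_actE _ _ Hv).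
rewrite (endo_comp_homogE _ _ _ _ Hg).
rewrite (endo_comp_homogE _ _ _ _ (endo_act_homog t Hg)).
pose E := par_at e; have Im := ltn_ord i.
pose e' (a : 'I_m) := if a == s i then \big[addb/false]_(b < n) E (s i + b)%N
                      else E (outer_pos (s i) n a).
pose w (b : 'I_n) := tup_at v (s i + b).
have Hw : homs (fun b : 'I_n => E (s i + b)%N) w by move=> b; exact: homog_tup_at.
pose Y := endo_inputs (s i) q (endo_act t g) v.
have HY : homs (fun a => e' a (+) (q && (a == s i))) Y.
  move=> a; rewrite /Y /endo_inputs /e' /outer_pos.
  case: (a =P s i) => [->|/eqP ai].
    have /endo_homogP Hg' := endo_act_homog t Hg.
    by rewrite ltnn andbT addbC; exact: Hg'.
  rewrite andbF addbF; case: ifP => _; last exact: homog_tup_at.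
  by apply: (homog_koszul gW); exact: homog_tup_at.
rewrite (endo_actE _ _ HY) inv_parity_flip.
pose X (a : 'I_m) := if a == i then g (fun b => tup_at v (s i + t b))
                     else tup_at v (outer_pos (s i) n (s a)).
pose x (a : 'I_m) := q && ((a < i)%N && e' (s a)).
pose y (a : 'I_m) := (if a == i then inv_parity t (fun b => E (s i + b)%N)
  else false) (+) (q && ((s a < s i)%N && e' (s a))).
have -> : endo_inputs i q g (fun c => v (r c)) = fun a => (-1) ^+ x a *: X a.
  apply: funext => a; rewrite /endo_inputs /x /X.
  case: (a =P i) => [->|/eqP ai].
    rewrite ltnn andbF scale1r; congr (mfun g _); apply: funext => b.
    have Hc : (i + b < p)%N by have := ltn_ord b; lia.
    by rewrite (tup_atE _ Hc) -(Hi b (Ordinal Hc)) // tup_at_ord.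
  have Hc := outer_pos_bound h (ltn_ord a) Im ai.
  have <- : v (r (Ordinal Hc)) = tup_at v (outer_pos (s i) n (s a)).
    by rewrite -(Ho a (Ordinal Hc)) // tup_at_ord.
  have He' : e' (s a) = e (r (Ordinal Hc)).
    rewrite /e' (inj_eq perm_inj) (negbTE ai) -(Ho a (Ordinal Hc)) //.
    exact: par_at_ord.
  rewrite He'.
  case: (ltnP a i) => ai' /=.
    rewrite -(koszul_homog gW q (Hv _)); congr (koszul _ _).
    have Hac : (a < p)%N by have := Hc; rewrite /outer_pos ai'.
    rewrite (tup_atE _ Hac); congr (v (r _)); apply: val_inj => /=.
    by rewrite /outer_pos ai'.
  rewrite andbF scale1r.
  have Hac : ((a + n).-1 < p)%N by have := Hc; rewrite /outer_pos ifF //; lia.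
  rewrite (tup_atE _ Hac); congr (v (r _)); apply: val_inj => /=.
  by rewrite /outer_pos ifF //; lia.
have -> : (fun a => Y (s a)) = fun a => (-1) ^+ y a *: X a.
  apply: funext => a; rewrite /Y /endo_inputs /y /X (inj_eq perm_inj).
  case: (a =P i) => [->|/eqP ai].
    by rewrite ltnn andbF addbF (endo_actE _ _ Hw).
  have He' : e' (s a) = E (outer_pos (s i) n (s a)).
    by rewrite /e' (inj_eq perm_inj) (negbTE ai).
  rewrite He' addFb /outer_pos; case: ifP => _ /=; last first.
    by rewrite andbF scale1r.
  by rewrite (koszul_homog gW _ (homog_tup_at _ Hv)).
rewrite !(multilinear_signs (mfun_multilinear f)) !scalerA -!signr_addb.
congr ((-1) ^+ nat_of_bool _ *: _).
have -> : inv_parity r e = inv_parity r (fun c => E c).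
  by apply: eq_inv_parity => c; rewrite /E par_at_ord.
rewrite (inv_parity_block h E Ho Hi) -/e' -!addbA; congr (_ (+) _).
have -> : \big[addb/false]_a y a = inv_parity t (fun b => E (s i + b)%N) (+)
    (q && \big[addb/false]_(a < m) ((s a < s i)%N && e' (s a))).
  rewrite /y big_split big_distrr /=; congr (_ (+) _).
  by rewrite -big_mkcond big_pred1_eq.
rewrite /x -big_distrr /=.
by case: q {Hg Y HY x y Hw} => /=; rewrite ?addbF // addbCA -addbA addbb addbF.
Qed.

Lemma endo_is_operad : is_operad (endo_operad_sig W).
Proof.
split=> /=.
- exact: endo_graded.
- exact: endo_act1.
- exact: endo_actM.
- exact: endo_act_proj.
- exact: endo_comp_homog.
- by move=> *; exact: endo_assoc.
- by move=> *; exact: endo_par.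
- by move=> *; exact: endo_equivariant.
Qed.

End EndoOperad.

(** * The differential of the endomorphism operad *)

Section EndoDifferential.
Variables (k : fieldType) (W : dgvect k).
Let gW := dv_graded W.
Let gE n := @endo_graded k W n.

Local Notation ehomog b f := (homog (V := endo_gmod W _) b f).

(** The position x is a natural number, so that the sum over the inputs of a
    composite can be split by [big_inputs]. *)
Definition diff_entry n (x : nat) (v : 'I_n -> W) : 'I_n -> W := fun j =>
  if (j < x)%N then koszul true (v j)
  else if j == x :> nat then dv_d (v j) else v j.

Lemma dv_homog b (w : W) : homog b w -> homog (~~ b) (dv_d w).
Proof. by case: (dv_diff W) => _ H _ Hw; rewrite /homog H Hw. Qed.

Lemma dv_koszul q (w : W) : dv_d (koszul q w) = (-1) ^+ q *: koszul q (dv_d w).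
Proof.
move: w; apply: (graded_ind gW) => [u w Hu Hw|b w Hw].
  rewrite !(linD _ _ (koszul_lin (V := W) q), linD _ _ (@dv_lin k W)).
  by rewrite scalerDr Hu Hw.
rewrite (koszul_homog gW _ Hw) (koszul_homog gW _ (dv_homog Hw)).
rewrite (linZ _ _ (@dv_lin k W)) scalerA -signr_addb; congr (_ ^+ _ *: _).
by case: q b {Hw} => [] [].
Qed.

Lemma tup_at_diff_entry n x (v : 'I_n -> W) y :
  tup_at (diff_entry x v) y = if (y < x)%N then koszul true (tup_at v y)
    else if y == x then dv_d (tup_at v y) else tup_at v y.
Proof.
have HK := koszul_lin (V := W) true; have HD := @dv_lin k W.
rewrite /tup_at /diff_entry; move: (koszul _) (dv_d (d := W)) HK HD => K D HK HD.
case: insubP => [j _ <-|_] //=.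
by rewrite (lin0 HK) (lin0 HD); case: ifP => // _; case: ifP.
Qed.

Lemma homs_diff_entry n (i : 'I_n) e (v : 'I_n -> W) : homs e v ->
  homs (fun j => e j (+) (true && (j == i))) (diff_entry i v).
Proof.
move=> Hv j; rewrite /diff_entry ord_eqE; case: ltngtP => _.
- by rewrite addbF; apply: (homog_koszul gW).
- by rewrite addbF.
- by rewrite addbT; exact: dv_homog.
Qed.

Lemma endo_diffD n (f g : mlin W n) :
  endo_diff (f + g) = endo_diff f + endo_diff g.
Proof. exact: (linD f g (@endo_diff_lin k W n)). Qed.

Lemma endo_diff_homogE n b (f : mlin W n) v : ehomog b f ->
  endo_diff f v = dv_d (f v) - (-1) ^+ b *: \sum_(i < n) f (diff_entry i v).
Proof.
by move=> Hf; rewrite endo_diffE (koszul_homog (@gE n) _ Hf) /= scaler_sumr.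
Qed.

Lemma endo_diff_homog n b (f : mlin W n) :
  ehomog b f -> ehomog (~~ b) (endo_diff f).
Proof.
move=> Hf; have /endo_homogP Hf' := Hf; apply/endo_homogP => e v Hv.
rewrite (endo_diff_homogE _ Hf) -scaleNr addNb; apply: homogD.
  exact/dv_homog/Hf'.
apply: homogZ; apply: (big_ind (fun w : W => homog _ w)) => [|x y|i _];
  [exact: homog0|exact: homogD|].
have := Hf' _ _ (homs_diff_entry i Hv); rewrite big_split /=.
have -> : \big[addb/false]_(j < n) (j == i) = true.
  by rewrite (bigD1 i) //= eqxx big1 // => j /negbTE.
by rewrite addbT addbN.
Qed.

Lemma endo_diff_proj n b (f : endo_gmod W n) :
  gproj (~~ b) (endo_diff f : endo_gmod W n) = endo_diff (gproj b f).
Proof.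
move: f; apply: (graded_ind (@gE n)) => [f g Hf Hg|c f Hf].
  rewrite endo_diffD !(linD _ _ (@gproj_lin k (endo_gmod W n) _)).
  by rewrite endo_diffD Hf Hg.
rewrite (gproj_homog (@gE n) _ Hf) (gproj_homog (@gE n) _ (endo_diff_homog Hf)).
rewrite (inj_eq (can_inj negbK)).
by case: eqP => // _; rewrite (lin0 (@endo_diff_lin k W n)).
Qed.

(** Applying d to the entry s(i) changes its parity; by [inv_parity_flip] the
    change of the permutation sign makes up for the different entries that d
    passes on the two sides. *)
Lemma endo_diff_act n (s : 'S_n) (f : mlin W n) :
  endo_diff (endo_act s f) = endo_act s (endo_diff f).
Proof.
move: f; apply: (graded_ind (@gE n)) => [f g Hf Hg|c f Hf].
  by rewrite !(endo_actD, endo_diffD) Hf Hg.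
apply: mlin_ext => e v Hv; rewrite (endo_actE _ _ Hv).
rewrite (endo_diff_homogE _ (endo_act_homog s Hf)) (endo_diff_homogE _ Hf).
rewrite (endo_actE _ _ Hv) (linZ _ _ (@dv_lin k W)) scalerBr; congr (_ - _).
rewrite scalerA mulrC -scalerA; congr (_ *: _); rewrite scaler_sumr.
rewrite (reindex_inj (@perm_inj _ s)); apply: eq_bigr => i _.
rewrite (endo_actE _ _ (homs_diff_entry (s i) Hv)) inv_parity_flip andTb.
pose X (a : 'I_n) := if a == i then dv_d (v (s i)) else v (s a).
have -> : (fun a => diff_entry (s i) v (s a)) =
    fun a => (-1) ^+ ((s a < s i)%N && e (s a)) *: X a.
  apply: funext => a; rewrite /diff_entry /X -ord_eqE (inj_eq perm_inj).
  case: (a =P i) => [->|_]; first by rewrite ltnn scale1r.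
  case: ifP => _; last by rewrite scale1r.
  by rewrite (koszul_homog gW _ (Hv _)).
have -> : diff_entry i (fun a => v (s a)) =
    fun a => (-1) ^+ ((a < i)%N && e (s a)) *: X a.
  apply: funext => a; rewrite /diff_entry /X -ord_eqE.
  case: (a =P i) => [->|_]; first by rewrite ltnn scale1r.
  case: ifP => _; last by rewrite scale1r.
  by rewrite (koszul_homog gW _ (Hv _)).
rewrite !(multilinear_signs (mfun_multilinear f)) !scalerA -!signr_addb.
by rewrite -addbA -addbA addbb addbF.
Qed.

(** This makes the linear dependence on the inserted value visible. *)
Lemma endo_inputs_upd m n p (i : 'I_m) q (G : ('I_n -> W) -> W) (v : 'I_p -> W) :
  endo_inputs i q G v =
    upd (endo_inputs i q (fun _ : 'I_n -> W => 0) v) i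
        (G (fun b => tup_at v (i + b))).
Proof.
apply: funext => a; rewrite /upd /endo_inputs ord_eqE.
by case: (nat_of_ord a =P i) => [->|]; rewrite ?ltnn.
Qed.

(** Let X be the tuple to which f is applied and B the same tuple with 0 as
    entry i and with the entries before it passed by d as well.  Applying d to an entry of the
    block gives a term of dg (HC), and applying it to another entry gives up to
    the sign of g a term of df (HD).  The remaining term of df applies d to g(w);
    it also occurs in dg with the opposite sign (HA). *)
Lemma endo_diff_comp m n p (h : p.+1 = (m + n)%N) (i : 'I_m)
    (f : mlin W m) (g : mlin W n) :
  endo_diff (endo_comp h i f g) = endo_comp h i (endo_diff f) g +
    endo_comp h i (koszul (V := endo_gmod W m) true f) (endo_diff g).
Proof.
move: f; apply: (graded_ind (@gE m)) => [f f' Hf Hf'|a f Hf].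
  rewrite (linD _ _ (koszul_lin (V := endo_gmod W m) true)).
  rewrite endo_compDl !endo_diffD Hf Hf' endo_compDl.
  by rewrite (endo_compDl h i (koszul (V := endo_gmod W m) true f)) addrACA.
move: g; apply: (graded_ind (@gE n)) => [g g' Hg Hg'|b g Hg].
  by rewrite !(endo_compDr, endo_diffD) Hg Hg' addrACA.
rewrite (koszul_homog (@gE m) _ Hf) (linZ _ _ (endo_comp_linl h i _)).
apply: mlinP => v; rewrite (endo_diff_homogE _ (endo_comp_homog h i Hf Hg)).
rewrite [RHS](_ : _ = endo_comp h i (endo_diff f) g v +
  (-1) ^+ a *: endo_comp h i f (endo_diff g) v) //.
rewrite !(endo_comp_homogE _ _ _ _ Hg).
rewrite (endo_comp_homogE _ _ _ _ (endo_diff_homog Hg)).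
rewrite (endo_diff_homogE _ Hf) -addrA; congr (_ + _).
rewrite signr_addb -scalerA -scalerN -scalerN -[X in X + _]scalerN -scalerDr.
congr (_ *: _).
set X := endo_inputs i b g v.
pose w (y : 'I_n) := tup_at v (i + y).
pose B := endo_inputs i (~~ b) (fun _ : 'I_n -> W => 0) v.
have Hf' := mfun_multilinear f.
have HA : f (endo_inputs i (~~ b) (endo_diff g) v) =
    f (diff_entry i X) - (-1) ^+ b *: \sum_(y < n) f (upd B i (g (diff_entry y w))).
  rewrite endo_inputs_upd (endo_diff_homogE _ Hg) -scaleNr multilinearD //.
  rewrite multilinearZ // scaleNr (lin_sum _ _ (Hf' B i)); congr (f _ - _).
  apply: funext => y; rewrite /upd /B /X /diff_entry /endo_inputs ord_eqE.
  by case: ltngtP => // _; rewrite (koszulK gW) addTb.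
have HC (y : 'I_n) :
    endo_comp h i f g (diff_entry (i + y) v) = f (upd B i (g (diff_entry y w))).
  rewrite (endo_comp_homogE _ _ _ _ Hg); congr (mfun f _).
  apply: funext => z; rewrite /upd /B /endo_inputs ord_eqE.
  have Hz := ltn_ord z; have Hy := ltn_ord y.
  case: ltngtP => zi.
  - rewrite tup_at_diff_entry ifT; last lia.
    by rewrite (koszulK gW) addbT.
  - by rewrite tup_at_diff_entry !ifF //; lia.
  congr (mfun g _); apply: funext => x.
  by rewrite tup_at_diff_entry /diff_entry ltn_add2l eqn_add2l.
have HD (a' : 'I_m) : a' != i ->
    endo_comp h i f g (diff_entry (outer_pos i n a') v) =
    (-1) ^+ b *: f (diff_entry a' X).
  move=> ai; rewrite (endo_comp_homogE _ _ _ _ Hg).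
  have {}ai : (a' != i :> nat) by [].
  have Ha := ltn_ord a'; case: (ltnP a' i) => ai'.
    rewrite /outer_pos ai'; apply: (multilinear_slotZ Hf' (c := a')) => [|z za].
      rewrite /diff_entry ltnn eqxx /X /endo_inputs ai'.
      rewrite dv_koszul scalerA -signr_addb addbb scale1r.
      by rewrite tup_at_diff_entry ltnn eqxx.
    have {}za : (z != a' :> nat) by [].
    rewrite /diff_entry (negbTE za) /X /endo_inputs ord_eqE.
    case: (ltngtP z i) => zi.
    - rewrite tup_at_diff_entry (negbTE za); case: ifP => // _.
      by rewrite !(koszulK gW) addbC.
    - rewrite tup_at_diff_entry !ifF //; lia.
    rewrite ifF; last lia.
    congr (mfun g _); apply: funext => y.
    by rewrite tup_at_diff_entry !ifF //; lia.
  rewrite /outer_pos ltnNge ai' /=.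
  apply: (multilinear_slotZ Hf' (c := i)) => [|z zi].
    rewrite /diff_entry /X ltn_neqAle ai' eq_sym ai /endo_inputs ltnn eqxx.
    transitivity (g (fun y => koszul true (w y))).
      2: by rewrite (koszul_multilinear _ _ Hg) andTb.
    congr (mfun g _); apply: funext => y; have Hy := ltn_ord y.
    by rewrite tup_at_diff_entry ifT //; lia.
  have {}zi : (z != i :> nat) by [].
  rewrite /X /diff_entry /endo_inputs ord_eqE (negbTE zi).
  case: ltnP => zi'.
    rewrite tup_at_diff_entry !ifT; try lia.
    by rewrite !(koszulK gW) addbC.
  rewrite tup_at_diff_entry.
  have -> : ((z + n).-1 < (a' + n).-1)%N = (z < a')%N by lia.
  by have -> : ((z + n).-1 == (a' + n).-1)%N = (z == a' :> nat) by lia.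
have -> : \sum_(c < p) endo_comp h i f g (diff_entry c v) =
    (-1) ^+ b *: \sum_(y < m | y != i) f (diff_entry y X) +
    \sum_(y < n) f (upd B i (g (diff_entry y w))).
  rewrite scaler_sumr -(eq_bigr _ HD) -(eq_bigr _ (fun y _ => HC y)).
  exact: (big_inputs _ h i (fun c => endo_comp h i f g (diff_entry c v))).
rewrite HA scalerN scalerDr scalerA -signr_addb addbb scale1r [in RHS](bigD1 i) //.
by rewrite [RHS]addrA !opprD [X in _ = X + _ - _]addrC subrK.
Qed.

End EndoDifferential.

(** * Derivations of operads *)

(** Two derivations along one operad map agree on an operadic expression as soon
    as they agree on the elements that occur in it. *)
Record is_derivation (k : fieldType) (P : operad_sig k)
    (d : forall n, P n -> P n) : Prop := IsDerivation {
  der_lin : forall n, linear (@d n);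
  der_proj : forall n b (f : P n), gproj (~~ b) (d n f) = d n (gproj b f);
  der_act : forall n (s : 'S_n) (f : P n), d n (oact s f) = oact s (d n f);
  der_comp : forall m n p (h : p.+1 = (m + n)%N) (i : 'I_m)
      (f : P m) (g : P n),
    d p (ocomp h i f g) =
      ocomp h i (d m f) g + ocomp h i (koszul true f) (d n g) }.

Lemma differential_derivation (k : fieldType) (P : operad_sig k)
    (d : forall n, P n -> P n) : is_differential d -> is_derivation d.
Proof.
by move=> [Hd Ha Hc]; split=> // n; have [] := Hd n.
Qed.

Lemma endo_derivation (k : fieldType) (W : dgvect k) :
  is_derivation (P := endo W) (@odiff k (endo W)).
Proof.
split.
- exact: endo_diff_lin.
- exact: endo_diff_proj.
- exact: endo_diff_act.
- exact: endo_diff_comp.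
Qed.

Lemma ct_derivation (k : fieldType) (A : formal_cdga k) (P : dgoperad_sig k) :
  is_operad P -> is_derivation (P := P) (@odiff k P) ->
  is_derivation (P := ct_dgoperad_sig A P) (@odiff k (ct_dgoperad_sig A P)).
Proof.
move=> HP [dl dp da dc]; split=> /=.
- by move=> n; exact: ct_diff_lin.
- move=> n b t; apply: ctensP => i /=.
  by apply: tproj_tdiff; [exact: (op_graded HP) | exact: dl | exact: dp].
- by move=> n s t; apply: ctensP => i /=; exact: (tdiff_act HP).
- move=> m n p h i t u; apply: ctensP => j.
  exact: (tdiff_comp HP dl dp (cfam t j) (cfam u j) (dc m n p h i)).
Qed.

(** * Nilpotency *)

Section Products.
Variables (k : fieldType) (A : ncdga k).

(** The power A^N, as the span of the products of at least N elements bracketed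
    to the left. *)
Inductive prods (N : nat) : A -> Prop :=
  | prods_fold a s : (N <= (size s).+1)%N -> prods N (foldl (@na_mul k A) a s)
  | prodsD a b : prods N a -> prods N b -> prods N (a + b)
  | prodsZ c a : prods N a -> prods N (c *: a).

Lemma na_mulDl (a b c : A) : na_mul (a + b) c = na_mul a c + na_mul b c.
Proof. exact: (linD a b (na_mul_linl c)). Qed.

Lemma na_mulDr (a b c : A) : na_mul a (b + c) = na_mul a b + na_mul a c.
Proof. exact: (linD b c (na_mul_linr a)). Qed.

Lemma foldl_na_mulA (a b : A) s :
  na_mul a (foldl (@na_mul k A) b s) = foldl (@na_mul k A) (na_mul a b) s.
Proof. by elim: s b => [//|c s IH] b /=; rewrite IH na_mulA. Qed.

(** By associativity the product of two products bracketed to the left can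
    itself be bracketed to the left. *)
Lemma prodsM M N a b : prods M a -> prods N b -> prods (M + N) (na_mul a b).
Proof.
move=> Ha Hb; elim: Ha => {a} [a s Hs|a a' _ Ha _ Ha'|c a _ Ha].
- elim: Hb => {b} [b t Ht|b b' _ Hb _ Hb'|c b _ Hb].
  + rewrite foldl_na_mulA -[na_mul _ b]/(foldl (@na_mul k A) _ [:: b]).
    rewrite -!foldl_cat; apply: prods_fold; rewrite !size_cat /=; lia.
  + by rewrite na_mulDr; exact: prodsD.
  + by rewrite na_mulZr; exact: prodsZ.
- by rewrite na_mulDl; exact: prodsD.
- by rewrite na_mulZl; exact: prodsZ.
Qed.

Lemma koszul_na_mul e (a b : A) :
  koszul (V := na_gmod A) e (na_mul a b) =
    na_mul (koszul (V := na_gmod A) e a) (koszul (V := na_gmod A) e b).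
Proof.
have gA := na_graded A; have KD x y := linD x y (koszul_lin (V := na_gmod A) e).
move: a; apply: (graded_ind gA) => [a a' Ha Ha'|c a Ha].
  by rewrite KD !na_mulDl [LHS]KD Ha Ha'.
move: b; apply: (graded_ind gA) => [b b' Hb Hb'|d b Hb].
  by rewrite KD !na_mulDr [LHS]KD Hb Hb'.
rewrite (koszul_homog gA _ Ha) (koszul_homog gA _ Hb).
rewrite (koszul_homog gA _ (ahomog_mul Ha Hb)) na_mulZl na_mulZr scalerA.
by rewrite -signr_addb andb_addr.
Qed.

Lemma prods_koszul N e a : prods N a -> prods N (koszul (V := na_gmod A) e a).
Proof.
elim=> {a} [a s Hs|a b _ Ha _ Hb|c a _ Ha].
- have -> : koszul (V := na_gmod A) e (foldl (@na_mul k A) a s) =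
      foldl (@na_mul k A) (koszul (V := na_gmod A) e a)
        [seq koszul (V := na_gmod A) e b | b <- s].
    by elim: s a {Hs} => [//|b s IH] a /=; rewrite IH koszul_na_mul.
  by apply: prods_fold; rewrite size_map.
- by rewrite (linD a b (koszul_lin (V := na_gmod A) e)); exact: prodsD.
- by rewrite (linZ c a (koszul_lin (V := na_gmod A) e)); exact: prodsZ.
Qed.

(** The subspace A^N (x) W of A (x) W. *)
Inductive tdeep (W : lmodType k) (N : nat) : tens A W -> Prop :=
  | tdeep_pure a w : prods N a -> tdeep N (tpure a w)
  | tdeepD t u : tdeep N t -> tdeep N u -> tdeep N (t + u).

Lemma prods0 N : prods N 0.
Proof.
by rewrite -(scale0r (foldl (@na_mul k A) 0 (nseq N 0))); apply: prodsZ;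
  apply: prods_fold; rewrite size_nseq.
Qed.

Lemma tdeep0 (W : lmodType k) N : tdeep N (0 : tens A W).
Proof. by rewrite -(@tpure0l k A W 0); apply: tdeep_pure; exact: prods0. Qed.

Lemma tdeepZ (W : lmodType k) N c (t : tens A W) : tdeep N t -> tdeep N (c *: t).
Proof.
elim=> {t} [a w Ha|t u _ Ht _ Hu].
  by rewrite -tpureZr; exact: tdeep_pure.
by rewrite scalerDr; exact: tdeepD.
Qed.

Lemma tdeep_any (W : lmodType k) N (t : tens A W) : (N <= 1)%N -> tdeep N t.
Proof.
move=> HN; rewrite [t]tens_pure /tlift; apply: big_ind => [|x y|l _].
- exact: tdeep0.
- exact: tdeepD.
- by apply: tdeep_pure; exact: (@prods_fold N _ [::]).
Qed.

Lemma tdeep_map (W W' : lmodType k) (g : W -> W') N (t : tens A W) :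
  linear g -> tdeep N t -> tdeep N (tmap id g t).
Proof.
move=> Hg; elim=> {t} [a w Ha|t u _ Ht _ Hu].
  by rewrite tmap_pure //; exact: tdeep_pure.
by rewrite tmapD //; exact: tdeepD.
Qed.

Lemma tdeep_comp (P : operad_sig k) m n p (h : p.+1 = (m + n)%N) (i : 'I_m) M N
    (t : tens A (P m)) (u : tens A (P n)) :
  tdeep M t -> tdeep N u -> tdeep (M + N) (tcomp h i t u).
Proof.
move=> Ht Hu; elim: Ht => {t} [a f Ha|t t' _ Ht _ Ht'].
  elim: Hu => {u} [b g Hb|u u' _ Hu _ Hu'].
    rewrite tcomp_pure big_bool; apply: tdeepD; apply: tdeep_pure;
      by apply: prodsM => //; exact: prods_koszul.
  by rewrite tcompDr; exact: tdeepD.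
by rewrite tcompDl; exact: tdeepD.
Qed.

(** A product of N + 1 elements is a fold over N elements, hence the successor. *)
Definition nil_bound : nat := (projT1 (cid (na_nilpotent A))).+1.

Lemma prods_nil (a : A) : prods nil_bound a -> a = 0.
Proof.
rewrite /nil_bound; case: cid => N HN /=.
elim=> {a} [a s Hs|a b _ -> _ ->|c a _ ->]; last 2 first.
- by rewrite addr0.
- by rewrite scaler0.
exact: HN.
Qed.

Lemma tdeep_nil (W : lmodType k) (t : tens A W) : tdeep nil_bound t -> t = 0.
Proof.
elim=> {t} [a w /prods_nil ->|t u _ -> _ ->]; last exact: addr0.
exact: tpure0l.
Qed.

End Products.

(** * Completions *)

Section Powers.
Variables (k : fieldType) (P : operad k) (J : ideal P).

Lemma ipow_pred N n (f : P n) : ipow J N f -> ipow J N.-1 f.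
Proof.
elim=> {N n f} /=.
- by move=> n f; exact: ipow_any.
- by move=> n f _; exact: ipow_any.
- by move=> N n; exact: ipow_0.
- by move=> N n c f g _ Hf _ Hg; exact: ipow_lin.
- by move=> N n s f _ Hf; exact: ipow_act.
- move=> [|M] N m n p h i f g Hf0 Hf Hg0 Hg.
    by rewrite add0n -[N.-1]add0n; exact: ipow_comp.
  by rewrite addSn /=; exact: ipow_comp.
Qed.

Lemma ipow_leq M N n (f : P n) : (M <= N)%N -> ipow J N f -> ipow J M f.
Proof.
move=> /subnK <-; elim: (N - M)%N => [//|d IH] H; apply: IH.
exact: (ipow_pred H).
Qed.

Lemma cseq_stable n (u : cseq J n) M N :
  (M <= N)%N -> ipow J M (u N - u M).
Proof.
move=> /subnK <-; elim: (N - M)%N => [|d IH].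
  by rewrite add0n subrr; exact: ipow_0.
rewrite addSn -[u _.+1](subrK (u (d + M)%N)) -addrA; apply: ipowD => //.
by apply: ipow_leq (cterm_compat u _); exact: leq_addl.
Qed.

Lemma completion_incl_map : operad_map (@completion_incl k P J).
Proof.
split.
- by move=> n c u v; rewrite /completion_incl clin_cls; apply: ccls_eq.
- by move=> n b u; rewrite [RHS]cproj_cls; apply: ccls_eq.
- by move=> n s u; rewrite [RHS]cact_cls; apply: ccls_eq.
- by move=> m n p h i u v; rewrite [RHS]ccomp_cls; apply: ccls_eq.
Qed.

End Powers.

Section ExtendToCompletion.
Variables (k : fieldType) (A : formal_cdga k) (P : operad_sig k).
Variables (Q : operad k) (J : ideal Q).
Variable f : forall n, Q n -> ct_operad_sig A P n.
Hypothesis Hf : operad_map f.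

(** Each factor of a composite, whether or not it lies in J, has its coefficient
    in A, so N factors in J give coefficients in A^N. *)
Lemma ipow_tdeep N n (u : Q n) i : ipow J N u -> tdeep N (cfam (f u) i).
Proof.
elim=> {N n u}.
- by move=> n u; exact: tdeep_any.
- by move=> n u _; exact: tdeep_any.
- by move=> N n; rewrite (lin0 (@om_lin _ _ _ _ Hf n)); exact: tdeep0.
- move=> N n c u v _ Hu _ Hv; rewrite (om_lin Hf) /=.
  by apply: tdeepD => //; exact: tdeepZ.
- move=> N n s u _ Hu; rewrite (om_act Hf) /=.
  by apply: tdeep_map => //; exact: oact_lin.
- by move=> M N m n p h j u v _ Hu _ Hv; rewrite (om_comp Hf); exact: tdeep_comp.
Qed.

Lemma ipow_vanish N n (u : Q n) i :
  (nil_bound (A i) <= N)%N -> ipow J N u -> cfam (f u) i = 0.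
Proof. by move=> HN Hu; apply/tdeep_nil/ipow_tdeep/(ipow_leq HN Hu). Qed.

Lemma ipow_cfam_eq N n (u v : Q n) i :
  (nil_bound (A i) <= N)%N -> ipow J N (u - v) -> cfam (f u) i = cfam (f v) i.
Proof.
move=> HN Huv; apply/eqP; rewrite -subr_eq0; apply/eqP.
by rewrite -(ipow_vanish HN Huv) (linB _ _ (@om_lin _ _ _ _ Hf n)).
Qed.

(** Modulo J^N a sequence is constant from its N-th term on, and J^N is mapped to
    zero in A_i for N at least [nil_bound]; this term is therefore evaluated. *)
Definition cextend n (u : completion J n) : ct_operad_sig A P n.
Proof.
exists (fun i => cfam (f (crep u (nil_bound (A i)))) i) => i j h.
set N := maxn (nil_bound (A i)) (nil_bound (A j)).
rewrite -(@ipow_cfam_eq _ _ (crep u N) _ j (leqnn _)); last first.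
  by apply: cseq_stable; exact: leq_maxr.
rewrite cfam_compat; apply: (ipow_cfam_eq (leqnn _)).
by apply: cseq_stable; exact: leq_maxl.
Defined.

Lemma cextend_cls n (u : cseq J n) i N : (nil_bound (A i) <= N)%N ->
  cfam (cextend (ccls u)) i = cfam (f (u N)) i.
Proof.
move=> HN; rewrite /= (ipow_cfam_eq (leqnn _) (crep_ccls u _)); symmetry.
by apply: (ipow_cfam_eq (leqnn _)); exact: cseq_stable.
Qed.

Lemma cextend_incl n (u : Q n) : cextend (completion_incl J u) = f u.
Proof. by apply: ctensP => i; rewrite (cextend_cls _ (leqnn _)). Qed.

Lemma cextend_map : operad_map cextend.
Proof.
have E n (u : cseq J n) i : cfam (f (crep (ccls u) (nil_bound (A i)))) i =
    cfam (f (u (nil_bound (A i)))) i.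
  exact: (ipow_cfam_eq (leqnn _) (crep_ccls u _)).
split.
- move=> n c u v; rewrite -[u]crepK -[v]crepK clin_cls.
  by apply: ctensP => i; rewrite /= !E /= (om_lin Hf).
- move=> n b u; rewrite -[u]crepK [X in cextend X]cproj_cls.
  by apply: ctensP => i; rewrite /= !E /= (om_proj Hf).
- move=> n s u; rewrite -[u]crepK [X in cextend X]cact_cls.
  by apply: ctensP => i; rewrite /= !E /= (om_act Hf).
- move=> m n p h j u v; rewrite -[u]crepK -[v]crepK [X in cextend X]ccomp_cls.
  by apply: ctensP => i; rewrite /= !E /= (om_comp Hf).
Qed.

Lemma cextend_continuous n :
  lin_continuous (completion_top J n) (ct_top A (P n)) (@cextend n).
Proof.
by move=> i; exists (nil_bound (A i)) => u Hu; exact: (ipow_vanish (leqnn _) Hu).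
Qed.

End ExtendToCompletion.

(** * Presented operads *)

Section PresentedMaps.
Variables (k : fieldType) (S : presentation k).

(** The elements of a presented operad are the classes of formal operadic
    expressions in the generators. *)
Lemma presented_ind (D : forall n, presented S n -> Prop) :
  (forall n (g : gens S n), D n (generator g)) ->
  (forall n c (u v : presented S n), D n u -> D n v -> D n (c *: u + v)) ->
  (forall n b (u : presented S n), D n u -> D n (gproj b u)) ->
  (forall n (s : 'S_n) (u : presented S n), D n u -> D n (oact s u)) ->
  (forall m n p (h : p.+1 = (m + n)%N) (i : 'I_m)
     (u : presented S m) (v : presented S n),
     D m u -> D n v -> D p (ocomp h i u v)) ->
  (forall n, D n 0) ->
  forall n (u : presented S n), D n u.
Proof.
move=> Dg Dl Dp Da Dc D0 n u; rewrite -[u]prepK; elim: (prep u) => {n u}.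
- by move=> n g; exact: Dg.
- by move=> n; exact: D0.
- move=> n t Ht u Hu; have := Dl n 1 _ _ Ht Hu; rewrite scale1r.
  by congr (D n _); apply/pclsP => Q I HI /=; rewrite !eval_prep.
- move=> n c t Ht; have := Dl n c _ _ Ht (D0 n); rewrite addr0.
  by congr (D n _); apply/pclsP => Q I HI /=; rewrite !eval_prep.
- move=> n b t Ht; have := Dp n b _ Ht.
  by congr (D n _); apply/pclsP => Q I HI /=; rewrite !eval_prep.
- move=> n s t Ht; have := Da n s _ Ht.
  by congr (D n _); apply/pclsP => Q I HI /=; rewrite !eval_prep.
- move=> m n p h i t Ht u Hu; have := Dc m n p h i _ _ Ht Hu.
  by congr (D p _); apply/pclsP => Q I HI /=; rewrite !eval_prep.
Qed.

Variables (Q : operad k) (I : forall n, gens S n -> Q n).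
Hypothesis HI : rels I.

Definition presented_map n (u : presented S n) : Q n := eval I (prep u).

Lemma presented_map_gen n (g : gens S n) : presented_map (generator g) = I g.
Proof. exact: (eval_prep _ HI). Qed.

Lemma presented_map_is_map : operad_map presented_map.
Proof.
split=> [n c u v|n b u|n s u|m n p h i u v];
  rewrite /presented_map /= eval_prep //=.
by rewrite (eval_prep _ HI).
Qed.

End PresentedMaps.

(** * Freely adjoining an element *)

Section Adjoin.
Variables (k : fieldType) (O : operad k).

Lemma adjoin_incl_map : operad_map (@adjoin_incl k O).
Proof.
split=> [n c u v|n b u|n s u|m n p h i u v]; apply/pclsP => Q I HI /=;
  rewrite ?eval_prep //= ?eval_prep //=; case: HI => HI _.
- exact: (om_lin HI).
- exact: (om_proj HI).
- exact: (om_act HI).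
- exact: (om_comp HI).
Qed.

Variables (Q : operad k) (f : forall n, O n -> Q n) (x : Q 0%N).
Hypotheses (Hf : operad_map f) (Hx : homog false x).

Definition adjoin_values n (g : gens (adj_presentation O) n) : Q n :=
  match g in adj_gens _ n' return Q n' with
  | AdjOld _ u => f u
  | AdjX => x
  end.

Lemma adjoin_values_rels : @rels k (adj_presentation O) Q adjoin_values.
Proof. by split. Qed.

Definition adjoin_map : forall n, adjoin O n -> Q n :=
  presented_map (S := adj_presentation O) adjoin_values.

Lemma adjoin_map_is_map : operad_map adjoin_map.
Proof. exact: (presented_map_is_map adjoin_values_rels). Qed.

Lemma adjoin_map_incl n (u : O n) : adjoin_map (adjoin_incl u) = f u.
Proof. exact: (presented_map_gen adjoin_values_rels (AdjOld u)). Qed.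

Lemma adjoin_map_x : adjoin_map (adjoin_x O) = x.
Proof. exact: (presented_map_gen adjoin_values_rels (AdjX O)). Qed.

End Adjoin.

Lemma formal_incl_map (k : fieldType) (O : operad k) :
  operad_map (@formal_incl k O).
Proof.
have [H1 H2 H3 H4] := completion_incl_map (gen_ideal (adjoin_x O)).
have [K1 K2 K3 K4] := adjoin_incl_map O.
split=> [n c u v|n b u|n s u|m n p h i u v]; rewrite /formal_incl.
- by rewrite K1 H1.
- by rewrite K2 H2.
- by rewrite K3 H3.
- by rewrite K4 H4.
Qed.

Lemma formal_x_even (k : fieldType) (O : operad k) : homog false (formal_x O).
Proof.
rewrite /homog -(om_proj (completion_incl_map (gen_ideal (adjoin_x O)))).
congr completion_incl; apply/pclsP => Q I HI /=; rewrite eval_prep //=.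
by case: HI.
Qed.

Section Fill.
Variable k : fieldType.

Lemma fill_lin (P : operad_sig k) (x : P 0%N) n : linear (@fill k P x n).
Proof.
elim: n => [|n IH] c u v //=.
by rewrite ocomp_linl IH.
Qed.

Lemma fill_map (P Q : operad_sig k) (f : forall n, P n -> Q n) (x : P 0%N) n
    (u : P n) : operad_map f -> f 0%N (fill x u) = fill (f 0%N x) (f n u).
Proof.
by move=> Hf; elim: n u => [//|n IH] u; rewrite [LHS]IH (om_comp Hf).
Qed.

End Fill.

(** * Arity zero *)

Section ArityZero.
Variables (k : fieldType) (A : formal_cdga k) (V : dgvect k).
Let W := pirev V.

(** This gives A_+ (x) E(Pi V)(0) = A_+ (x) Pi V, from Hom(k, W) = W. *)
Lemma tmap_cancel (B : ncdga k) (U U' : lmodType k) (g : U -> U') (h : U' -> U)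
    (t : tens B U) : linear g -> linear h -> cancel g h ->
  tmap id h (tmap id g t) = t.
Proof.
move=> Hg Hh gh; apply: (tens_ext (f := fun t => tmap id h (tmap id g t)) (g := id)) => //.
  by apply: linear_comp_fun; exact: tmap_lin.
by move=> a w; rewrite !tmap_pure // gh.
Qed.

Lemma ml_eval0K : cancel (@ml_eval0 k W) (@ml_const k W).
Proof.
move=> f; apply: mlinP => v; rewrite /= /ml_eval0.
by congr (mfun f _); apply: funext => -[].
Qed.

Lemma arity0_toK : cancel (@arity0_to k A V) (@arity0_of k A V).
Proof.
move=> y; apply: ctensP => i.
exact: (tmap_cancel _ (@ml_eval0_lin k W) (@ml_const_lin k W) ml_eval0K).
Qed.

Lemma arity0_ofK : cancel (@arity0_of k A V) (@arity0_to k A V).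
Proof.
move=> y; apply: ctensP => i.
exact: (tmap_cancel _ (@ml_const_lin k W) (@ml_eval0_lin k W) (frefl _)).
Qed.

Lemma ml_eval0_proj b (f : endo_gmod W 0) : ml_eval0 (gproj b f) = gproj b (ml_eval0 f).
Proof.
rewrite /ml_eval0 (@endo_projE k W 0 b f (fun _ => false)) => [|[]//].
by rewrite big_ord0 addbF.
Qed.

Lemma arity0_to_proj b (y : alg_target A V 0%N) :
  arity0_to (gproj b y) = gproj b (arity0_to y).
Proof.
apply: ctensP => i /=; move: (cfam y i).
have L0 := @ml_eval0_lin k W.
apply: (tens_homog_ind (@endo_graded k W 0)) => [t u Ht Hu|c d a w Ha Hw].
  by rewrite !(tprojD, tmapD _ _ _ L0) Ht Hu.
have Hw' : homog d (ml_eval0 w) by rewrite /homog -ml_eval0_proj Hw.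
rewrite tmap_pure // (tproj_pure _ (@endo_graded k W 0) Ha Hw).
rewrite (tproj_pure _ (dv_graded W) Ha Hw').
by case: ifP => _; rewrite ?tmap_pure // (lin0 (tmap_lin id L0)).
Qed.

Lemma arity0_to_diff (y : alg_target A V 0%N) :
  arity0_to (odiff y) = ct_diff (dv_lin (V := W)) (arity0_to y).
Proof.
apply: ctensP => i /=; move: (cfam y i).
have L0 := @ml_eval0_lin k W; have LD := @endo_diff_lin k W 0.
have Ld := @dv_lin k W.
apply: (tens_homog_ind (@endo_graded k W 0)) => [t u Ht Hu|c d a w Ha Hw].
  rewrite (tdiffD _ _ LD) (tmapD _ (tdiff _ t) _ L0) Ht Hu.
  by rewrite (tmapD _ t u L0) (tdiffD _ _ Ld).
rewrite tmap_pure // (tdiff_pure _ LD Ha) (tdiff_pure _ Ld Ha) tmapD //.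
rewrite (linZ _ _ (tmap_lin id L0)) !tmap_pure //.
have -> // : ml_eval0 (endo_diff w) = dv_d (ml_eval0 w).
by rewrite /ml_eval0 endo_diffE big_ord0 subr0.
Qed.

End ArityZero.

(** * Algebras over the Maurer-Cartan operad *)

Section MaurerCartan.
Variables (k : fieldType) (O : dgoperad k) (phi : forall n, linf k n -> O n).
Variables (A : formal_cdga k) (V : dgvect k).

Definition mc_series (f : forall n, O n -> alg_target A V n)
    (y : alg_target A V 0%N) (N : nat) : alg_target A V 0%N :=
  \sum_(n < N) (n.+1`!%:R : k)^-1 *: fill y (f _ (phi (linf_m k n))).

Lemma mc_lhs_arity0 f (y : alg_target A V 0%N) N :
  mc_lhs phi f (arity0_to y) N = arity0_to (odiff y - mc_series f y N).
Proof.
have L : linear (@arity0_to k A V) by exact: ct_map_lin.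
rewrite /mc_lhs arity0_toK -arity0_to_diff (linB _ _ L); congr (_ + _).
rewrite /mc_series (lin_sum _ _ L) -sumrN; apply: eq_bigr => n _.
by rewrite (linZ _ _ L) -scalerN /mu (linN _ (fill_lin y (n := n.+1))) (linN _ L).
Qed.

(** As mu_n is - f(phi(m_n)), the equation says that the series of f at y
    converges to d(y). *)
Lemma MC_arity0 f (y : alg_target A V 0%N) :
  MC phi f (arity0_to y) <->
  homog false y /\ converges (ct_top A (endo (pirev V) 0%N)) (mc_series f y) (odiff y).
Proof.
rewrite /MC /homog -arity0_to_proj.
split=> [[Hy Hc]|[Hy Hc]]; split.
- exact: (can_inj (@arity0_toK k A V)).
- move=> i; have [N0 HN] := Hc i; exists N0 => N /HN.
  rewrite mc_lhs_arity0 subr0 => H; rewrite -opprB.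
  set z := odiff y - mc_series f y N in H *.
  have -> : - z = - arity0_of (arity0_to z) by rewrite arity0_toK.
  change (- tmap id (@ml_const k (pirev V)) (cfam (arity0_to z) i) = 0).
  change (cfam (arity0_to z) i = 0) in H.
  by rewrite H (lin0 (tmap_lin id (@ml_const_lin _ _))) oppr0.
- by rewrite Hy.
- move=> i; have [N0 HN] := Hc i; exists N0 => N /HN.
  rewrite mc_lhs_arity0 subr0 => H.
  pose z := mc_series f y N - odiff y; have Hz : cfam z i = 0 := H.
  have -> : odiff y - mc_series f y N = - z by rewrite opprB.
  change (tmap id (@ml_eval0 k (pirev V)) (- cfam z i) = 0).
  by rewrite Hz oppr0 (lin0 (tmap_lin id (@ml_eval0_lin _ _))).
Qed.

Variable M : mc_structure phi.
Variable g : forall n, mc_dg M n -> alg_target A V n.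
Hypotheses (Hg : operad_map g)
  (gC : forall n, lin_continuous (@mc_top k O phi M n)
     (ct_top A (endo (pirev V) n)) (@g n)).

(** The value of g on d(x) is the sum of the Maurer-Cartan series at g(x): g is
    continuous and sends the partial sums to the partial sums. *)
Lemma mc_series_converges :
  converges (ct_top A (endo (pirev V) 0%N))
    (mc_series (fun n u => g (mc_incl M u)) (g (mc_x M)))
    (g (odiff (mc_x M))).
Proof.
move=> i; have [j Hj] := gC i; have [N0 HN] := mc_d_x M j.
exists N0 => N /HN /Hj; rewrite (linB _ _ (@om_lin _ _ _ _ Hg 0)) => H.
suff -> : mc_series (fun n u => g (mc_incl M u)) (g (mc_x M)) N =
    g (mc_partial phi N : mc_dg M 0%N) by [].
rewrite /mc_partial (lin_sum _ _ (@om_lin _ _ _ _ Hg 0)); apply: eq_bigr => n _.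
rewrite (linZ _ _ (@om_lin _ _ _ _ Hg 0)); congr (_ *: _).
by rewrite (fill_map _ _ Hg).
Qed.

End MaurerCartan.

(** * Compatibility with the differentials *)

Section ContinuousDerivations.
Variables (k : fieldType) (Q : operad k) (J : ideal Q).
Variables (A : formal_cdga k) (P : dgoperad_sig k).
Variable d : forall n, completion J n -> completion J n.
Hypotheses (Hd : forall n, linear (@d n))
  (dC : forall n, lin_continuous (completion_top J n) (completion_top J n) (@d n)).
Variable f : forall n, Q n -> ct_dgoperad_sig A P n.
Hypothesis Hf : operad_map f.

(** Modulo a neighbourhood of 0 an element of the completion is a constant
    sequence, and both composites are continuous. *)
Lemma cextend_diff :
  (forall n (u : Q n), cextend Hf (d (completion_incl J u)) = odiff (f u)) ->
  forall n (u : completion J n), cextend Hf (d u) =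
    odiff (cextend Hf u : ct_dgoperad_sig A P n).
Proof.
move=> H n u; apply: ctensP => i.
have gL := @om_lin _ _ _ _ (cextend_map J Hf) n.
have [M0 HM0] := cextend_continuous J Hf (n := n) i.
have [M HM] := dC (n := n) M0.
set N := maxn M (nil_bound (A i)).
pose v := completion_incl J (crep u N).
have E : cfam (cextend Hf (d (u - v))) i = 0.
  apply: HM0; apply: HM => /=.
  pose s := cseq_add (cseq_scale (-1) (cconst J (crep u N))) (crep u).
  have -> : u - v = ccls s by rewrite -clin_cls crepK scaleN1r addrC.
  rewrite -[crep _ M](subrK (s M)); apply: ipowD; first exact: crep_ccls.
  rewrite /= scaleN1r addrC -opprB; apply: ipowN; apply: cseq_stable.
  exact: leq_maxl.
have {}E : cfam (cextend Hf (d u)) i = cfam (cextend Hf (d v)) i.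
  apply/eqP; rewrite -subr_eq0 -[X in _ == X]E (linB _ _ (@Hd n)) (linB _ _ gL).
  exact: eqxx.
rewrite E /v H /=; congr (tdiff _ _).
by rewrite -(cextend_cls Hf _ (leq_maxr M _)) crepK.
Qed.

End ContinuousDerivations.

Lemma om_koszul (k : fieldType) (P Q : operad_sig k) (f : forall n, P n -> Q n)
    n e (u : P n) : operad_map f -> f n (koszul e u) = koszul e (f n u).
Proof.
move=> Hf; rewrite /koszul; case: e => //.
by rewrite (linB _ _ (@om_lin _ _ _ _ Hf n)) !(om_proj Hf).
Qed.

Section Forward.
Variables (k : fieldType) (O : dgoperad k) (phi : forall n, linf k n -> O n).
Variables (M : mc_structure phi) (A : formal_cdga k) (V : dgvect k).
Variables (f : forall n, O n -> alg_target A V n) (y : alg_target A V 0%N).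
Hypotheses (Hf : dgoperad_map f) (y_even : homog false y).
Hypothesis y_mc :
  converges (ct_top A (endo (pirev V) 0%N)) (mc_series phi f y) (odiff y).

Let T : operad k := Operad (ct_is_operad A (endo_is_operad (pirev V))).
Let U := underlying O.

Definition adjoin_ext : forall n, adjoin U n -> T n :=
  adjoin_map (O := U) (Q := T) f y.

Lemma adjoin_ext_map : operad_map adjoin_ext.
Proof. exact: (adjoin_map_is_map (O := U) (Q := T) Hf.1 y_even). Qed.

Definition mc_ext : forall n, mc_dg M n -> alg_target A V n :=
  cextend (J := gen_ideal (adjoin_x U)) adjoin_ext_map.

Lemma mc_ext_map : operad_map mc_ext.
Proof. exact: cextend_map. Qed.

Lemma mc_ext_continuous n :
  lin_continuous (@mc_top k O phi M n) (ct_top A (endo (pirev V) n)) (@mc_ext n).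
Proof. exact: cextend_continuous. Qed.

Lemma mc_ext_incl n (u : O n) : mc_ext (mc_incl M u) = f u.
Proof.
rewrite /mc_ext [LHS]cextend_incl.
exact: (adjoin_map_incl (O := U) (Q := T) Hf.1 y_even u).
Qed.

Lemma mc_ext_x : mc_ext (mc_x M) = y.
Proof.
rewrite /mc_ext [LHS]cextend_incl.
exact: (adjoin_map_x (O := U) (Q := T) Hf.1 y_even).
Qed.

(** Both sides are the limit of the Maurer-Cartan series at y. *)
Lemma mc_ext_diff_x : mc_ext (odiff (mc_x M)) = odiff y.
Proof.
apply: ctensP => i.
have [N0 H0] := mc_series_converges mc_ext_map mc_ext_continuous i.
have [N1 H1] := y_mc i.
have := H1 _ (leq_maxr N0 N1); have := H0 _ (leq_maxl N0 N1).
have -> : mc_series phi (fun n u => mc_ext (mc_incl M u)) (mc_ext (mc_x M)) =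
    mc_series phi f y.
  apply: funext => N; rewrite mc_ext_x; apply: eq_bigr => n _.
  by rewrite mc_ext_incl.
move: (mc_series _ _ _ _) => s E E'.
have {}E : cfam s i - cfam (mc_ext (odiff (mc_x M))) i = 0 := E.
have {}E' : cfam s i - cfam (odiff y) i = 0 := E'.
by move/subr0_eq: E => <-; move/subr0_eq: E'.
Qed.

(** On O this is the hypothesis on f, on x it is [mc_ext_diff_x], and the operad
    operations are handled by the rules of a derivation. *)
Lemma mc_ext_dg : dgoperad_map mc_ext.
Proof.
split; first exact: mc_ext_map.
have [iL iP iA iC] := completion_incl_map (gen_ideal (adjoin_x U)).
have [eL eP eA eC] := adjoin_ext_map.
have [gL gP gA gC] := mc_ext_map.
have [dL dP dA dC] := differential_derivation (mc_d_diff M).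
have [tL tP tA tC] : is_derivation (P := T) (@odiff k (alg_target A V)).
  exact: (@ct_derivation k A (endo (pirev V)) (endo_is_operad (pirev V))
    (endo_derivation (pirev V))).
apply: (cextend_diff (J := gen_ideal (adjoin_x U)) dL (@mc_d_continuous _ _ _ M)).
refine (@presented_ind k (adj_presentation U) (fun n u =>
  mc_ext (mc_d M (completion_incl (gen_ideal (adjoin_x U)) u)) =
  odiff (adjoin_ext u : alg_target A V n)) _ _ _ _ _ _).
- move=> n [{}n u|]; last first.
    rewrite [RHS](_ : _ = odiff y); first exact: mc_ext_diff_x.
    by congr odiff; exact: (adjoin_map_x (O := U) (Q := T) Hf.1 y_even).
  rewrite [mc_d M _](mc_d_incl M) [LHS]mc_ext_incl Hf.2; congr odiff.
  by symmetry; exact: (adjoin_map_incl (O := U) (Q := T) Hf.1 y_even u).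
- by move=> n c u v Hu Hv; rewrite iL dL [LHS]gL Hu Hv eL [RHS]tL.
- move=> n b u Hu; rewrite iP eP -[b]negbK -dP [LHS]gP Hu.
  by rewrite [LHS]tP negbK.
- by move=> n s u Hu; rewrite iA dA [LHS]gA Hu eA [RHS]tA.
- move=> m n p h i u v Hu Hv; rewrite iC dC.
  rewrite [LHS](linD _ _ (gL p)) !gC Hu Hv eC [RHS]tC.
  rewrite (om_koszul _ _ mc_ext_map); congr (ocomp h i _ _ + ocomp h i (koszul true _) _).
    exact: (cextend_incl _ adjoin_ext_map v).
  exact: (cextend_incl _ adjoin_ext_map u).
- move=> n; rewrite (lin0 (iL n)) (lin0 (dL n)) [LHS](lin0 (gL n)).
  by rewrite (lin0 (eL n)) [RHS](lin0 (tL n)).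
Qed.

End Forward.

Unset Implicit Arguments.

Theorem theorem6p5 (k : fieldType) (char0 : [pchar k] =i pred0)
    (L : linf_structure k) (O : dgoperad k) (phi : forall n, linf_dg L n -> O n)
    (phi_map : dgoperad_map phi) (OMC : mc_structure phi)
    (A : formal_cdga k) (V : dgvect k) :
  (forall (f : forall n, O n -> alg_target A V n),
     alg_structure (fun n => discrete (O n)) f ->
     forall xi : ct_gmod A (pirev V), MC phi f xi ->
     exists g : forall n, mc_dg OMC n -> alg_target A V n,
       [/\ alg_structure (mc_top OMC) g,
           forall n (u : O n), g n (mc_incl OMC u) = f n u &
           arity0_to (g 0%N (mc_x OMC)) = xi]) /\
  (forall (g : forall n, mc_dg OMC n -> alg_target A V n),
     alg_structure (mc_top OMC) g ->
     let f := fun n (u : O n) => g n (mc_incl OMC u) in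
     alg_structure (fun n => discrete (O n)) f /\
     MC phi f (arity0_to (g 0%N (mc_x OMC)))).
Proof.
split=> [f [Hf _] xi|g [[gM gd] gC] f].
  rewrite -(arity0_ofK xi) => /MC_arity0[y_even y_mc].
  exists (mc_ext (M := OMC) Hf y_even); split.
  - by split; [exact: (mc_ext_dg OMC Hf y_even y_mc) | exact: mc_ext_continuous].
  - by move=> n u; exact: mc_ext_incl.
  - by rewrite mc_ext_x.
have iM := formal_incl_map (underlying O).
split.
  split; last first.
    move=> n i; exists tt => u ->; rewrite /f.
    have -> : mc_incl OMC (0 : O n) = 0 by exact: (lin0 (@om_lin _ _ _ _ iM n)).
    by rewrite (lin0 (@om_lin _ _ _ _ gM n)).
  split.
    case: iM gM => [iL iP iA iC] [gL gP gA gC'].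
    split=> [n c u v|n b u|n s u|m n p h i u v]; rewrite /f /mc_incl.
    - by rewrite iL [LHS]gL.
    - by rewrite iP [LHS]gP.
    - by rewrite iA [LHS]gA.
    - by rewrite iC [LHS]gC'.
  by move=> n u; rewrite /f -gd; congr (g n _); symmetry; exact: (mc_d_incl OMC).
apply/MC_arity0; split.
  rewrite /homog -(om_proj gM); congr (g 0%N _).
  exact: (formal_x_even (underlying O)).
rewrite -gd; exact: mc_series_converges.
Qed.
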